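(* Let $k\geq6$ be even and $p\in W_k^{\mathrm{even}}$. Then $$\sum_{\substack{3\leq r\leq k-3\\ r\ \mathrm{odd}}}\widehat c_r(p)\,H_{r,k-r}=0\qquad\text{in }\widetilde{\mathcal D}_k.$$ Consequently, $$\sum_{\substack{3\leq r\leq k-3\\ r\ \mathrm{odd}}}\widehat c_r(p)\,\zeta_{\mathcal A}(r-1,1,k-r-1,1)=0$$ holds unconditionally for finite multiple zeta values. Assume that for all $a,b,c\ge1$ with $a+b+c=k$ the identity $$\zeta_{\mathcal A}^{\mathrm f}(a,b,c)=(-1)^{b-1}\sum_{\substack{n+m=k-1\\ n,m\ge1}}\binom na\binom mc\,\zeta_{\mathcal A}^{\mathrm f}(n,1,m)+(-1)^{a+c}\sum_{i=1}^{b-1}\binom{a+i}{a}\binom{b+c-i}{c}\,\mathfrak z^{\mathrm f}(a+i)\,\mathfrak z^{\mathrm f}(b+c-i)$$ holds in $\mathcal Z_{\mathcal A}^{\mathrm f}$. Then the analogous relation $\sum_{3\le r\le k-3,\ r\text{ odd}}\widehat c_r(p)\,\zeta_{\mathcal A}^{\mathrm f}(r-1,1,k-r-1,1)=0$ holds in $\mathcal Z_{\mathcal A}^{\mathrm f}$. If $\det A_k\neq0$, the relations $\sum_r\widehat c_r(p)H_{r,k-r}=0$, as $p$ varies in $W_k^{\mathrm{even}}$, span the space of all linear relations among the $H_{r,s}$ ($r,s\ge3$ odd, $r+s=k$) in $\widetilde{\mathcal D}_k$, and they vanish identically (that is, $\widehat c_r(p)=0$ for all $r$) only for $p\in\mathbb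 Q(X^{k-2}-Y^{k-2})$.
   Context: Formal double zeta space. For $k\ge3$, $\mathcal D_k$ is the $\mathbb Q$-vector space generated by symbols $Z_{r,s},P_{r,s}$ ($r,s\ge1$, $r+s=k$) and $Z_k$ subject to $$P_{r,s}=Z_{r,s}+Z_{s,r}+Z_k=\sum_{\substack{a+b=k\\ a,b\ge1}}\left[\binom{a-1}{r-1}+\binom{a-1}{s-1}\right]Z_{a,b}.$$ For even $k$, $\widetilde{\mathcal D}_k=\mathcal D_k\big/\bigl(\mathbb QZ_k+\mathbb QZ_{1,k-1}+\mathrm{span}_{\mathbb Q}\{P_{r,s}:r,s\text{ even},\ r+s=k\}\bigr)$; the same symbols denote classes in the quotient. For odd $r,s\ge3$ with $r+s=k$, $$H_{r,s}=\frac12\Bigg((rs-r+1)Z_{r,s}+(rs+s-1)Z_{s,r}+(s+1)Z_{s+1,r-1}-(r+1)Z_{r+1,s-1}+\sum_{\substack{3\le\ell\le k-3\\ \ell\text{ odd}}}\left(\binom{k-\ell}{s}-\binom{k-\ell}{r}\right)P_{\ell,k-\ell}\Bigg).$$ The matrix $A_k$. Let $B_\nu$ be the Bernoulli numbers with $B_1=-\frac12$, and $B_\nu=0$ for $\nu<0$. For odd $m$ with $1\le m\le k-3$ and $r+s=k$ put $\lambda'_{m,k-m}(r,s)=\sum_{\ell=0}^{r-2}\binom{k-2-\ell}{m-1}\binom{r-1}{\ell}B_{k-m-\ell-1}$. In $\widetilde{\mathcal D}_k$ one has, for odd $r,s\ge3$ with $r+s=k$, $$2H_{r,s}=(rs-r+1)Z_{r,s}+(rs+s-1)Z_{s,r}+\sum_{\substack{3\le\ell\le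 k-3\\ \ell\text{ odd}}}\left(\binom{k-\ell}{s}-\binom{k-\ell}{r}\right)(Z_{\ell,k-\ell}+Z_{k-\ell,\ell})+2\sum_{\substack{r'+s'=k\\ r',s'\ge1\text{ odd}}}\left(\frac{r+1}{r}\lambda'_{r,s}(r',s')-\frac{s+1}{s}\lambda'_{s,r}(r',s')\right)Z_{r',s'}.$$ Substituting $Z_{1,k-1}=0$ and $Z_{k-1,1}=-\sum_{3\le a\le k-3,\ a\text{ odd}}Z_{a,k-a}$ in the right-hand side gives $2H_{r,s}=\sum_{3\le r'\le k-3,\ r'\text{ odd}}A_{r,r'}Z_{r',k-r'}$, and $A_k=(A_{r,r'})$, with rows and columns indexed by the odd integers between $3$ and $k-3$. Explicitly, for odd $3\le r\le k-3$, $s=k-r$, and odd $1\le m\le k-1$ let $$M_{r,m}=(rs-r+1)\delta_{m,r}+(rs+s-1)\delta_{m,s}+\epsilon_m\left(\binom{k-m}{s}-\binom{k-m}{r}+\binom ms-\binom mr\right)+2\left(\frac{r+1}{r}\lambda'_{r,s}(m,k-m)-\frac{s+1}{s}\lambda'_{s,r}(m,k-m)\right),$$ with $\epsilon_m=1$ if $3\le m\le k-3$ and $\epsilon_m=0$ otherwise; then $A_{r,r'}=M_{r,r'}-M_{r,k-1}$. Period polynomials. $W_k^{\mathrm{even}}$ is the space of homogeneous polynomials $p\in\mathbb Q[X,Y]$ of degree $k-2$ with $p(X,Y)=p(X+Y,Y)-p(X+Y,X)$. For $p\in W_k^{\mathrm{even}}$ define $q_{r,s}\in\mathbb Q$ ($r,s\ge1$,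 $r+s=k$) by $p(X+Y,Y)=\sum_{r+s=k}\binom{k-2}{r-1}q_{r,s}X^{r-1}Y^{s-1}$. For odd $r$ with $3\le r\le k-3$, $\widehat c_r(p)$ is the determinant of the matrix obtained from $A_k$ by replacing the row indexed by $r$ by $\bigl(2(q_{r',k-r'}-q_{k-1,1})\bigr)_{r'}$, where $r'$ runs over the odd integers from $3$ to $k-3$. Finite multiple zeta values. $\mathcal A=\prod_p\mathbb Z/p\mathbb Z\big/\bigoplus_p\mathbb Z/p\mathbb Z$ ($p$ over all primes), $\zeta_{\mathcal A}(k_1,\ldots,k_r)=\bigl(\sum_{p>m_1>\cdots>m_r>0}m_1^{-k_1}\cdots m_r^{-k_r}\bmod p\bigr)_p\in\mathcal A$. Formal finite multiple zeta values. Let $\mathfrak H=\mathbb Q\langle x,y\rangle$, $\mathfrak H^1=\mathbb Q+\mathfrak Hy$, $z_k=x^{k-1}y$. The words in $\mathfrak H^1$ are the empty word $\mathbf 1$ and $z_{k_1}\cdots z_{k_r}$, of weight $\mathrm{wt}=k_1+\cdots+k_r$. The stuffle product $*$ on $\mathfrak H^1$ is bilinear with $\mathbf 1*w=w*\mathbf 1=w$, $z_aw*z_bv=z_a(w*z_bv)+z_b(z_aw*v)+z_{a+b}(w*v)$. The shuffle product $\mathrm{sh}$ on $\mathfrak H$ is bilinear with $\mathbf 1\,\mathrm{sh}\,w=w\,\mathrm{sh}\,\mathbf 1=w$, $au\,\mathrm{sh}\,bv=a(u\,\mathrm{sh}\,bv)+b(au\,\mathrm{sh}\,v)$ for $a,b\in\{x,y\}$.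 Let $\mathfrak H^1_*$ be $\mathfrak H^1$ with product $*$ and $R(z_{k_1}\cdots z_{k_r})=z_{k_r}\cdots z_{k_1}$. $\mathcal Z_{\mathcal A}^{\mathrm f}=\mathfrak H^1_*/\mathfrak L$, where $\mathfrak L$ is the ideal of $\mathfrak H^1_*$ generated by $w\,\mathrm{sh}\,v-(-1)^{\mathrm{wt}(w)}R(w)v$ for all words $w,v\in\mathfrak H^1$; $\zeta_{\mathcal A}^{\mathrm f}(k_1,\ldots,k_r)$ is the class of $z_{k_1}\cdots z_{k_r}$. Set $\mathfrak z^{\mathrm f}(1)=0$ and $\mathfrak z^{\mathrm f}(n)=\frac1n\zeta_{\mathcal A}^{\mathrm f}(n-1,1)$ for $n\ge2$. *)

(* Defs.v *)
From HB Require Import structures.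
From mathcomp Require Import all_boot all_order all_algebra.
From mathcomp Require Import generic_quotient ring_quotient finmap.
From mathcomp Require Import boolp zify ring.
From mathcomp Require Import monalg.

Set Implicit Arguments.
Unset Strict Implicit.
Unset Printing Implicit Defensive.

Import GRing.Theory.

Local Open Scope ring_scope.
Local Open Scope quotient_scope.

Section SpanQuotient.
Variables (R : pzRingType) (V : lmodType R).
Implicit Type G : V -> Prop.

Definition spanp G : pred V := fun v =>
  `[< exists2 s : seq (R * V), (forall t, t \in s -> G t.2)
        & v = \sum_(t <- s) t.1 *: t.2 >].

Lemma spanpP G v :
  reflect (exists2 s : seq (R * V), (forall t, t \in s -> G t.2)
             & v = \sum_(t <- s) t.1 *: t.2) (v \in spanp G).
Proof. exact: asboolP. Qed.

Lemma spanp_submod_closed G : submod_closed (spanp G).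
Proof.
split=> [|a u v /spanpP[s sG ->] /spanpP[t tG ->]]; apply/spanpP.
  by exists [::]; rewrite ?big_nil.
exists ([seq (a * x.1, x.2) | x <- s] ++ t).
  by move=> x; rewrite mem_cat => /orP[/mapP[y /sG Gy ->]|/tG].
rewrite big_cat big_map scaler_sumr; congr (_ + _).
by apply: eq_bigr => x _; rewrite scalerA.
Qed.

HB.instance Definition _ G :=
  GRing.isSubmodClosed.Build R V (spanp G) (spanp_submod_closed G).

Definition span_zmod G : zmodClosed V := GRing.ZmodClosed.clone V (spanp G) _.

Definition lquot G : Type := Quotient.quot (span_zmod G).

HB.instance Definition _ G := GRing.Zmodule.on (lquot G).

Definition lproj G (v : V) : lquot G := \pi_(Quotient.quot (span_zmod G)) v.

Lemma lproj_eq G u v : (lproj G u = lproj G v) <-> (u - v \in spanp G).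
Proof.
rewrite -[_ \in _]/(_ \in span_zmod G) Quotient.idealrBE; split=> [e|/eqP //].
by apply/eqP; exact: e.
Qed.

Lemma lproj_surj G (x : lquot G) : exists v, x = lproj G v.
Proof. by exists (repr x); rewrite /lproj reprK. Qed.

Lemma lprojB G : {morph lproj G : u v / u - v}.
Proof. by move=> u v; exact: (@raddfB _ _ \pi_(Quotient.quot (span_zmod G))). Qed.

Definition lquot_scale G (a : R) (x : lquot G) : lquot G := lproj G (a *: repr x).

Lemma lproj_scale G a v : lproj G (a *: v) = lquot_scale a (lproj G v).
Proof.
apply/lproj_eq; rewrite -scalerBr rpredZ //.
by apply/lproj_eq; rewrite {2}/lproj reprK.
Qed.

Fact lquot_scaleA G a b (x : lquot G) :
  lquot_scale a (lquot_scale b x) = lquot_scale (a * b) x.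
Proof. by case: (lproj_surj x) => v ->; rewrite -!lproj_scale scalerA. Qed.

Fact lquot_scale1 G : left_id 1 (@lquot_scale G).
Proof. by move=> x; case: (lproj_surj x) => v ->; rewrite -lproj_scale scale1r. Qed.

Fact lprojD G : {morph lproj G : u v / u + v}.
Proof. by move=> u v; exact: (@raddfD _ _ \pi_(Quotient.quot (span_zmod G))). Qed.

Fact lquot_scaleDr G : right_distributive (@lquot_scale G) +%R.
Proof.
move=> a x y; case: (lproj_surj x) => u ->; case: (lproj_surj y) => v ->.
by rewrite -lprojD -!lproj_scale -lprojD scalerDr.
Qed.

Fact lquot_scaleDl G (x : lquot G) :
  {morph (@lquot_scale G)^~ x : a b / a + b}.
Proof.
move=> a b; case: (lproj_surj x) => v ->.
by rewrite -!lproj_scale -lprojD scalerDl.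
Qed.

HB.instance Definition _ G := GRing.Zmodule_isLmodule.Build R (lquot G)
  (@lquot_scaleA G) (@lquot_scale1 G) (@lquot_scaleDr G) (@lquot_scaleDl G).

Lemma lproj_is_linear G : linear (lproj G).
Proof. by move=> a u v; rewrite lprojD lproj_scale. Qed.

HB.instance Definition _ G :=
  GRing.isLinear.Build R V (lquot G) *:%R (lproj G) (@lproj_is_linear G).

Lemma lproj_eq0 G v : (lproj G v = 0) <-> (v \in spanp G).
Proof. by rewrite -(linear0 (lproj G)) lproj_eq subr0. Qed.

End SpanQuotient.

(* Index [i] of either copy of ['I_k.-1] stands for the pair (r, s) with
   r = i + 1 and s = k - r; the three summands index the symbols Z_{r,s},
   P_{r,s} and Z_k. *)
Definition dsym (k : nat) : finType := ('I_k.-1 + 'I_k.-1 + unit)%type.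

Definition dfree (k : nat) := {ffun dsym k -> rat^o}.

(* The basis vector of a symbol; it is 0 unless r, s >= 1 and r + s = k. *)
Definition symZ (k r s : nat) : dfree k := [ffun x : dsym k =>
  (if x is inl (inl i) then (i.+1 == r) && (r + s == k)%N else false)%:R].

Definition symP (k r s : nat) : dfree k := [ffun x : dsym k =>
  (if x is inl (inr i) then (i.+1 == r) && (r + s == k)%N else false)%:R].

Definition symZk (k : nat) : dfree k := [ffun x : dsym k =>
  (if x is inr _ then true else false)%:R].

Definition drel (k : nat) (v : dfree k) : Prop :=
  exists r s, [/\ (0 < r)%N, (0 < s)%N, (r + s = k)%N &
    v = symP k r s - (symZ k r s + symZ k s r + symZk k) \/
    v = symP k r s - \sum_(1 <= a < k)
          ('C(a - 1, r - 1) + 'C(a - 1, s - 1))%:R *: symZ k a (k - a)].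

Definition Dz (k : nat) : lmodType rat := lquot (@drel k).

Definition DZ (k r s : nat) : Dz k := lproj (@drel k) (symZ k r s).
Definition DP (k r s : nat) : Dz k := lproj (@drel k) (symP k r s).
Definition DZk (k : nat) : Dz k := lproj (@drel k) (symZk k).

Definition dtrel (k : nat) (v : Dz k) : Prop :=
  [\/ v = DZk k, v = DZ k 1 (k - 1) |
      exists r s, [/\ (0 < r)%N, (0 < s)%N, ~~ odd r, ~~ odd s &
        (r + s = k)%N /\ v = DP k r s]].

Definition Dtilde (k : nat) : lmodType rat := lquot (@dtrel k).

Definition DtZ (k r s : nat) : Dtilde k := lproj (@dtrel k) (DZ k r s).
Definition DtP (k r s : nat) : Dtilde k := lproj (@dtrel k) (DP k r s).

Definition Hdz (k r s : nat) : Dtilde k := 2%:R^-1 *: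
  ((r%:R * s%:R - r%:R + 1) *: DtZ k r s
   + (r%:R * s%:R + s%:R - 1) *: DtZ k s r
   + (s%:R + 1) *: DtZ k (s + 1) (r - 1)
   - (r%:R + 1) *: DtZ k (r + 1) (s - 1)
   + \sum_(3 <= l < k - 2 | odd l)
       ('C(k - l, s)%:R - 'C(k - l, r)%:R) *: DtP k l (k - l)).

Fixpoint bernoulli_seq (n : nat) : seq rat :=
  if n is m.+1 then
    let s := bernoulli_seq m in
    rcons s ((m == 0%N)%:R -
             m.+1%:R^-1 * \sum_(j < m) 'C(m.+1, j)%:R * nth 0 s j)
  else [::].

Definition bernoulli (n : nat) : rat := nth 0 (bernoulli_seq n.+1) n.

Lemma size_bernoulli_seq n : size (bernoulli_seq n) = n.
Proof. by elim: n => //= n IHn; rewrite size_rcons IHn. Qed.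

Lemma nth_bernoulli_seq n j : (j < n)%N ->
  nth 0 (bernoulli_seq n) j = bernoulli j.
Proof.
elim: n => // n IHn; rewrite ltnS leq_eqVlt => /orP[/eqP-> //|lt_jn].
by rewrite /= nth_rcons size_bernoulli_seq lt_jn IHn.
Qed.

Lemma bernoulli_rec n :
  \sum_(j < n.+1) 'C(n.+1, j)%:R * bernoulli j = (n == 0%N)%:R.
Proof.
rewrite big_ord_recr /= {2}/bernoulli /= nth_rcons size_bernoulli_seq ltnn eqxx.
under [pX in _ - _ * pX]eq_bigr do rewrite nth_bernoulli_seq //.
rewrite binSn mulrBr mulVKf ?Num.Theory.pnatr_eq0 // addrC subrK.
by case: n => [|n]; rewrite ?mulr0 ?mulr1.
Qed.

Definition bernoulliz (z : int) : rat := if z is Posz n then bernoulli n else 0.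

(* lambda'_{m,k-m}(r,s) with r + s = k. *)
Definition lambda' (k m r : nat) : rat :=
  \sum_(0 <= l < r.-1)
    'C(k - 2 - l, m - 1)%:R * 'C(r - 1, l)%:R
    * bernoulliz (k%:Z - m%:Z - l%:Z - 1).

Definition Mcoef (k r m : nat) : rat :=
  let s := (k - r)%N in
  (r%:R * s%:R - r%:R + 1) * (m == r)%:R
  + (r%:R * s%:R + s%:R - 1) * (m == s)%:R
  + (3 <= m <= k - 3)%N%:R
    * ('C(k - m, s)%:R - 'C(k - m, r)%:R + 'C(m, s)%:R - 'C(m, r)%:R)
  + 2%:R * ((r%:R + 1) / r%:R * lambda' k r m - (s%:R + 1) / s%:R * lambda' k s m).

(* For even k >= 6, the odd integers from 3 to k - 3 are the [od i], i < nod k. *)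
Definition nod (k : nat) : nat := (k./2 - 2)%N.
Definition od (k : nat) (i : 'I_(nod k)) : nat := i.*2.+3.

Lemma odP k r : (6 <= k)%N -> ~~ odd k ->
  (odd r && (3 <= r <= k - 3)%N) <-> exists i : 'I_(nod k), r = od i.
Proof.
move=> k6 ek; split=> [/andP[or r3]|[[i lt_i] ->]]; last first.
  by move: lt_i; rewrite /nod /od /=; lia.
have lt_r : (r./2.-1 < nod k)%N by move: r3 or; rewrite /nod; lia.
by exists (Ordinal lt_r); rewrite /od /=; lia.
Qed.

Definition Amx (k : nat) : 'M[rat]_(nod k) :=
  \matrix_(i, j) (Mcoef k (od i) (od j) - Mcoef k (od i) (k - 1)).

Definition primeT : Type := {p : nat | prime p}.

Definition prodF : Type := forall p : primeT, 'F_(val p).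

HB.instance Definition _ := gen_eqMixin prodF.
HB.instance Definition _ := gen_choiceMixin prodF.

Definition prodF_zero : prodF := fun=> 0.
Definition prodF_one : prodF := fun=> 1.
Definition prodF_opp (a : prodF) : prodF := fun p => - a p.
Definition prodF_add (a b : prodF) : prodF := fun p => a p + b p.
Definition prodF_mul (a b : prodF) : prodF := fun p => a p * b p.

Fact prodF_addA : associative prodF_add.
Proof. by move=> a b c; apply: functional_extensionality_dep => p; apply: addrA. Qed.
Fact prodF_addC : commutative prodF_add.
Proof. by move=> a b; apply: functional_extensionality_dep => p; apply: addrC. Qed.
Fact prodF_add0 : left_id prodF_zero prodF_add.
Proof. by move=> a; apply: functional_extensionality_dep => p; apply: add0r. Qed.
Fact prodF_addN : left_inverse prodF_zero prodF_opp prodF_add.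
Proof. by move=> a; apply: functional_extensionality_dep => p; apply: addNr. Qed.

HB.instance Definition _ :=
  GRing.isZmodule.Build prodF prodF_addA prodF_addC prodF_add0 prodF_addN.

Fact prodF_mulA : associative prodF_mul.
Proof. by move=> a b c; apply: functional_extensionality_dep => p; apply: mulrA. Qed.
Fact prodF_mulC : commutative prodF_mul.
Proof. by move=> a b; apply: functional_extensionality_dep => p; apply: mulrC. Qed.
Fact prodF_mul1 : left_id prodF_one prodF_mul.
Proof. by move=> a; apply: functional_extensionality_dep => p; apply: mul1r. Qed.
Fact prodF_mulD : left_distributive prodF_mul +%R.
Proof. by move=> a b c; apply: functional_extensionality_dep => p; apply: mulrDl. Qed.
Fact prodF_one_neq0 : prodF_one != 0.
Proof.
apply/eqP => e; have /eqP := congr1 (fun a : prodF => a (exist _ 2 isT)) e.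
by rewrite oner_eq0.
Qed.

HB.instance Definition _ := GRing.Zmodule_isComNzRing.Build prodF
  prodF_mulA prodF_mulC prodF_mul1 prodF_mulD prodF_one_neq0.

(* The ideal of families with finite support, i.e. the direct sum. *)
Definition fsupp : pred prodF := fun a =>
  `[< exists s : seq primeT, forall p, p \notin s -> a p = 0 >].

Lemma fsuppP (a : prodF) :
  reflect (exists s : seq primeT, forall p, p \notin s -> a p = 0) (a \in fsupp).
Proof. exact: asboolP. Qed.

Lemma fsupp_bound (a : prodF) :
  (exists N : nat, forall p : primeT, (N < val p)%N -> a p = 0) <-> a \in fsupp.
Proof.
split=> [[N aN]|/fsuppP[s as0]].
  apply/fsuppP; exists (pmap insub (iota 0 N.+1)) => p ps; apply: aN.
  by rewrite ltnNge; apply: contra ps => le_pN; rewrite mem_pmap_sub mem_iota.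
exists (\max_(p <- s) val p)%N => p lt_p; apply: as0.
by apply: contraL lt_p => ps; rewrite -leqNgt (leq_bigmax_seq (F := val)).
Qed.

Fact fsupp_idealr : idealr_closed fsupp.
Proof.
split=> [||a u v /fsuppP[s us] /fsuppP[t vt]].
- by apply/fsuppP; exists [::].
- apply/negP => /fsupp_bound[N one0].
  have [p lt_Np pr_p] := prime_above N.
  by have /eqP := one0 (exist _ p pr_p) lt_Np; rewrite oner_eq0.
apply/fsuppP; exists (s ++ t) => p; rewrite mem_cat negb_or => /andP[ps pt].
rewrite -[LHS]/(a p * u p + v p).
by rewrite us // vt // mulr0 addr0.
Qed.

HB.instance Definition _ := isIdealr.Build prodF fsupp fsupp_idealr.

Definition fsupp_ideal : idealr prodF := Idealr.clone prodF fsupp _.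

Definition calA : Type := Quotient.quot fsupp_ideal.

HB.instance Definition _ := GRing.ComNzRing.on calA.

Definition calA_class (a : prodF) : calA := \pi_(Quotient.quot fsupp_ideal) a.

Lemma calA_class_eq (a b : prodF) :
  (calA_class a = calA_class b) <-> (a - b \in fsupp).
Proof.
rewrite -[_ \in _]/(_ \in fsupp_ideal) Quotient.idealrBE; split=> [e|/eqP //].
by apply/eqP; exact: e.
Qed.

Lemma calA_surj (x : calA) : exists a, x = calA_class a.
Proof. by exists (repr x); rewrite /calA_class reprK. Qed.

(* c acts on the p-component through its residue mod p; [ratr c] is 0 for the
   finitely many p that divide the denominator. *)
Definition prodF_scale (c : rat) (a : prodF) : prodF := fun p => ratr c * a p.

Definition calA_scale (c : rat) (x : calA) : calA :=
  calA_class (prodF_scale c (repr x)).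

Lemma calA_class_scale c a : calA_class (prodF_scale c a) = calA_scale c (calA_class a).
Proof.
apply/calA_class_eq.
have /calA_class_eq/fsuppP[s as0] : calA_class a = calA_class (repr (calA_class a)).
  by rewrite {2}/calA_class reprK.
apply/fsuppP; exists s => p /as0 ap0.
rewrite -[LHS]/(ratr c * a p - ratr c * repr (calA_class a) p) -mulrBr.
by rewrite -[_ - _]/((a - repr (calA_class a)) p) ap0 mulr0.
Qed.

Lemma intF_neq0 (z : int) : z != 0 ->
  exists N : nat, forall p : primeT, (N < val p)%N -> z%:~R != 0 :> 'F_(val p).
Proof.
move=> z0; exists `|z|%N => -[p pr_p] /= lt_zp.
have z0' : `|z|%:R != 0 :> 'F_p.
  rewrite -(dvdn_pcharf (pchar_Fp pr_p)) gtnNdvd //.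
  by rewrite absz_gt0.
by case: (intP z) z0' {lt_zp z0} => // n; rewrite ?mulrNz ?oppr_eq0 ?abszN.
Qed.

Lemma ratr_denq (F : fieldType) (c : rat) : (denq c)%:~R != 0 :> F ->
  ratr c * (denq c)%:~R = (numq c)%:~R :> F.
Proof. by move=> d0; rewrite /ratr divfK. Qed.

Lemma ratrD_modp (c d : rat) : exists N : nat, forall p : primeT, (N < val p)%N ->
  ratr (c + d) = ratr c + ratr d :> 'F_(val p).
Proof.
have [Nc hc] := intF_neq0 (denq_neq0 c).
have [Nd hd] := intF_neq0 (denq_neq0 d).
have [Ns hs] := intF_neq0 (denq_neq0 (c + d)).
exists (Nc + Nd + Ns)%N => p lt_p.
have {}hc : (denq c)%:~R != 0 :> 'F_(val p) by apply: hc; lia.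
have {}hd : (denq d)%:~R != 0 :> 'F_(val p) by apply: hd; lia.
have {}hs : (denq (c + d))%:~R != 0 :> 'F_(val p) by apply: hs; lia.
apply: (mulIf (mulf_neq0 hs (mulf_neq0 hc hd))).
rewrite mulrA (ratr_denq hs).
have -> (x y u v w : 'F_(val p)) :
  (x + y) * (w * (u * v)) = (x * u * v + y * v * u) * w by ring.
rewrite (ratr_denq hc) (ratr_denq hd) -!rmorphM -rmorphD -rmorphM.
congr (_%:~R); apply: (@intr_inj rat).
rewrite !(rmorphD, rmorphM) /= !numqE.
by ring.
Qed.

Lemma ratrM_modp (c d : rat) : exists N : nat, forall p : primeT, (N < val p)%N ->
  ratr (c * d) = ratr c * ratr d :> 'F_(val p).
Proof.
have [Nc hc] := intF_neq0 (denq_neq0 c).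
have [Nd hd] := intF_neq0 (denq_neq0 d).
have [Ns hs] := intF_neq0 (denq_neq0 (c * d)).
exists (Nc + Nd + Ns)%N => p lt_p.
have {}hc : (denq c)%:~R != 0 :> 'F_(val p) by apply: hc; lia.
have {}hd : (denq d)%:~R != 0 :> 'F_(val p) by apply: hd; lia.
have {}hs : (denq (c * d))%:~R != 0 :> 'F_(val p) by apply: hs; lia.
apply: (mulIf (mulf_neq0 hs (mulf_neq0 hc hd))).
rewrite mulrA (ratr_denq hs).
have -> (x y u v w : 'F_(val p)) :
  x * y * (w * (u * v)) = (x * u) * (y * v) * w by ring.
rewrite (ratr_denq hc) (ratr_denq hd) -!rmorphM.
congr (_%:~R); apply: (@intr_inj rat).
by rewrite !rmorphM /= !numqE; ring.
Qed.

Lemma calA_class_bound (a b : prodF) (N : nat) :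
  (forall p : primeT, (N < val p)%N -> a p = b p) -> calA_class a = calA_class b.
Proof.
move=> ab; apply/calA_class_eq/fsupp_bound; exists N => p lt_p.
by rewrite -[LHS]/(a p - b p) ab // subrr.
Qed.

Lemma calA_classD : {morph calA_class : a b / a + b}.
Proof. by move=> a b; exact: (@raddfD _ _ \pi_(Quotient.quot fsupp_ideal)). Qed.

Lemma calA_classM : {morph calA_class : a b / a * b}.
Proof. by move=> a b; exact: (@rmorphM _ _ \pi_(Quotient.quot fsupp_ideal)). Qed.

Fact calA_scaleA a b x : calA_scale a (calA_scale b x) = calA_scale (a * b) x.
Proof.
have [f ->] := calA_surj x; rewrite -!calA_class_scale.
have [N hN] := ratrM_modp a b; apply: (@calA_class_bound _ _ N) => p /hN e.
by rewrite /prodF_scale e mulrA.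
Qed.

Fact calA_scale1 : left_id 1 calA_scale.
Proof.
move=> x; have [f ->] := calA_surj x; rewrite -!calA_class_scale.
apply: (@calA_class_bound _ _ 0) => p _.
by rewrite /prodF_scale /ratr divr1 mul1r.
Qed.

Fact calA_scaleDr : right_distributive calA_scale +%R.
Proof.
move=> a x y; have [f ->] := calA_surj x; have [g ->] := calA_surj y.
rewrite -calA_classD -!calA_class_scale -calA_classD.
by apply: (@calA_class_bound _ _ 0) => p _; exact: mulrDr.
Qed.

Fact calA_scaleDl x : {morph calA_scale^~ x : a b / a + b}.
Proof.
move=> a b; have [f ->] := calA_surj x.
rewrite -!calA_class_scale -calA_classD.
have [N hN] := ratrD_modp a b; apply: (@calA_class_bound _ _ N) => p /hN e.
by rewrite /prodF_scale e mulrDl.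
Qed.

HB.instance Definition _ := GRing.Zmodule_isLmodule.Build rat calA
  calA_scaleA calA_scale1 calA_scaleDr calA_scaleDl.

Fact calA_scaleAl (a : rat) (x y : calA) : a *: (x * y) = a *: x * y.
Proof.
have [f ->] := calA_surj x; have [g ->] := calA_surj y.
rewrite -calA_classM -[LHS]calA_class_scale.
rewrite -[a *: calA_class f]calA_class_scale -calA_classM.
by apply: (@calA_class_bound _ _ 0) => p _; exact: mulrA.
Qed.

HB.instance Definition _ := GRing.Lmodule_isLalgebra.Build rat calA calA_scaleAl.
HB.instance Definition _ := GRing.Lalgebra_isComAlgebra.Build rat calA.

(* The multiple harmonic sum over n > m_1 > ... > m_r > 0 of
   m_1^{-k_1} ... m_r^{-k_r}, in 'F_p. *)
Fixpoint mhs (p n : nat) (ks : seq nat) : 'F_p :=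
  if ks is k :: ks' then \sum_(1 <= m < n) m%:R ^- k * mhs p m ks' else 1.

Definition zetaA (ks : seq nat) : calA := calA_class (fun p => mhs (val p) (val p) ks).

Section LinearExtension.
Variables (K : choiceType) (V : lmodType rat) (phi : K -> V).

Definition linext (f : {malg rat[K]}) : V :=
  \sum_(u <- msupp f) f@_u *: phi u.

Lemma linextEw (d : {fset K}) (f : {malg rat[K]}) : (msupp f `<=` d)%fset ->
  linext f = \sum_(u <- d) f@_u *: phi u.
Proof.
move=> fd; rewrite /linext (big_fset_incl _ fd) // => u _.
by move/mcoeff_outdom => ->; rewrite scale0r.
Qed.

Lemma linext_is_linear : linear linext.
Proof.
move=> a f g; pose d := (msupp f `|` msupp g)%fset.
rewrite (@linextEw d f) ?fsubsetUl // (@linextEw d g) ?fsubsetUr //.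
rewrite (@linextEw d); last first.
  apply: fsubset_trans (msuppD_le _ _) _.
  by rewrite fsetSU // msuppZ_le.
rewrite scaler_sumr -big_split; apply: eq_bigr => u _ /=.
by rewrite mcoeffD mcoeffZ scalerDl scalerA.
Qed.

HB.instance Definition _ :=
  GRing.isLinear.Build rat {malg rat[K]} V *:%R linext linext_is_linear.

Lemma linextU u : linext << u >> = phi u.
Proof.
by rewrite (linextEw msuppU_le) big_seq_fset1 mcoeffUU scale1r.
Qed.

End LinearExtension.

Lemma malg_ext (K : choiceType) (V : lmodType rat) (F G : {linear {malg rat[K]} -> V}) :
  (forall u, F << u >> = G << u >>) -> F =1 G.
Proof.
move=> FG f; rewrite (monalgE f) !linear_sum; apply: eq_bigr => u _.
have -> : << f@_u *g u >> = f@_u *: << u >> :> {malg rat[K]}.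
  by apply/malgP => v; rewrite mcoeffZ !mcoeffU; case: eqP; rewrite ?mulr1 ?mulr0.
by rewrite !linearZ FG.
Qed.

(* A word of H^1 is encoded by a sequence of naturals in which the entry n
   stands for x^n y = z_{n+1}, so [:: k_1.-1; ...; k_r.-1] is z_{k_1}...z_{k_r}.
   In the stuffle product, z_{a+1} and z_{b+1} merge into z_{a+b+2}, which is
   encoded by (a + b).+1. *)
Definition zword := seq nat.

Definition wt (w : zword) : nat := (\sum_(n <- w) n.+1)%N.

Section QuasiShuffle.
Variables (V : lmodType rat) (W : zword -> V) (mul : V -> V -> V) (cns : nat -> V -> V).
Hypothesis W_ind : forall P : V -> Prop,
  P 0 -> (forall a u f, P f -> P (a *: W u + f)) -> forall f, P f.
Hypothesis mulPr : forall a f g h, mul h (a *: f + g) = a *: mul h f + mul h g.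
Hypothesis mulPl : forall a f g h, mul (a *: f + g) h = a *: mul f h + mul g h.
Hypothesis cnsP : forall n a f g, cns n (a *: f + g) = a *: cns n f + cns n g.
Hypothesis cnsW : forall n u, cns n (W u) = W (n :: u).
Hypothesis mulW0 : forall u, mul (W u) (W [::]) = W u.
Hypothesis mul0W : forall u, mul (W [::]) (W u) = W u.
Hypothesis mulW_cons : forall a u b v, mul (W (a :: u)) (W (b :: v)) =
  cns a (mul (W u) (W (b :: v))) + cns b (mul (W (a :: u)) (W v))
  + cns (a + b).+1 (mul (W u) (W v)).

Let scale_add (a : rat) (x y z : V) : x = y -> a *: x + z = a *: y + z.
Proof. by move->. Qed.

Let mulDl f g h : mul (f + g) h = mul f h + mul g h.
Proof. by have := mulPl 1 f g h; rewrite !scale1r. Qed.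

Let mulDr f g h : mul h (f + g) = mul h f + mul h g.
Proof. by have := mulPr 1 f g h; rewrite !scale1r. Qed.

Let cnsD n f g : cns n (f + g) = cns n f + cns n g.
Proof. by have := cnsP n 1 f g; rewrite !scale1r. Qed.

Let mul0 f : mul f 0 = 0.
Proof. by apply: (addrI (mul f 0)); rewrite -mulDr !addr0. Qed.

Let mul0l f : mul 0 f = 0.
Proof. by apply: (addrI (mul 0 f)); rewrite -mulDl !addr0. Qed.

Let cns0 n : cns n 0 = 0.
Proof. by apply: (addrI (cns n 0)); rewrite -cnsD !addr0. Qed.

Let addr6 (x1 x2 x3 y1 y2 y3 : V) :
  x1 + y1 + (x2 + y2) + (x3 + y3) = x1 + x2 + x3 + (y1 + y2 + y3).
Proof. by rewrite (addrACA x1) (addrACA (x1 + x2)). Qed.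

Let addr9 (x1 x2 x3 x4 x5 x6 x7 x8 x9 y1 y2 y3 y4 y5 y6 y7 y8 y9 : V) :
  x1 + x4 + x7 = y1 -> x5 = y2 + y5 + y8 -> x2 = y4 -> x3 = y7 -> x6 = y3 ->
  x8 = y6 -> x9 = y9 ->
  x1 + x2 + x3 + (x4 + x5 + x6) + (x7 + x8 + x9)
  = y1 + y2 + y3 + (y4 + y5 + y6) + (y7 + y8 + y9).
Proof.
move=> <- -> -> -> -> -> ->.
by rewrite [LHS](AC (3*(1*3*1)*3) (((1*4*9)*5*8)*(2*6*10)*(3*7*11)))%AC.
Qed.

Lemma qs_mul_cons a f b g : mul (cns a f) (cns b g) =
  cns a (mul f (cns b g)) + cns b (mul (cns a f) g) + cns (a + b).+1 (mul f g).
Proof.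
elim/W_ind: f => [|c u f IHf]; first by rewrite cns0 !mul0l !cns0 !addr0.
rewrite !(cnsP, mulPl) IHf addr6 -!scalerDr; apply: scale_add.
elim/W_ind: g {f IHf} => [|d v g IHg]; first by rewrite cns0 !mul0 !cns0 !addr0.
rewrite !(cnsP, mulPr) IHg addr6 -!scalerDr; apply: scale_add.
by rewrite !cnsW mulW_cons.
Qed.

Lemma qs_mul1l : left_id (W [::]) mul.
Proof.
move=> f; elim/W_ind: f => [|a u f IHf]; first exact: mul0.
by rewrite mulPr IHf mul0W.
Qed.

Lemma qs_mulC : commutative mul.
Proof.
suff wordC u v : mul (W u) (W v) = mul (W v) (W u).
  move=> f g; elim/W_ind: f => [|a u f IHf]; first by rewrite mul0l mul0.
  rewrite mulPl mulPr IHf; apply: scale_add.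
  elim/W_ind: g {f IHf} => [|b v g IHg]; first by rewrite mul0l mul0.
  by rewrite mulPl mulPr IHg wordC.
elim: u v => [|a u IHu] v; first by rewrite mul0W mulW0.
elim: v => [|b v IHv]; first by rewrite mul0W mulW0.
by rewrite !mulW_cons IHu IHv IHu addnC (addrC (cns a _)).
Qed.

Lemma qs_mulA : associative mul.
Proof.
suff wordA u v w : mul (W u) (mul (W v) (W w)) = mul (mul (W u) (W v)) (W w).
  move=> f g h; elim/W_ind: f => [|a u f IHf]; first by rewrite !mul0l.
  rewrite !mulPl IHf; apply: scale_add.
  elim/W_ind: g {f IHf} => [|b v g IHg]; first by rewrite !(mul0l, mul0).
  rewrite !(mulPl, mulPr) IHg; apply: scale_add.
  elim/W_ind: h {g IHg} => [|c w h IHh]; first by rewrite !mul0.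
  by rewrite !mulPr IHh wordA.
have [n] := ubnP (size u + size v + size w)%N.
elim: n u v w => // n IHn u v w le_n.
case: u le_n => [|a u]; first by rewrite !qs_mul1l.
case: v => [|b v]; first by rewrite mul0W mulW0.
case: w => [|c w]; first by rewrite mulW0 !(qs_mulC _ (W [::])) !qs_mul1l.
move=> le_n; rewrite -!cnsW.
have E1 : mul (W u) (mul (cns b (W v)) (cns c (W w)))
        = mul (mul (W u) (cns b (W v))) (cns c (W w)).
  by rewrite !cnsW IHn //=; move: le_n => /=; lia.
have E2 : mul (cns a (W u)) (mul (W v) (cns c (W w)))
        = mul (mul (cns a (W u)) (W v)) (cns c (W w)).
  by rewrite !cnsW IHn //=; move: le_n => /=; lia.
have E3 : mul (cns a (W u)) (mul (cns b (W v)) (W w))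
        = mul (mul (cns a (W u)) (cns b (W v))) (W w).
  by rewrite !cnsW IHn //=; move: le_n => /=; lia.
have E12 : mul (W u) (mul (W v) (cns c (W w))) = mul (mul (W u) (W v)) (cns c (W w)).
  by rewrite !cnsW IHn //=; move: le_n => /=; lia.
have E13 : mul (W u) (mul (cns b (W v)) (W w)) = mul (mul (W u) (cns b (W v))) (W w).
  by rewrite !cnsW IHn //=; move: le_n => /=; lia.
have E23 : mul (cns a (W u)) (mul (W v) (W w)) = mul (mul (cns a (W u)) (W v)) (W w).
  by rewrite !cnsW IHn //=; move: le_n => /=; lia.
have E123 : mul (W u) (mul (W v) (W w)) = mul (mul (W u) (W v)) (W w).
  by rewrite IHn //=; move: le_n => /=; lia.
rewrite (qs_mul_cons b (W v)) (qs_mul_cons a (W u) b) !mulDr !mulDl.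
rewrite !qs_mul_cons; apply: addr9.
- by rewrite -!cnsD -!mulDr -qs_mul_cons E1.
- by rewrite -!cnsD -!mulDl -qs_mul_cons E3.
- by rewrite E2.
- by rewrite E12.
- by rewrite E13.
- by rewrite E23.
- by rewrite E123 addnS addSn addnA.
Qed.

End QuasiShuffle.

Definition H1 : Type := {malg rat[zword]}.

HB.instance Definition _ := GRing.Lmodule.on H1.

Definition wordH1 (w : zword) : H1 := << w >>.

(* The words of the stuffle product of two words, with multiplicity. *)
Fixpoint stuffle (u : zword) : zword -> seq zword :=
  if u is a :: u' then
    fix stuffle_u v :=
      if v is b :: v' then
        [seq a :: w | w <- stuffle u' v]
        ++ [seq b :: w | w <- stuffle_u v']
        ++ [seq (a + b).+1 :: w | w <- stuffle u' v']
      else [:: u]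
  else fun v => [:: v].

Definition H1_stuffle (u v : zword) : H1 := \sum_(w <- stuffle u v) wordH1 w.

Definition H1_mul (f g : H1) : H1 :=
  linext (fun u => linext (H1_stuffle u) g) f.

Definition H1_one : H1 := wordH1 [::].

Definition H1_cons (a : nat) : {malg rat[zword]} -> H1 :=
  linext (fun u => wordH1 (a :: u)).

HB.instance Definition _ a := GRing.Linear.on (H1_cons a).

Lemma H1_consU a u : H1_cons a (wordH1 u) = wordH1 (a :: u).
Proof. exact: linextU. Qed.

Lemma H1_mulU u v : H1_mul (wordH1 u) (wordH1 v) = H1_stuffle u v.
Proof. by rewrite /H1_mul linextU linextU. Qed.

Lemma H1_mul_linear g : linear (H1_mul^~ g).
Proof. by move=> a f1 f2; rewrite /H1_mul linearP. Qed.

Lemma H1_mul_linear_r f : linear (H1_mul f).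
Proof.
move=> a g1 g2; rewrite /H1_mul /linext scaler_sumr -big_split.
by apply: eq_bigr => u _ /=; rewrite -!/(linext _ _) linearP scalerDr !scalerA mulrC.
Qed.

HB.instance Definition _ f :=
  GRing.isLinear.Build rat {malg rat[zword]} H1 *:%R (H1_mul f) (H1_mul_linear_r f).

Lemma H1_ind (P : H1 -> Prop) :
  P 0 -> (forall a u f, P f -> P (a *: wordH1 u + f)) -> forall f, P f.
Proof.
move=> P0 PD f; rewrite (monalgE f); elim: (enum_fset _) => [|u s IHs].
  by rewrite big_nil.
rewrite big_cons.
have -> : << f@_u *g u >> = f@_u *: wordH1 u.
  by apply/malgP => v; rewrite mcoeffZ !mcoeffU; case: eqP; rewrite ?mulr1 ?mulr0.
exact: PD.
Qed.

Local Lemma H1_mulPr a (f g h : H1) :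
  H1_mul h (a *: f + g) = a *: H1_mul h f + H1_mul h g.
Proof. exact: H1_mul_linear_r. Qed.

Local Lemma H1_mulPl a (f g h : H1) :
  H1_mul (a *: f + g) h = a *: H1_mul f h + H1_mul g h.
Proof. exact: H1_mul_linear. Qed.

Local Lemma H1_consP n a (f g : H1) :
  H1_cons n (a *: f + g) = a *: H1_cons n f + H1_cons n g.
Proof. exact: linext_is_linear. Qed.

Local Lemma H1_mulW0 u : H1_mul (wordH1 u) (wordH1 [::]) = wordH1 u.
Proof. by rewrite H1_mulU; case: u => [|a u]; rewrite /H1_stuffle /= big_seq1. Qed.

Local Lemma H1_mul0W u : H1_mul (wordH1 [::]) (wordH1 u) = wordH1 u.
Proof. by rewrite H1_mulU /H1_stuffle /= big_seq1. Qed.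

Local Lemma H1_cons_sum n (s : seq zword) :
  H1_cons n (\sum_(w <- s) wordH1 w) = \sum_(w <- s) wordH1 (n :: w).
Proof.
rewrite /H1_cons linear_sum; apply: eq_bigr => w _; exact: linextU.
Qed.

Local Lemma H1_mulW_cons a u b v : H1_mul (wordH1 (a :: u)) (wordH1 (b :: v)) =
  H1_cons a (H1_mul (wordH1 u) (wordH1 (b :: v)))
  + H1_cons b (H1_mul (wordH1 (a :: u)) (wordH1 v))
  + H1_cons (a + b).+1 (H1_mul (wordH1 u) (wordH1 v)).
Proof.
rewrite !H1_mulU /H1_stuffle !H1_cons_sum.
by rewrite [stuffle (a :: u) (b :: v)]/= !big_cat /= !big_map addrA.
Qed.

Fact H1_mulA : associative H1_mul.
Proof.
exact: (qs_mulA H1_ind H1_mulPr H1_mulPl H1_consP H1_consU H1_mulW0 H1_mul0W H1_mulW_cons).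
Qed.

Fact H1_mulC : commutative H1_mul.
Proof. exact: (qs_mulC H1_ind H1_mulPr H1_mulPl H1_mulW0 H1_mul0W H1_mulW_cons). Qed.

Fact H1_mul1l : left_id H1_one H1_mul.
Proof. exact: (qs_mul1l H1_ind H1_mulPr H1_mul0W). Qed.

Fact H1_mulDl : left_distributive H1_mul +%R.
Proof. by move=> f g h; have := H1_mulPl 1 f g h; rewrite !scale1r. Qed.

Fact H1_one_neq0 : H1_one != 0.
Proof. by rewrite /H1_one /wordH1 monalgU_eq0 oner_eq0. Qed.

HB.instance Definition _ := GRing.Zmodule_isComNzRing.Build H1
  H1_mulA H1_mulC H1_mul1l H1_mulDl H1_one_neq0.

Fact H1_scaleAl (a : rat) (f g : H1) : a *: (f * g) = a *: f * g.
Proof.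
have H1_0mul : H1_mul 0 g = 0 by exact: (mul0r g).
by have := H1_mulPl a f 0 g; rewrite H1_0mul !addr0.
Qed.

HB.instance Definition _ := GRing.Lmodule_isLalgebra.Build rat H1 H1_scaleAl.
HB.instance Definition _ := GRing.Lalgebra_isComAlgebra.Build rat H1.

Definition lx : bool := false.
Definition ly : bool := true.

Definition xyword (w : zword) : seq bool :=
  flatten [seq rcons (nseq n lx) ly | n <- w].

Fixpoint zword_of_rec (n : nat) (u : seq bool) : zword :=
  if u is l :: u' then
    if l == lx then zword_of_rec n.+1 u' else n :: zword_of_rec 0 u'
  else [::].

(* The inverse of [xyword] on the xy-words of H^1, those which are empty or end
   with y; see [xywordK] and [zword_ofK]. *)
Definition zword_of (u : seq bool) : zword := zword_of_rec 0 u.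

(* The words of the shuffle product of two xy-words, with multiplicity. *)
Fixpoint shuffle (u : seq bool) : seq bool -> seq (seq bool) :=
  if u is a :: u' then
    fix shuffle_u v :=
      if v is b :: v' then
        [seq a :: w | w <- shuffle u' v] ++ [seq b :: w | w <- shuffle_u v']
      else [:: u]
  else fun v => [:: v].

Definition H1_shuffle (w v : zword) : H1 :=
  \sum_(u <- shuffle (xyword w) (xyword v)) wordH1 (zword_of u).

Lemma xywordK : cancel xyword zword_of.
Proof.
have rec n m u :
  zword_of_rec m (rcons (nseq n lx) ly ++ u) = (m + n)%N :: zword_of_rec 0 u.
  by elim: n m => [|n IHn] m /=; rewrite ?addn0 // IHn addSnnS.
by elim=> //= n w IHw; rewrite /zword_of /xyword /= rec add0n; congr (_ :: _).
Qed.

Lemma zword_ofK u : last ly u = ly -> xyword (zword_of u) = u.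
Proof.
have rec n v : last lx v = ly -> xyword (zword_of_rec n v) = nseq n lx ++ v.
  elim: v n => [//|a v IHv] n /= lv.
  case: (a =P lx) lv => [-> lv|/eqP a_y lv].
    by rewrite IHv //; elim: n => //= n ->.
  have {a_y} -> : a = ly by case: a a_y {lv}.
  rewrite /xyword /= cat_rcons; congr (_ ++ _ :: _).
  by case: v lv IHv => [//|b v] lv IHv; exact: IHv.
by case: u => [//|a u] lu; exact: rec.
Qed.

Lemma shuffle_last u v w : last ly u = ly -> last ly v = ly ->
  w \in shuffle u v -> last ly w = ly.
Proof.
have size_sh s t r : r \in shuffle s t -> size r = (size s + size t)%N.
  elim: s t r => [|a s IHs] t r /=; first by rewrite inE => /eqP->.
  elim: t r => [|b t IHt] r; first by rewrite inE => /eqP->; rewrite addn0.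
  rewrite mem_cat => /orP[] /mapP[r' r'_in ->] /=.
    by rewrite (IHs _ _ r'_in).
  by rewrite (IHt _ r'_in) addnS.
have last_tl a s : last a s = ly -> last ly s = ly by case: s.
elim: u v w => [|a u IHu] v w lu lv /=; first by rewrite inE => /eqP->.
elim: v w lv => [|b v IHv] w lv; first by rewrite inE => /eqP->.
rewrite mem_cat => /orP[] /mapP[w' w'_in ->] /=.
  have := size_sh _ _ _ w'_in; have := IHu _ _ (last_tl a u lu) lv w'_in.
  by case: w' {w'_in} => //= _; rewrite addnS.
have := size_sh (a :: u) v w' w'_in; have := IHv _ (last_tl b v lv) w'_in.
by case: w' {w'_in}.
Qed.

Lemma shuffle_count u v w : w \in shuffle u v ->
  count_mem ly w = (count_mem ly u + count_mem ly v)%N.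
Proof.
elim: u v w => [|a u IHu] v w /=; first by rewrite inE => /eqP->.
elim: v w => [|b v IHv] w; first by rewrite inE => /eqP->; rewrite addn0.
rewrite mem_cat => /orP[] /mapP[w' w'_in ->] /=.
  by rewrite (IHu _ _ w'_in) /= !addnA.
by rewrite (IHv _ w'_in) /=; lia.
Qed.

Lemma last_xyword w : last ly (xyword w) = ly.
Proof.
elim: w => //= n w IHw; rewrite /xyword /= last_cat last_rcons; exact: IHw.
Qed.

Lemma count_xyword w : count_mem ly (xyword w) = size w.
Proof.
elim: w => //= n w IHw; rewrite /xyword /= count_cat -cats1 count_cat count_nseq /=.
by rewrite mul0n; congr _.+1; exact: IHw.
Qed.

(* The shuffle product of two words of H^1 is a combination of words of H^1. *)
Lemma shuffle_H1 w v u : u \in shuffle (xyword w) (xyword v) ->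
  xyword (zword_of u) = u.
Proof. by move=> u_in; apply/zword_ofK/(shuffle_last _ _ u_in); rewrite last_xyword. Qed.

Definition dshuffle_rel (w v : zword) : H1 :=
  H1_shuffle w v - (-1) ^+ wt w *: wordH1 (rev w ++ v).

Definition calL : pred H1 := fun f =>
  `[< exists2 s : seq (H1 * H1),
        (forall t, t \in s -> exists w v, t.2 = dshuffle_rel w v)
      & f = \sum_(t <- s) t.1 * t.2 >].

Lemma calLP f :
  reflect (exists2 s : seq (H1 * H1),
             (forall t, t \in s -> exists w v, t.2 = dshuffle_rel w v)
           & f = \sum_(t <- s) t.1 * t.2) (f \in calL).
Proof. exact: asboolP. Qed.

Definition const_coef : {linear {malg rat[zword]} -> rat^o} :=
  linext (V := rat^o) (fun u : zword => (u == [::])%:R).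

Lemma const_coefU u : const_coef (wordH1 u) = (u == [::])%:R.
Proof. exact: linextU. Qed.

Local Lemma const_coefP a (f g : H1) :
  const_coef (a *: f + g) = a * const_coef f + const_coef g.
Proof. exact: (linearP const_coef). Qed.

Lemma const_coefM (f g : H1) :
  const_coef (f * g : H1) = const_coef f * const_coef g.
Proof.
have wordM u v : const_coef (wordH1 u * wordH1 v : H1)
    = const_coef (wordH1 u) * const_coef (wordH1 v).
  rewrite [wordH1 u * _]H1_mulU /H1_stuffle linear_sum !const_coefU.
  case: u v => [|c u] [|d v]; rewrite ?mul0r ?mul1r /=.
  - by rewrite big_seq1 const_coefU.
  - by rewrite big_seq1 const_coefU.
  - by rewrite big_seq1 const_coefU.
  rewrite !big_cat /= !big_map.
  by do !rewrite big1 => [|? _]; rewrite ?const_coefU ?addr0.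
have cc0 : const_coef (0 : H1) = 0 by exact: (linear0 const_coef).
elim/H1_ind: f => [|a u f IHf]; first by rewrite mul0r cc0 mul0r.
rewrite mulrDl -scalerAl !const_coefP mulrDl IHf -mulrA; congr (_ * _ + _).
elim/H1_ind: g {f IHf} => [|b v g IHg]; first by rewrite mulr0 cc0 mulr0.
by rewrite mulrDr -scalerAr !const_coefP mulrDr IHg wordM mulrCA.
Qed.

Lemma const_coef_rel w v : const_coef (dshuffle_rel w v) = 0.
Proof.
rewrite /dshuffle_rel /H1_shuffle linearB linearZ /= linear_sum /= const_coefU.
have size_z n u : size (zword_of_rec n u) = count_mem ly u.
  by elim: u n => // -[] u IHu n /=; rewrite IHu.
have [/eqP|nz] := eqVneq (size w + size v)%N 0%N.
  rewrite addn_eq0 !size_eq0 => /andP[/eqP-> /eqP->] /=.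
  by rewrite big_seq1 const_coefU /wt big_nil expr0 scale1r subrr.
have -> : (rev w ++ v == [::]) = false.
  by apply/negbTE; rewrite -size_eq0 size_cat size_rev.
rewrite scaler0 subr0 big_seq big1 // => u /shuffle_count.
rewrite !count_xyword => cu; rewrite const_coefU -size_eq0 size_z cu.
by rewrite (negbTE nz).
Qed.

Fact calL_idealr : idealr_closed calL.
Proof.
split=> [||a f g /calLP[s sR ->] /calLP[t tR ->]].
- by apply/calLP; exists [::]; rewrite ?big_nil.
- apply/negP => /calLP[s sR /(congr1 const_coef)].
  rewrite -[1 : H1]/(wordH1 [::]) const_coefU (linear_sum const_coef) big_seq big1 => [/eqP|x /sR].
    by rewrite oner_eq0.
  by move=> [w [v e]]; rewrite const_coefM e const_coef_rel mulr0.
apply/calLP; exists ([seq (a * x.1, x.2) | x <- s] ++ t).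
  by move=> x; rewrite mem_cat => /orP[/mapP[y /sR Ry ->]|/tR].
have -> : a * (\sum_(x <- s) x.1 * x.2) = \sum_(x <- s) a * x.1 * x.2.
  by rewrite mulr_sumr; apply: eq_bigr => x _; rewrite mulrA.
by rewrite big_cat big_map.
Qed.

HB.instance Definition _ := isIdealr.Build H1 calL calL_idealr.

Definition calL_ideal : idealr H1 := Idealr.clone H1 calL _.

Definition Zf : Type := Quotient.quot calL_ideal.

HB.instance Definition _ := GRing.ComNzRing.on Zf.

Definition Zf_class (f : H1) : Zf := \pi_(Quotient.quot calL_ideal) f.

Lemma Zf_class_eq (f g : H1) : (Zf_class f = Zf_class g) <-> (f - g \in calL).
Proof.
rewrite -[_ \in _]/(_ \in calL_ideal) Quotient.idealrBE; split=> [e|/eqP //].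
by apply/eqP; exact: e.
Qed.

Lemma Zf_surj (x : Zf) : exists f, x = Zf_class f.
Proof. by exists (repr x); rewrite /Zf_class reprK. Qed.

Lemma Zf_classD : {morph Zf_class : f g / f + g}.
Proof. by move=> a b; exact: (@raddfD _ _ \pi_(Quotient.quot calL_ideal)). Qed.

Lemma Zf_classM : {morph Zf_class : f g / f * g}.
Proof. by move=> a b; exact: (@rmorphM _ _ \pi_(Quotient.quot calL_ideal)). Qed.

Definition Zf_scale (c : rat) (x : Zf) : Zf := Zf_class (c *: repr x).

Lemma Zf_class_scale c f : Zf_class (c *: f) = Zf_scale c (Zf_class f).
Proof.
apply/Zf_class_eq; rewrite -scalerBr -mulr_algl idealMr //.
by apply/Zf_class_eq; rewrite {2}/Zf_class reprK.
Qed.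

Fact Zf_scaleA a b x : Zf_scale a (Zf_scale b x) = Zf_scale (a * b) x.
Proof. by have [f ->] := Zf_surj x; rewrite -!Zf_class_scale scalerA. Qed.

Fact Zf_scale1 : left_id 1 Zf_scale.
Proof. by move=> x; have [f ->] := Zf_surj x; rewrite -Zf_class_scale scale1r. Qed.

Fact Zf_scaleDr : right_distributive Zf_scale +%R.
Proof.
move=> a x y; have [f ->] := Zf_surj x; have [g ->] := Zf_surj y.
by rewrite -Zf_classD -!Zf_class_scale -Zf_classD scalerDr.
Qed.

Fact Zf_scaleDl x : {morph Zf_scale^~ x : a b / a + b}.
Proof.
move=> a b; have [f ->] := Zf_surj x.
by rewrite -!Zf_class_scale -Zf_classD scalerDl.
Qed.

HB.instance Definition _ := GRing.Zmodule_isLmodule.Build rat Zf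
  Zf_scaleA Zf_scale1 Zf_scaleDr Zf_scaleDl.

Fact Zf_scaleAl (a : rat) (x y : Zf) : a *: (x * y) = a *: x * y.
Proof.
have [f ->] := Zf_surj x; have [g ->] := Zf_surj y.
rewrite -Zf_classM -[LHS]Zf_class_scale -[a *: Zf_class f]Zf_class_scale.
by rewrite -Zf_classM scalerAl.
Qed.

HB.instance Definition _ := GRing.Lmodule_isLalgebra.Build rat Zf Zf_scaleAl.
HB.instance Definition _ := GRing.Lalgebra_isComAlgebra.Build rat Zf.

(* Only for positive k_1, ..., k_r; an index 0 would be read as 1. *)
Definition zetaf (ks : seq nat) : Zf := Zf_class (wordH1 [seq k.-1 | k <- ks]).

Definition zf (n : nat) : Zf :=
  if (n <= 1)%N then 0 else n%:R^-1 *: zetaf [:: (n - 1)%N; 1%N].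

From mathcomp Require Import mpoly.

(* [monalg] and [mpoly] both define the notation for mpoly rings. *)
Notation QXY := (mpoly 2 rat).

Definition pX : QXY := 'X_(@Ordinal 2 0 isT).
Definition pY : QXY := 'X_(@Ordinal 2 1 isT).

Definition subst2 (p f g : QXY) : QXY :=
  p \mPo [tuple f; g].

Definition Weven (k : nat) (p : QXY) : Prop :=
  p \is (k - 2).-homog /\ p = subst2 p (pX + pY) pY - subst2 p (pX + pY) pX.

Definition qcoef (k : nat) (p : QXY) (r s : nat) : rat :=
  (subst2 p (pX + pY) pY)@_[multinom [tuple (r - 1)%N; (s - 1)%N]] / 'C(k - 2, r - 1)%:R.

Definition chat (k : nat) (p : QXY) (i : 'I_(nod k)) : rat :=
  \det (\matrix_(i', j)
    if i' == i then 2%:R * (qcoef k p (od j) (k - od j) - qcoef k p (k - 1) 1)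
    else Amx k i' j).

(* Main.v *)
Require Import Defs.
From HB Require Import structures.
From mathcomp Require Import all_boot all_order all_algebra.
From mathcomp Require Import zify ring.
From mathcomp Require Import finfield mpoly.

(** Forms. Put n = k - 2 and read a binary form of degree n as a combination of
    the Z_{r,s}, the monomial X^(r-1) Y^(s-1) standing for Z_{r,s} / C(n, r-1);
    this is the map [Phi]. The two expressions of P_{r,s} become the single rule
    Phi(h(X,Y) + h(Y,X)) = Phi(h(X,X+Y) + h(X+Y,X)) for all h ([Phi_rel]), and
    the vanishing of P_{even,even} says that Phi kills the symmetric forms all of
    whose exponents are odd ([Phi_odd_sym]).

    Period polynomials give relations. An even period polynomial p satisfies
    p(Y,X) = -p(X,Y) = -p(X,-Y). Applying both rules to forms built from
    G = p(X+Y,Y) shows that Phi kills the even part of G, that is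
    sum_{r odd} q_{r,s} Z_{r,s} = 0 ([Weven_relation]). The polynomial
    X^n - Y^n yields Z_{k-1,1} = - sum_{3 <= r <= k-3} Z_{r,s}, and together
    sum_r (q_{r,s} - q_{k-1,1}) Z_{r,s} = 0 ([qrow_relation]). On the other hand
    [Phi_rel] for homogenised Bernoulli polynomials expresses Z_{even,even} by
    Z_{odd,odd} ([DtZ_even_odd]), which proves 2 H = A Z ([Hdz_Amx]). By Cramer's
    rule the row of the determinants chat_r(p) is v adj(A), with v the row of the
    2 (q_{r,s} - q_{k-1,1}), so that chat A = det(A) v, and
    2 sum_r chat_r(p) H_r = det(A) v Z = 0 ([chat_Hdz]).

    All relations arise in this way. If sum_r u_r Z_{r,s} = 0, the universal
    property of the quotient ([Dtilde_lift]) shows that the form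
    e = sum_r u_r C(n, r-1) X^(r-1) Y^(s-1) can be written as
    h - h(X,X+Y) + o with h and o symmetric and all exponents of o odd
    ([DtZ_relation]). Then p = e(X,Y) - e(Y,X) = h(X+Y,Y) - h(X+Y,X) is an even
    period polynomial, and the even part of p(X+Y,Y) is e, so its row v is 2 u
    ([null_form_even_Weven], [relation_qrow]). For det(A) <> 0 this describes all
    relations among the H_r. If moreover v = 0, then after subtracting a multiple
    of X^n - Y^n the form F = p(X+Y,Y) is odd in X, and so is p = F - F(Y,X);
    being even as well, p vanishes ([Weven_eq0]).

    Finite multiple zeta values. Let zeta be any function on indices, with values
    in a commutative Q-algebra, that satisfies the stuffle product, the reversal
    formula, zeta(n) = 0, and the depth three formula assumed in the statement.
    Then there is a linear map on the quotient space taking H_{r,s} to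
    zeta(r-1,1,s-1,1) ([Dtilde_model], [psi_Hdz]), which transports the relations
    ([model_relation]). It sends Z_{r,s} to a binomially weighted sum of the
    zeta(n,1,k-1-n) and of products z(n) z(k-n). Inserting the depth three formula
    into the stuffle product of zeta(c) and zeta(a,b) shows that a symmetrised
    weighted sum tau(a,b,c) vanishes for positive a, b, c; a second order
    difference equation ([diff2_wsum]) extends this to b = 0 ([zTau_border]), and
    there it is the double shuffle relation for the images.

    For the formal values, stuffle product and reversal hold by construction, and
    zeta(n) = 0 follows from the shuffle product of y and x^(n-2) y ([zetaf1]).
    For the values in the ring of families of residues, the depth three formula
    is a congruence modulo large primes p ([mhs3]): the sums of i^(-m) over i < j
    are values at j of a polynomial Q_m over F_p, the coefficients of Q_m are
    binomial multiples of those of Q_1 ([power_sum_poly_coef]), and since the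
    sum of j^N over F_p vanishes unless p - 1 divides N ([sum_pow_natF]), nested
    sums of depth three become bilinear in the coefficients of Q_1, where the
    formula is an instance of Vandermonde's identity ([long_split]). *)

Set Implicit Arguments.
Unset Strict Implicit.
Unset Printing Implicit Defensive.

Import GRing.Theory.

Local Open Scope ring_scope.

(** * Linear maps out of the double zeta space *)

(** A map that kills the generators kills their span, so its value does not
    depend on the representative. *)
Lemma lquot_lift (R : pzRingType) (V W : lmodType R) (G : V -> Prop)
    (f : {linear V -> W}) : (forall v, G v -> f v = 0) ->
  exists g : {linear lquot G -> W}, forall v, g (lproj G v) = f v.
Proof.
move=> fG.
have f0 v : v \in spanp G -> f v = 0.
  move=> /spanpP[s sG ->]; rewrite linear_sum big_seq big1 // => t /sG Gt.
  by rewrite linearZ /= fG // scaler0.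
have fE v : f (repr (lproj G v)) = f v.
  apply/eqP; rewrite -subr_eq0 -linearB f0 //; apply/lproj_eq.
  by rewrite {1}/lproj reprK.
pose g (x : lquot G) := f (repr x).
have g_lin : linear g.
  move=> a x y; have [u ->] := lproj_surj x; have [v ->] := lproj_surj y.
  by rewrite /g -linearP !fE linearP.
pose gL := GRing.isLinear.Build R (lquot G) W *:%R g g_lin.
pose gl : {linear lquot G -> W} := HB.pack g gL.
by exists gl => v; exact: fE.
Qed.

Section Dtilde.
Variable k : nat.

Lemma DZk0 : lproj (@dtrel k) (DZk k) = 0.
Proof.
apply/lproj_eq0/spanpP; exists [:: (1, DZk k)]; last by rewrite big_seq1 scale1r.
by move=> t; rewrite inE => /eqP -> /=; constructor.
Qed.

Lemma DtZ1 : DtZ k 1 (k - 1) = 0.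
Proof.
apply/lproj_eq0/spanpP; exists [:: (1, DZ k 1 (k - 1))]; last by rewrite big_seq1 scale1r.
by move=> t; rewrite inE => /eqP -> /=; constructor.
Qed.

Lemma DtP_even r s : (0 < r)%N -> (0 < s)%N -> ~~ odd r -> ~~ odd s -> (r + s = k)%N ->
  DtP k r s = 0.
Proof.
move=> r0 s0 er es rsk.
apply/lproj_eq0/spanpP; exists [:: (1, DP k r s)]; last by rewrite big_seq1 scale1r.
by move=> t; rewrite inE => /eqP -> /=; constructor; exists r, s.
Qed.

Definition Dclass (v : dfree k) : Dtilde k := lproj (@dtrel k) (lproj (@drel k) v).

Fact Dclass_linear : linear Dclass.
Proof. by move=> a u v; rewrite /Dclass !linearP. Qed.

HB.instance Definition _ :=
  GRing.isLinear.Build rat (dfree k) (Dtilde k) *:%R Dclass Dclass_linear.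

Lemma Dclass_rel v : @drel k v -> Dclass v = 0.
Proof.
move=> Dv; rewrite /Dclass; suff -> : lproj (@drel k) v = 0 by exact: linear0.
apply/lproj_eq0/spanpP; exists [:: (1, v)]; last by rewrite big_seq1 scale1r.
by move=> t; rewrite inE => /eqP ->.
Qed.

Lemma DtP_stuffle r s : (0 < r)%N -> (0 < s)%N -> (r + s = k)%N ->
  DtP k r s = DtZ k r s + DtZ k s r.
Proof.
move=> r0 s0 rsk; apply/eqP; rewrite -subr_eq0; apply/eqP.
have /Dclass_rel : drel (symP k r s - (symZ k r s + symZ k s r + symZk k)).
  by exists r, s; split => //; left.
by rewrite linearB !(linearD Dclass) /= [Dclass (symZk k)]DZk0 addr0.
Qed.

Lemma DtP_shuffle r s : (0 < r)%N -> (0 < s)%N -> (r + s = k)%N ->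
  DtP k r s = \sum_(1 <= a < k)
          ('C(a - 1, r - 1) + 'C(a - 1, s - 1))%:R *: DtZ k a (k - a).
Proof.
move=> r0 s0 rsk; apply/eqP; rewrite -subr_eq0; apply/eqP.
have /Dclass_rel : drel (symP k r s - \sum_(1 <= a < k)
          ('C(a - 1, r - 1) + 'C(a - 1, s - 1))%:R *: symZ k a (k - a)).
  by exists r, s; split => //; right.
rewrite linearB (linear_sum Dclass) /= => e; rewrite -[RHS]e; congr (_ - _).
by apply: eq_bigr => a _; rewrite (linearZ_LR Dclass).
Qed.

Section Lift.
Variables (W : lmodType rat) (zv pv : nat -> W).
Hypothesis pv_stuffle : forall r s, (0 < r)%N -> (0 < s)%N -> (r + s = k)%N ->
  pv r = zv r + zv s.
Hypothesis pv_shuffle : forall r s, (0 < r)%N -> (0 < s)%N -> (r + s = k)%N ->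
  pv r = \sum_(1 <= a < k) ('C(a - 1, r - 1) + 'C(a - 1, s - 1))%:R *: zv a.
Hypothesis pv_even : forall r s, (0 < r)%N -> (0 < s)%N -> (r + s = k)%N ->
  ~~ odd r -> ~~ odd s -> pv r = 0.
Hypothesis k_gt1 : (1 < k)%N.
Hypothesis zv1 : zv 1%N = 0.

Definition lift_val (x : dsym k) : W := match x with
  | inl (inl i) => zv i.+1 | inl (inr i) => pv i.+1 | inr _ => 0 end.
Definition lift_fun (v : dfree k) : W := \sum_x v x *: lift_val x.
Local Notation f := lift_fun.

Fact lift_linear : linear f.
Proof.
move=> a u v; rewrite /lift_fun scaler_sumr -big_split; apply: eq_bigr => x _.
by rewrite !ffunE scalerA; exact: scalerDl.
Qed.

HB.instance Definition _ := GRing.isLinear.Build rat (dfree k) W *:%R f lift_linear.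

Lemma lift_symZ r s : (0 < r)%N -> (0 < s)%N -> (r + s = k)%N -> f (symZ k r s) = zv r.
Proof.
move=> r0 s0 rsk; rewrite /lift_fun !big_sumType /= [X in _ + X]big1 => [|i _]; last by rewrite scaler0.
rewrite addr0 [X in _ + X]big1 => [|i _]; last by rewrite ffunE scale0r.
have lt_r : (r.-1 < k.-1)%N by lia.
rewrite addr0 (bigD1 (Ordinal lt_r)) //= big1 => [|i ne_i]; rewrite ffunE.
  by rewrite prednK // rsk !eqxx scale1r addr0.
suff /negbTE -> : i.+1 != r by rewrite scale0r.
by apply: contraNneq ne_i => e; apply/eqP/val_inj; rewrite /= -e.
Qed.

Lemma lift_symP r s : (0 < r)%N -> (0 < s)%N -> (r + s = k)%N -> f (symP k r s) = pv r.
Proof.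
move=> r0 s0 rsk; rewrite /lift_fun !big_sumType /= [X in _ + X]big1 => [|i _]; last by rewrite scaler0.
rewrite addr0 [X in X + _]big1 => [|i _]; last by rewrite ffunE scale0r.
have lt_r : (r.-1 < k.-1)%N by lia.
rewrite add0r (bigD1 (Ordinal lt_r)) //= big1 => [|i ne_i]; rewrite ffunE.
  by rewrite prednK // rsk !eqxx scale1r addr0.
suff /negbTE -> : i.+1 != r by rewrite scale0r.
by apply: contraNneq ne_i => e; apply/eqP/val_inj; rewrite /= -e.
Qed.

Lemma lift_symZk : f (symZk k) = 0.
Proof.
rewrite /lift_fun !big_sumType /= !big1 ?addr0 // => i _; rewrite ?scaler0 //.
  by rewrite ffunE scale0r.
by rewrite ffunE scale0r.
Qed.

(** The universal property of the quotient. Its elements Z_k and Z_{1,k-1} and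
    the P_{r,s} with even indices are zero, so a linear map is given by values for
    the remaining symbols that respect both product formulas. *)
Lemma Dtilde_lift : exists g : {linear Dtilde k -> W},
  (forall r s, (0 < r)%N -> (0 < s)%N -> (r + s = k)%N -> g (DtZ k r s) = zv r) /\
  (forall r s, (0 < r)%N -> (0 < s)%N -> (r + s = k)%N -> g (DtP k r s) = pv r).
Proof.
have frel v : @drel k v -> f v = 0.
  move=> [r [s [r0 s0 rsk [->|->]]]].
    rewrite linearB !(linearD f) /= lift_symZk lift_symP // !lift_symZ //; last by rewrite addnC.
    by rewrite addr0 -pv_stuffle ?subrr.
  rewrite linearB (linear_sum f) /= lift_symP // (pv_shuffle r0 s0 rsk).
  apply/eqP; rewrite subr_eq0; apply/eqP/eq_big_nat => a a1k.
  by rewrite linearZ /= lift_symZ //; lia.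
have [g1 g1E] := lquot_lift frel.
have g1rel v : @dtrel k v -> g1 v = 0.
  move=> [->|->|[r [s [r0 s0 er es [rsk ->]]]]]; rewrite g1E.
  - exact: lift_symZk.
  - by rewrite [LHS]lift_symZ //; lia.
  - by rewrite [LHS]lift_symP // (pv_even r0 s0).
have [g gE] := lquot_lift g1rel.
exists g; split=> r s r0 s0 rsk; rewrite gE g1E; [exact: lift_symZ|exact: lift_symP].
Qed.

End Lift.
End Dtilde.

(** * Binomial sums *)

(** Trinomial revision. *)
Lemma bin_mul_bin n i j : (i + j <= n)%N ->
  ('C(n, i + j) * 'C(i + j, j) = 'C(n, j) * 'C(n - j, i))%N.
Proof.
move=> le_n.
have f0 : (0 < i`! * j`! * (n - (i + j))`!)%N by rewrite !muln_gt0 !fact_gt0.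
apply/eqP; rewrite -(eqn_pmul2r f0); apply/eqP.
have e1 := bin_fact le_n.
have e2 := @bin_fact (i + j) j (leq_addl _ _).
have e3 := @bin_fact n j ltac:(lia).
have e4 := @bin_fact (n - j) i ltac:(lia).
rewrite addnK in e2; rewrite -subnDA [(j + i)%N]addnC in e4.
transitivity n`!.
  by rewrite -e1 -e2; ring.
by rewrite -e3 -e4; ring.
Qed.

(** Binomial inversion: the signed Pascal matrix is its own inverse. *)
Lemma alt_bin n j : \sum_(a < n.+1) (-1) ^+ a * ('C(n, a) * 'C(a, j))%:R
  = (-1) ^+ j * (n == j)%:R :> rat.
Proof.
have [lt_nj|le_jn] := ltnP n j.
  rewrite (ltn_eqF lt_nj) mulr0 big1 // => a _.
  by rewrite ['C(a, j)]bin_small ?muln0 ?mulr0 //; have := ltn_ord a; lia.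
rewrite -(big_mkord xpredT (fun a => (-1) ^+ a * ('C(n, a) * 'C(a, j))%:R)).
rewrite (big_cat_nat (n := j)) //=; last by lia.
rewrite big_nat big1 ?add0r => [|a /andP[_ a_j]]; last first.
  by rewrite ['C(a, j)]bin_small ?muln0 ?mulr0.
rewrite -{1}[j]add0n big_addn big_mkord subSn //.
transitivity ((-1) ^+ j * 'C(n, j)%:R * \sum_(i < (n - j).+1) (-1) ^+ i * 'C(n - j, i)%:R :> rat).
  rewrite mulr_sumr; apply: eq_bigr => i _.
  rewrite bin_mul_bin; last by have := ltn_ord i; lia.
  by rewrite exprD natrM; ring.
have := exprDn 1 (-1 : rat) (n - j); rewrite subrr expr0n.
under eq_bigr => i _ do rewrite expr1n mul1r -mulr_natr.
move=> <-; rewrite -mulrA; congr (_ * _); rewrite subn_eq0 eqn_leq le_jn andbT.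
have [le_nj|] := leqP n j; last by rewrite mulr0.
have -> : n = j by apply/eqP; rewrite eqn_leq le_nj.
by rewrite binn mulr1.
Qed.

(** By Pascal's rule the left-hand sides for n + 1 and for n differ by the sum
    of [alt_bin]. *)
Lemma alt_bin_pred k n j : (n < k)%N ->
  \sum_(1 <= a < k) (-1) ^+ a * ('C(n, a) * 'C(a - 1, j))%:R
  = (-1) ^+ j.+1 * (j < n)%N%:R :> rat.
Proof.
move=> lt_nk.
transitivity (\sum_(a < n) (-1) ^+ a.+1 * ('C(n, a.+1) * 'C(a, j))%:R : rat).
  rewrite -(big_mkord xpredT (fun a => (-1) ^+ a.+1 * ('C(n, a.+1) * 'C(a, j))%:R)).
  rewrite (big_cat_nat (n := n.+1)) //= big_add1 /=.
  rewrite [X in _ + X]big_nat [X in _ + X]big1 ?addr0 => [|a /andP[n_a _]]; last first.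
    by rewrite bin_small ?mul0n ?mulr0.
  by apply: eq_bigr => a _; rewrite subSS subn0.
elim: n {lt_nk} => [|n IHn]; first by rewrite big_ord0 mulr0.
have := alt_bin n j.
transitivity (\sum_(a < n) (-1) ^+ a.+1 * ('C(n, a.+1) * 'C(a, j))%:R
    - \sum_(a < n.+1) (-1) ^+ a * ('C(n, a) * 'C(a, j))%:R : rat).
  rewrite [X in X - _](_ : _ = \sum_(a < n.+1) (-1) ^+ a.+1 * ('C(n, a.+1) * 'C(a, j))%:R).
    rewrite -sumrB; apply: eq_bigr => a _.
    rewrite binS !natrM natrD exprS.
    by rewrite mulN1r !mulNr mulrDl mulrDr opprD.
  by rewrite big_ord_recr /= bin_small ?mul0n ?mulr0 ?addr0.
rewrite IHn alt_bin exprS mulN1r ltnS [(j <= n)%N]leq_eqVlt [n == j]eq_sym.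
case: (j =P n) => [->|_] /=; last by rewrite mulr0 subr0.
by rewrite ltnn mulr0 sub0r mulr1 mulr1.
Qed.

(** * The odd indices *)

Lemma od_bounds k (j : 'I_(nod k)) : (3 <= od j)%N && (od j <= k - 3)%N && odd (od j).
Proof. by have := ltn_ord j; rewrite /od /nod /=; lia. Qed.

Lemma od_eq k (i j : 'I_(nod k)) : (od i == od j :> nat) = (i == j).
Proof. by apply/eqP/eqP => [|-> //]; rewrite /od => e; apply: val_inj => /=; lia. Qed.

Lemma od_rev k (j : 'I_(nod k)) : ~~ odd k -> od (rev_ord j) = (k - od j)%N.
Proof. by move=> ek; have := ltn_ord j; rewrite /od /nod /=; lia. Qed.

Lemma even_index_cases k i : (6 <= k)%N -> ~~ odd k -> ~~ odd i -> (i <= k - 2)%N ->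
  [\/ i = 0%N, i = (k - 2)%N | exists j : 'I_(nod k), i = (od j - 1)%N].
Proof.
move=> k6 ek ei le_i; have [->|i0] := eqVneq i 0%N; first by constructor.
have [->|i2] := eqVneq i (k - 2)%N; first by constructor.
have : odd i.+1 && (3 <= i.+1 <= k - 3)%N by rewrite /= ei; move: ei ek; lia.
by move/(odP _ k6 ek) => [j ij]; constructor 3; exists j; rewrite -ij subn1.
Qed.

Lemma sum_even (V : nmodType) (F : nat -> V) n :
  \sum_(i < n.*2.+1 | ~~ odd i) F i = \sum_(t < n.+1) F t.*2.
Proof.
elim: n => [|n IHn]; first by rewrite !big_mkcond !big_ord1.
rewrite [RHS]big_ord_recr /= -IHn doubleS [LHS]big_mkcond big_ord_recr /= odd_double negbK /=.
by rewrite big_ord_recr /= odd_double addr0 -big_mkcond.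
Qed.

(** The odd numbers i + 1 below k are 1, the [od j], and k - 1. *)
Lemma sum_even_od (V : nmodType) (F : nat -> V) k : (6 <= k)%N -> ~~ odd k ->
  \sum_(i < k.-1 | ~~ odd i) F i = F 0%N + \sum_(j < nod k) F (od j - 1)%N + F (k - 2)%N.
Proof.
move=> k6 ek; have kE : k.-1 = (nod k).+1.*2.+1 by rewrite /nod; lia.
rewrite kE sum_even big_ord_recl big_ord_recr /= addrA; congr (_ + _ + F _).
by rewrite /bump /=; lia.
Qed.

Lemma sum_odd_od (V : nmodType) (F : nat -> V) k : (6 <= k)%N -> ~~ odd k ->
  \sum_(3 <= l < k - 2 | odd l) F l = \sum_(j < nod k) F (od j).
Proof.
move=> k6 ek; have step n : \sum_(3 <= l < n.*2.+3 | odd l) F l = \sum_(j < n) F j.*2.+3.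
  elim: n => [|n IHn]; first by rewrite big_geq ?big_ord0.
  rewrite [RHS]big_ord_recr /= -IHn doubleS big_mkcond big_nat_recr //= big_nat_recr //=.
  by rewrite odd_double addr0 -big_mkcond.
rewrite -[RHS]step [RHS]big_mkcond.
have -> : (nod k).*2.+3 = (k - 2).+1 by rewrite /nod; lia.
have ek2 : odd (k - 2) = false by rewrite oddB ?(negbTE ek) //; lia.
by rewrite big_nat_recr /= ?ek2 ?addr0 -?big_mkcond //; lia.
Qed.

(** * Binary forms *)

Definition mono (i j : nat) : QXY := pX ^+ i * pY ^+ j.

Definition coefXY (i j : nat) (p : QXY) : rat := p@_[multinom [tuple i; j]].

Lemma big_ord2 (R : Type) (idx : R) (op : Monoid.law idx) (F : 'I_2 -> R) :
  \big[op/idx]_(i < 2) F i = op (F (@Ordinal 2 0 isT)) (F (@Ordinal 2 1 isT)).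
Proof.
rewrite !big_ord_recl big_ord0 Monoid.mulm1.
by congr (op (F _) (F _)); apply: val_inj.
Qed.

Lemma mnm2P (m : 'X_{1..2}) : m = [multinom [tuple m (@Ordinal 2 0 isT); m (@Ordinal 2 1 isT)]].
Proof.
apply/mnmP => -[[|[|//]] lt_i]; rewrite multinomE (tnth_nth 0%N) /=; congr (m _); exact: val_inj.
Qed.

Lemma monoE i j : mono i j = 'X_[ [multinom [tuple i; j]] ].
Proof. by rewrite mpolyXE_id big_ord2 !multinomE !(tnth_nth 0%N). Qed.

Lemma coefXY_linear i j : linear (coefXY i j : QXY -> rat^o).
Proof. by move=> a p q; rewrite /coefXY mcoeffD mcoeffZ. Qed.

HB.instance Definition _ i j := GRing.isLinear.Build rat QXY rat^o *:%R (coefXY i j) (@coefXY_linear i j).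

Lemma coefXY_mono i j a b : coefXY i j (mono a b) = ((a == i) && (b == j))%:R.
Proof.
rewrite /coefXY monoE mcoeffX; congr (nat_of_bool _)%:R; apply/eqP/andP => [/mnmP e|[/eqP-> /eqP->] //].
have := e (@Ordinal 2 0 isT); have := e (@Ordinal 2 1 isT).
by rewrite !multinomE !(tnth_nth 0%N) /= => -> ->.
Qed.

(** Polynomials are combinations of monomials, so linear maps need only be
    compared there; identities for substitutions, coefficients and [Phi] are
    checked in this way. *)
Lemma mono_ext (V : lmodType rat) (F G : {linear QXY -> V}) :
  (forall a b, F (mono a b) = G (mono a b)) -> F =1 G.
Proof.
move=> FG p; rewrite (mpolyE p) !linear_sum; apply: eq_bigr => m _.
by rewrite !linearZ_LR /= [m]mnm2P -monoE FG.
Qed.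

Lemma QXYP (p q : QXY) : (forall i j, coefXY i j p = coefXY i j q) -> p = q.
Proof. by move=> pq; apply/mpolyP => m; rewrite [m]mnm2P; exact: pq. Qed.

(** ** Substitutions *)

Lemma subst2D p q f g : subst2 (p + q) f g = subst2 p f g + subst2 q f g.
Proof. exact: comp_mpolyD. Qed.
Lemma subst2B p q f g : subst2 (p - q) f g = subst2 p f g - subst2 q f g.
Proof. exact: comp_mpolyB. Qed.
Lemma subst2N p f g : subst2 (- p) f g = - subst2 p f g.
Proof. exact: comp_mpolyN. Qed.
Lemma subst2Z c p f g : subst2 (c *: p) f g = c *: subst2 p f g.
Proof. exact: comp_mpolyZ. Qed.
Lemma subst2X f g : subst2 pX f g = f.
Proof. exact: comp_mpolyXU. Qed.
Lemma subst2Y f g : subst2 pY f g = g.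
Proof. exact: comp_mpolyXU. Qed.
Lemma subst2M p q f g : subst2 (p * q) f g = subst2 p f g * subst2 q f g.
Proof. exact: rmorphM. Qed.
Lemma subst2Xn p n f g : subst2 (p ^+ n) f g = subst2 p f g ^+ n.
Proof. exact: rmorphXn. Qed.
Lemma subst2_sum I (r : seq I) (P : pred I) (F : I -> QXY) f g :
  subst2 (\sum_(i <- r | P i) F i) f g = \sum_(i <- r | P i) subst2 (F i) f g.
Proof. exact: (linear_sum (comp_mpoly [tuple f; g])). Qed.

Lemma subst2_mono a b f g : subst2 (mono a b) f g = f ^+ a * g ^+ b.
Proof. by rewrite subst2M !subst2Xn subst2X subst2Y. Qed.

Definition substE := (subst2D, subst2B, subst2N, subst2X, subst2Y).

Lemma subst2_comp p f g f' g' :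
  subst2 (subst2 p f g) f' g' = subst2 p (subst2 f f' g') (subst2 g f' g').
Proof.
apply: (mono_ext (F := comp_mpoly [tuple f'; g'] \o comp_mpoly [tuple f; g])
  (G := comp_mpoly [tuple subst2 f f' g'; subst2 g f' g'])) => a b /=.
rewrite -[LHS]/(subst2 (subst2 (mono a b) f g) f' g').
rewrite -[RHS]/(subst2 (mono a b) (subst2 f f' g') (subst2 g f' g')).
by rewrite !subst2_mono subst2M !subst2Xn.
Qed.

Lemma subst2_id p : subst2 p pX pY = p.
Proof.
apply: (mono_ext (F := comp_mpoly [tuple pX; pY]) (G := idfun)) => a b /=.
exact: (subst2_mono a b pX pY).
Qed.

Lemma subst2_homog d p f g : f \is 1.-homog -> g \is 1.-homog -> p \is d.-homog ->
  subst2 p f g \is d.-homog.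
Proof.
move=> hf hg /dhomogP hp; rewrite (mpolyE p) subst2_sum big_seq.
apply: rpred_sum => m /hp; rewrite /= mdegE big_ord2 => md.
rewrite subst2Z rpredZ // [m]mnm2P -monoE subst2_mono -md.
have hX n (h : QXY) : h \is 1.-homog -> h ^+ n \is n.-homog.
  by move/(dhomogMn n); rewrite mul1n.
by apply: dhomogM; apply: hX.
Qed.

Lemma mono_homog i j : mono i j \is (i + j).-homog.
Proof.
by rewrite monoE dhomogX /= mdegE big_ord2 !multinomE !(tnth_nth 0%N).
Qed.

Lemma pX_homog : pX \is 1.-homog.
Proof. by have := mono_homog 1 0; rewrite /mono expr1 expr0 mulr1. Qed.
Lemma pY_homog : pY \is 1.-homog.
Proof. by have := mono_homog 0 1; rewrite /mono expr1 expr0 mul1r. Qed.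

Lemma coefXY_out d p i j : p \is d.-homog -> (i + j != d)%N -> coefXY i j p = 0.
Proof.
move=> hp ij; apply: (dhomog_nemf_coeff hp).
by rewrite /= mdegE big_ord2 !multinomE !(tnth_nth 0%N).
Qed.

Lemma QXY_E p : p = \sum_(m <- msupp p) p@_m *: mono (m (@Ordinal 2 0 isT)) (m (@Ordinal 2 1 isT)).
Proof. by rewrite {1}(mpolyE p); apply: eq_bigr => m _; rewrite monoE -mnm2P. Qed.

Lemma subst2_opp d p f g : p \is d.-homog -> subst2 p (- f) (- g) = (-1) ^+ d *: subst2 p f g.
Proof.
move=> /dhomogP hp; rewrite [p in LHS]QXY_E [p in RHS]QXY_E !subst2_sum scaler_sumr !big_seq.
apply: eq_bigr => m /hp; rewrite /= mdegE big_ord2 => md.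
rewrite !subst2Z !subst2_mono -md !(exprNn f) (exprNn g) exprD.
rewrite !scalerA [_ * _@_ _]mulrC -scalerA; congr (_ *: _).
have sgE n : (-1) ^+ n = ((-1) ^+ n : rat)%:A :> QXY.
  by rewrite -signr_odd -[in RHS]signr_odd; case: odd; rewrite ?scaleN1r ?scale1r.
rewrite !sgE -!scalerAl -!scalerAr !mul1r scalerA.
done.
Qed.

Lemma binom_mono n : (pX + pY) ^+ n = \sum_(l < n.+1) 'C(n, l)%:R *: mono l (n - l).
Proof.
rewrite addrC exprDn; apply: eq_bigr => l _.
by rewrite scaler_nat /mono mulrC.
Qed.

Lemma coefXY_swap i j p : coefXY i j (subst2 p pY pX) = coefXY j i p.
Proof.
apply: (mono_ext (V := rat^o) (F := coefXY i j \o comp_mpoly [tuple pY; pX]) (G := coefXY j i)) => a b /=.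
rewrite -[LHS]/(coefXY i j (subst2 (mono a b) pY pX)) subst2_mono mulrC -/(mono b a) !coefXY_mono.
by rewrite andbC.
Qed.

Lemma mulr_rato (x : rat) (y : rat^o) : x *: y = x * y. Proof. by []. Qed.

Lemma coefXY_sign i j p : coefXY i j (subst2 p (- pX) pY) = (-1) ^+ i * coefXY i j p.
Proof.
pose G (q : QXY) : rat^o := (-1) ^+ i * coefXY i j q.
have G_lin : linear G by move=> c u v; rewrite /G linearP /= !mulr_rato; ring.
pose GL : {linear QXY -> rat^o} := HB.pack G (GRing.isLinear.Build rat QXY rat^o *:%R G G_lin).
apply: (mono_ext (V := rat^o) (F := coefXY i j \o comp_mpoly [tuple - pX; pY]) (G := GL)) => a b /=.
rewrite -[LHS]/(coefXY i j (subst2 (mono a b) (- pX) pY)) subst2_mono.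
have -> : (- pX) ^+ a * pY ^+ b = (-1) ^+ a *: mono a b.
  rewrite -signr_odd -[- pX]scaleN1r exprZn -scalerAl; congr (_ *: _).
  by rewrite signr_odd.
rewrite linearZ_LR /= /G coefXY_mono mulr_rato; have [->|_] := eqVneq a i => //.
by rewrite !mulr0.
Qed.

Lemma coefXY_shift i j p : coefXY i j (subst2 p (pX + pY) pY)
  = \sum_(l < (i + j).+1) 'C(l, i)%:R * coefXY l (i + j - l) p.
Proof.
pose G (q : QXY) : rat^o := \sum_(l < (i + j).+1) 'C(l, i)%:R * coefXY l (i + j - l) q.
have G_lin : linear G.
  move=> c u v; rewrite /G scaler_sumr -big_split; apply: eq_bigr => l _ /=.
  by rewrite linearP /= !mulr_rato; ring.
pose GL : {linear QXY -> rat^o} := HB.pack G (GRing.isLinear.Build rat QXY rat^o *:%R G G_lin).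
apply: (mono_ext (V := rat^o) (F := coefXY i j \o comp_mpoly [tuple pX + pY; pY]) (G := GL)) => a b /=.
rewrite -[LHS]/(coefXY i j (subst2 (mono a b) (pX + pY) pY)) subst2_mono binom_mono mulr_suml linear_sum.
have monoY l m : mono l m * pY ^+ b = mono l (m + b) by rewrite /mono exprD mulrA.
under eq_bigr => l _ do rewrite -scalerAl linearZ_LR monoY /= coefXY_mono.
rewrite /G; under [RHS]eq_bigr => l _ do rewrite coefXY_mono.
have [ab|ab] := eqVneq (a + b)%N (i + j)%N; last first.
  rewrite !big1 // => l _.
    rewrite (_ : _ && _ = false) ?mulr0 //; apply/andP => -[/eqP al /eqP bl].
    by move: ab; rewrite al bl subnKC ?eqxx // -ltnS.
  rewrite mulr_rato (_ : _ && _ = false) ?mulr0 //; apply/andP => -[/eqP al /eqP bl].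
  by move: ab (ltn_ord l); rewrite -al -bl; lia.
have lt_a : (a < (i + j).+1)%N by lia.
rewrite [RHS](bigD1 (Ordinal lt_a)) //= eqxx (_ : b == _); last by rewrite -ab addKn.
rewrite /= mulr1 [X in _ = _ + X]big1 ?addr0 => [|l ne_l]; last first.
  rewrite (_ : _ && _ = false) ?mulr0 //; apply/andP => -[/eqP al _].
  by move/eqP: ne_l; apply; apply: val_inj.
have [lt_ai|le_ia] := ltnP a i.
  rewrite bin_small // big1 // => l _; rewrite mulr_rato (_ : _ && _ = false) ?mulr0 //.
  by apply/andP => -[/eqP li _]; move: (ltn_ord l); lia.
have lt_i : (i < a.+1)%N by [].
rewrite (bigD1 (Ordinal lt_i)) //= eqxx (_ : (_ == j)) /= ?mulr_rato ?mulr1; last by lia.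
rewrite big1 ?addr0 // => l ne_l; rewrite mulr_rato (_ : _ && _ = false) ?mulr0 //.
by apply/andP => -[/eqP li _]; move/eqP: ne_l; apply; apply: val_inj.
Qed.

Lemma coefXY_X0 j p : coefXY 0 j (subst2 p 0 pY) = coefXY 0 j p.
Proof.
apply: (mono_ext (V := rat^o) (F := coefXY 0 j \o comp_mpoly [tuple 0; pY]) (G := coefXY 0 j)) => a b /=.
rewrite -[LHS]/(coefXY 0 j (subst2 (mono a b) 0 pY)) subst2_mono.
case: a => [|a]; first by [].
by rewrite exprS !mul0r linear0 coefXY_mono.
Qed.

Lemma coefXY_XmXYn d i l : (i <= d)%N -> (l <= d)%N ->
  coefXY i (d - i) (pX ^+ l * (pX + pY) ^+ (d - l)) = if (l <= i)%N then 'C(d - l, i - l)%:R else 0.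
Proof.
move=> le_id le_ld; rewrite binom_mono mulr_sumr linear_sum.
have monoX a b : pX ^+ l * mono a b = mono (a + l) b by rewrite /mono mulrA addnC exprD.
under eq_bigr => j _ do rewrite -scalerAr linearZ_LR monoX /= coefXY_mono mulr_rato.
have [le_li|lt_il] := leqP l i; last first.
  by rewrite big1 // => j _; rewrite (_ : (j + l == i)%N = false) ?mulr0 //; lia.
have lt_j : (i - l < (d - l).+1)%N by lia.
rewrite (bigD1 (Ordinal lt_j)) //= big1 => [|j ne_j].
  by rewrite subnK // eqxx (_ : (_ == _)%N) ?mulr1 ?addr0 //; lia.
rewrite (_ : (j + l == i)%N = false) ?mulr0 //.
by apply: contraNF ne_j => /eqP e; apply/eqP/val_inj => /=; lia.
Qed.

(** ** Forms as combinations of double zeta symbols *)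

Section Phi.
Variable k : nat.

(** The monomial X^(r-1) Y^(s-1) is read as Z_{r,s} / C(k-2, r-1). With this
    normalisation, replacing Y by X + Y produces the binomial coefficients of the
    shuffle product ([Phi_binom]). *)
Definition Phi (p : QXY) : Dtilde k :=
  \sum_(i < k.-1) coefXY i (k - 2 - i) p *: ('C(k - 2, i)%:R^-1 *: DtZ k i.+1 (k - 1 - i)).

Lemma Phi_linear : linear Phi.
Proof.
move=> a p q; rewrite /Phi scaler_sumr -big_split; apply: eq_bigr => i _ /=.
by rewrite /coefXY mcoeffD mcoeffZ scalerDl -scalerA.
Qed.

HB.instance Definition _ := GRing.isLinear.Build rat QXY (Dtilde k) *:%R Phi Phi_linear.

Lemma Phi_mono_out a b : (a + b != k - 2)%N -> Phi (mono a b) = 0.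
Proof.
move=> ab; rewrite /Phi big1 // => i _; rewrite coefXY_mono (_ : _ && _ = false) ?scale0r //.
by apply/andP => -[/eqP ai /eqP bi]; move: (ltn_ord i) ab; lia.
Qed.

Lemma Phi_mono a b : (a + b).+2 = k ->
  Phi (mono a b) = 'C(k - 2, a)%:R^-1 *: DtZ k a.+1 b.+1.
Proof.
move=> ab; have lt_a : (a < k.-1)%N by lia.
rewrite /Phi (bigD1 (Ordinal lt_a)) //= coefXY_mono eqxx (_ : b == _); last by lia.
rewrite scale1r big1 ?addr0 => [|i ne_i]; last first.
  rewrite coefXY_mono (_ : _ && _ = false) ?scale0r //; apply/andP => -[/eqP ai _].
  by move/eqP: ne_i; apply; apply: val_inj.
by congr (_ *: DtZ k _ _); lia.
Qed.

(** Adding the image under X |-> -X cancels the symbols with even indices. *)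
Lemma Phi_even_part p :
  Phi p + Phi (subst2 p (- pX) pY)
  = 2%:R *: \sum_(i < k.-1 | ~~ odd i)
      (coefXY i (k - 2 - i) p / 'C(k - 2, i)%:R) *: DtZ k i.+1 (k - 1 - i).
Proof.
rewrite /Phi -big_split /= scaler_sumr [RHS]big_mkcond.
apply: eq_bigr => i _; rewrite coefXY_sign -scalerDl.
have [oi|ei] := boolP (odd i); first by rewrite -signr_odd oi expr1 mulN1r subrr scale0r.
rewrite -signr_odd (negbTE ei) expr0 mul1r !scalerA; congr (_ *: _).
by rewrite mulrA mulr_natl mulr2n.
Qed.

(** The form that [Phi] sends to Z_{r,k-r}. *)
Definition zmono (r : nat) : QXY := 'C(k - 2, r.-1)%:R *: mono r.-1 (k - r).-1.

Lemma Phi_zmono r : (0 < r < k)%N -> Phi (zmono r) = DtZ k r (k - r).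
Proof.
move=> r_k; rewrite (linearZ_LR Phi) /= Phi_mono; last by lia.
have -> : r.-1.+1 = r by lia.
have -> : (k - r).-1.+1 = (k - r)%N by lia.
move: (DtZ k _ _) => z; rewrite scalerA divff ?scale1r // Num.Theory.pnatr_eq0 -lt0n bin_gt0.
by lia.
Qed.

Lemma XmXYn_zmono a b : (a + b).+2 = k ->
  'C(k - 2, a)%:R *: (pX ^+ a * (pX + pY) ^+ b) = \sum_(1 <= c < k) 'C(c.-1, a)%:R *: zmono c.
Proof.
move=> ab; rewrite binom_mono mulr_sumr scaler_sumr.
have monoX l m : pX ^+ a * mono l m = mono (a + l) m by rewrite /mono exprD mulrA.
under eq_bigr => l _ do rewrite -scalerAr monoX.
rewrite [RHS](big_cat_nat (n := a.+1)) //=; last by lia.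
rewrite [X in X + _]big_nat [X in X + _]big1 ?add0r => [|c c_a]; last first.
  by rewrite bin_small ?scale0r //; lia.
rewrite -{1}[a.+1]add0n big_addn big_mkord (_ : k - a.+1 = b.+1)%N; last by lia.
apply: eq_bigr => l _; have le_lb : (l <= b)%N by rewrite -ltnS.
rewrite /zmono addnS /= addnC; have -> : (k - (l + a).+1).-1 = (b - l)%N by lia.
rewrite !scalerA -!natrM; congr (_%:R *: _).
have := @bin_mul_bin (k - 2) l a ltac:(lia).
have -> : (k - 2 - a = b)%N by lia.
by move=> <-; rewrite mulnC.
Qed.

Lemma Phi_binom a b : (a + b).+2 = k ->
  'C(k - 2, a)%:R *: Phi (pX ^+ a * (pX + pY) ^+ b)
  = \sum_(1 <= c < k) 'C(c - 1, a)%:R *: DtZ k c (k - c).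
Proof.
move=> ab; rewrite -(linearZ_LR Phi) XmXYn_zmono // (linear_sum Phi).
apply: eq_big_nat => c c_k; rewrite (linearZ_LR Phi) /=.
by rewrite Phi_zmono // subn1.
Qed.

Hypothesis k_gt2 : (2 < k)%N.

(** For h = X^(r-1) Y^(s-1) and up to the factor C(k-2, r-1), the left-hand
    side is the stuffle product Z_{r,s} + Z_{s,r} and the right-hand side the
    shuffle product, so both are P_{r,s}. *)
Lemma Phi_rel h :
  Phi (h + subst2 h pY pX) = Phi (subst2 h pX (pX + pY) + subst2 h (pX + pY) pX).
Proof.
rewrite !(linearD Phi) /=; pose S (q : QXY) f g := subst2 q f g.
pose F (q : QXY) : Dtilde k := Phi q + Phi (S q pY pX).
pose G (q : QXY) : Dtilde k := Phi (S q pX (pX + pY)) + Phi (S q (pX + pY) pX).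
have F_lin : linear F.
  by move=> c u v; rewrite /F /S subst2D subst2Z !linearP /= scalerDr addrACA.
have G_lin : linear G.
  by move=> c u v; rewrite /G /S !subst2D !subst2Z !linearP /= scalerDr addrACA.
pose FL : {linear QXY -> Dtilde k} := HB.pack F (GRing.isLinear.Build rat QXY (Dtilde k) *:%R F F_lin).
pose GL : {linear QXY -> Dtilde k} := HB.pack G (GRing.isLinear.Build rat QXY (Dtilde k) *:%R G G_lin).
apply: (mono_ext (F := FL) (G := GL)) => a b /=; rewrite /F /G /S !subst2_mono.
have -> : pY ^+ a * pX ^+ b = mono b a by rewrite mulrC.
have [ab|ab] := eqVneq (a + b)%N (k - 2)%N; last first.
  have out c d : (c + d != k - 2)%N -> Phi (pX ^+ c * (pX + pY) ^+ d) = 0.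
    move=> cd; rewrite binom_mono mulr_sumr (linear_sum Phi) big1 // => l _.
    rewrite -scalerAr (linearZ_LR Phi) /= /mono mulrA -exprD -/(mono _ _) Phi_mono_out ?scaler0 //.
    by rewrite -addnA subnKC // -ltnS.
  rewrite [(pX + pY) ^+ a * _]mulrC (Phi_mono_out ab) (out _ _ ab).
  by rewrite addnC in ab; rewrite (Phi_mono_out ab) (out _ _ ab).
have ak : (a + b).+2 = k by lia.
have bk : (b + a).+2 = k by lia.
have c0 : 'C(k - 2, a)%:R != 0 :> rat by rewrite Num.Theory.pnatr_eq0 -lt0n bin_gt0; lia.
have cE : 'C(k - 2, b) = 'C(k - 2, a).
  by rewrite -(@bin_sub (k - 2) a); [congr 'C(_, _); lia|lia].
have B1 := Phi_binom ak; have B2 := Phi_binom bk; rewrite cE in B2.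
have M1 := Phi_mono ak; have M2 := Phi_mono bk; rewrite cE in M2.
have R : 'C(k - 2, a)%:R *: (Phi (pX ^+ a * (pX + pY) ^+ b) + Phi (pX ^+ b * (pX + pY) ^+ a))
    = \sum_(1 <= c < k) 'C(c - 1, a)%:R *: DtZ k c (k - c)
      + \sum_(1 <= c < k) 'C(c - 1, b)%:R *: DtZ k c (k - c).
  by move: (Phi _) (Phi _) B1 B2 => u v B1 B2; rewrite scalerDr B1 B2.
have L : 'C(k - 2, a)%:R *: (Phi (mono a b) + Phi (mono b a))
    = DtZ k a.+1 b.+1 + DtZ k b.+1 a.+1.
  by move: (Phi _) (Phi _) M1 M2 => u v -> ->; rewrite scalerDr !scalerA divff // !scale1r.
apply: (scalerI c0); rewrite [(pX + pY) ^+ a * _]mulrC.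
rewrite [LHS]L [RHS]R.
have rs : (a.+1 + b.+1 = k)%N by lia.
rewrite -(DtP_stuffle (ltn0Sn a) (ltn0Sn b) rs) (DtP_shuffle (ltn0Sn a) (ltn0Sn b) rs) -big_split.
by apply: eq_bigr => c _ /=; rewrite natrD scalerDl !subn1.
Qed.

(** Half of [Phi_rel]. *)
Lemma Phi_rel_sym h : subst2 h pY pX = h -> Phi h = Phi (subst2 h pX (pX + pY)).
Proof.
move=> hsym; have := Phi_rel h; rewrite hsym.
have -> : subst2 h (pX + pY) pX = subst2 h pX (pX + pY).
  by rewrite -[in RHS]hsym subst2_comp !substE.
rewrite (linearD Phi h h) (linearD Phi (subst2 h pX (pX + pY)) (subst2 h pX (pX + pY))) /=.
move: (Phi h) (Phi _) => u v; rewrite -!mulr2n -!scaler_nat; apply: scalerI.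
by rewrite Num.Theory.pnatr_eq0.
Qed.

Lemma Phi_swap p : Phi (subst2 p pY pX)
  = \sum_(i < k.-1) coefXY i (k - 2 - i) p *: ('C(k - 2, i)%:R^-1 *: DtZ k (k - 1 - i) i.+1).
Proof.
rewrite [LHS](reindex_inj rev_ord_inj); apply: eq_bigr => i _.
have lt_i := ltn_ord i; have i_k : (i <= k - 2)%N by lia.
rewrite [nat_of_ord (rev_ord i)]/=.
have -> : (k - 1 - (k.-1 - i.+1) = i.+1)%N by lia.
have -> : (k.-1 - i.+1).+1 = (k - 1 - i)%N by lia.
have -> : (k.-1 - i.+1 = k - 2 - i)%N by lia.
by rewrite coefXY_swap (subKn i_k) (bin_sub i_k).
Qed.

Hypothesis k_even : ~~ odd k.

(** Such a form is read as a combination of the P_{r,s} with r and s even,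
    because the exponents are r - 1 and s - 1. *)
Lemma Phi_odd_sym o : subst2 o pY pX = o -> (forall i j, ~~ odd i -> coefXY i j o = 0) -> Phi o = 0.
Proof.
move=> osym oodd; have : Phi o + Phi (subst2 o pY pX) = 0.
  rewrite Phi_swap /Phi -big_split big1 // => i _ /=; have lt_i := ltn_ord i.
  have i0 : (0 < i.+1)%N by []. have j0 : (0 < k - 1 - i)%N by lia.
  have ij : (i.+1 + (k - 1 - i) = k)%N by lia.
  rewrite -!scalerDr -(DtP_stuffle i0 j0 ij).
  have [oi|ei] := boolP (odd i); last by rewrite oodd // scale0r.
  by rewrite (DtP_even i0 j0 _ _ ij) ?scaler0 //; move: k_even; lia.
rewrite osym -mulr2n -scaler_nat => /eqP; rewrite scaler_eq0 Num.Theory.pnatr_eq0 /=.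
by move/eqP.
Qed.

End Phi.

(** * Cramer's rule for the replaced rows *)

(** Laplace expansion along the replaced row, whose cofactors do not see the
    replacement. *)
Lemma det_replace_row (R : comNzRingType) n (A : 'M[R]_n) (v : 'rV[R]_n) i :
  \det (\matrix_(i', j) if i' == i then v 0 j else A i' j) = (v *m \adj A) 0 i.
Proof.
rewrite (expand_det_row _ i) mxE; apply: eq_bigr => j _; rewrite !mxE eqxx; congr (_ * _).
rewrite /cofactor; congr (_ * \det _); apply/matrixP => x y; rewrite !mxE.
by rewrite eq_sym (negbTE (neq_lift _ _)).
Qed.

(** The row that replaces a row of [Amx k] in the definition of [chat]. *)
Definition qrow (k : nat) (p : QXY) : 'rV[rat]_(nod k) :=
  \row_j (2%:R * (qcoef k p (od j) (k - od j) - qcoef k p (k - 1) 1)).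

Lemma chat_adj k p (i : 'I_(nod k)) : chat p i = (qrow k p *m \adj (Amx k)) 0 i.
Proof.
rewrite -det_replace_row; congr (\det _); apply/matrixP => x y.
by rewrite !mxE.
Qed.

(** Cramer's rule, in the form that also holds for a singular matrix. *)
Lemma chat_mulA k p : (\row_(i < nod k) chat p i) *m Amx k = \det (Amx k) *: qrow k p.
Proof.
have -> : \row_(i < nod k) chat p i = qrow k p *m \adj (Amx k).
  by apply/rowP => i; rewrite mxE chat_adj.
by rewrite -mulmxA mul_adj_mx mul_mx_scalar.
Qed.

(** * Even period polynomials *)

(** The coefficient of X^(l-1) in q(X+Y,Y) - q is l q_l plus a combination of
    the q_i with i > l, so the q_l with l > 0 vanish, starting from the top. *)
Lemma shift_invariant d (q : QXY) : q \is d.-homog -> subst2 q (pX + pY) pY = q ->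
  q = coefXY 0 d q *: pY ^+ d.
Proof.
move=> hq inv.
have cf0 l : (0 < l <= d)%N -> coefXY l (d - l) q = 0.
  have [n] := ubnP (d - l); elim: n l => // n IHn l le_n l_d.
  have := congr1 (coefXY l.-1 (d - l.-1)) inv; rewrite coefXY_shift.
  have -> : (l.-1 + (d - l.-1) = d)%N by lia.
  have lt_l : (l < d.+1)%N by lia.
  have lt_l1 : (l.-1 < d.+1)%N by lia.
  rewrite (bigD1 (Ordinal lt_l1)) //= binn mul1r (bigD1 (Ordinal lt_l)) /=; last first.
    by apply/eqP => /(congr1 val) /=; lia.
  rewrite big1 => [|i /andP[i1 i2]].
    have -> : 'C(l, l.-1) = l by rewrite -{1}(prednK (n := l)) ?binSn ?prednK //; lia.
    rewrite addr0 => /eqP; rewrite -subr_eq0 addrAC subrr add0r mulf_eq0 Num.Theory.pnatr_eq0.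
    by case/orP => /eqP //; lia.
  have {}i1 : (i : nat) != l.-1 by apply: contraNneq i1 => e; apply/eqP/val_inj.
  have {}i2 : (i : nat) != l by apply: contraNneq i2 => e; apply/eqP/val_inj.
  have [i_l|l_i] := ltnP i l.-1; first by rewrite bin_small ?mul0r.
  by rewrite IHn ?mulr0 //; have := ltn_ord i; lia.
have -> : pY ^+ d = mono 0 d by rewrite /mono expr0 mul1r.
apply: QXYP => i j; rewrite linearZ_LR /= coefXY_mono mulr_rato.
have [ij|ij] := eqVneq (i + j)%N d; last first.
  rewrite (coefXY_out hq ij) (_ : _ && _ = false) ?mulr0 //.
  by apply/andP => -[/eqP i0 /eqP j0]; move: ij; rewrite -i0 -j0 add0n eqxx.
have -> : j = (d - i)%N by lia.
case: i ij => [|i] ij; first by rewrite subn0 !eqxx mulr1.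
by rewrite /= mulr0 cf0 //; lia.
Qed.

Section Weven.
Variables (k : nat) (p : QXY).
Hypothesis k_ge6 : (6 <= k)%N.
Hypothesis k_even : ~~ odd k.
Hypothesis Wp : Weven k p.

Let P f g := subst2 p f g.

Lemma Weven_homog : p \is (k - 2).-homog. Proof. by case: Wp. Qed.

Lemma Weven_lewis f g : P f g = P (f + g) g - P (f + g) f.
Proof.
have [_ e] := Wp; rewrite /P {1}e subst2B !subst2_comp.
by rewrite !substE.
Qed.

(** The right-hand side of the defining equation changes sign when X and Y are
    exchanged. *)
Lemma Weven_anti f g : P g f = - P f g.
Proof. by rewrite [P g f]Weven_lewis [P f g]Weven_lewis addrC [g + f]addrC addrC opprB. Qed.

(** The difference d = p(X,Y) - p(X,-Y) satisfies d(X+Y,Y) = d, by the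
    defining equation for both terms. By [shift_invariant] it is a multiple of
    Y^(k-2), which is even in Y, while d is odd in Y. *)
Lemma Weven_oppr f g : P f (- g) = P f g.
Proof.
suff H : P pX (- pY) = p.
  by have := congr1 (fun q => subst2 q f g) H; rewrite /P subst2_comp !substE.
pose d := p - P pX (- pY).
have hd : d \is (k - 2).-homog.
  rewrite rpredB ?Weven_homog //; apply: subst2_homog Weven_homog; first exact: pX_homog.
  by rewrite rpredN pY_homog.
have dinv : subst2 d (pX + pY) pY = d.
  rewrite subst2B subst2_comp !substE -/(P (pX + pY) (- pY)) -/(P _ _).
  have e1 := Weven_lewis pX pY; have e2 := Weven_lewis (pX + pY) (- pY).
  rewrite addrK in e2; rewrite [P pX (pX + pY)]Weven_anti in e2.
  rewrite /d -[p in RHS]subst2_id -[subst2 p pX pY]/(P pX pY) e1 e2.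
  by rewrite opprK opprD addrA addrAC.
have dY : subst2 d pX (- pY) = - d.
  by rewrite /d subst2B subst2_comp !substE opprK subst2_id opprB.
have := shift_invariant hd dinv; set c := coefXY _ _ _ => dE.
have : d = - d.
  rewrite -dY dE subst2Z subst2Xn subst2Y; congr (_ *: _).
  have ek : ~~ odd (k - 2) by move: k_even; lia.
  by rewrite exprNn -signr_odd (negbTE ek) expr0 mul1r.
move/eqP; rewrite -addr_eq0 -mulr2n -scaler_nat scaler_eq0 Num.Theory.pnatr_eq0 /=.
by rewrite subr_eq0 => /eqP.
Qed.

Lemma Weven_oppl f g : P (- f) g = P f g.
Proof. by rewrite Weven_anti Weven_oppr -Weven_anti. Qed.

Let G := P (pX + pY) pY.

(** Put G' = G(-X,Y) = p(X-Y,Y). The form G - G' is symmetric with odd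
    exponents, so G and G' have the same image by [Phi_odd_sym]. The form h = 2
    G' - p is symmetric and h(X,X+Y) = -G - p, so [Phi_rel_sym] gives 2
    Phi(G') = -Phi(G). Hence 3 Phi(G) = 0. *)
Lemma Weven_even_part :
  Phi k G = 0 /\ Phi k (subst2 G (- pX) pY) = 0.
Proof.
have pE : p = P pX pY by rewrite /P subst2_id.
have sG : subst2 G (- pX) pY = P (pX - pY) pY.
  by rewrite subst2_comp !substE -/(P _ _) -Weven_oppl opprD opprK.
have pE1 : p = P (pX + pY) pY - P (pX + pY) pX by rewrite {1}pE Weven_lewis.
have pE2 : P (pX - pY) pY = p + P (pX - pY) pX.
  rewrite [LHS]Weven_lewis subrK [P pX (pX - pY)]Weven_anti opprK -pE.
  by [].
have wG : subst2 G pY pX = G - p.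
  rewrite subst2_comp !substE -/(P _ _) [pY + pX]addrC -[P _ pX in LHS](subKr (P (pX + pY) pY)).
  by rewrite -pE1.
have wsG : subst2 (P (pX - pY) pY) pY pX = P (pX - pY) pY - p.
  rewrite subst2_comp !substE -/(P _ _) -[pY - pX]opprB Weven_oppl pE2 [RHS]addrC addKr.
  by [].
pose h := P (pX - pY) pY + (P (pX - pY) pY - p).
have hsym : subst2 h pY pX = h.
  rewrite subst2D subst2B wsG [subst2 p pY pX]Weven_anti -pE opprK subrK addrC.
  by [].
have hsh : subst2 h pX (pX + pY) = - G - p.
  rewrite subst2D -wsG subst2_comp subst2_comp !substE.
  rewrite -/(P _ _) -/(P _ _) opprD addrA subrr sub0r Weven_oppl.
  rewrite [P pY (pX + pY)]Weven_anti; congr (_ + _).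
  by rewrite subst2_comp !substE [pX + pY]addrC addrK -/(P _ _) Weven_anti -pE.
have k2 : (2 < k)%N by lia.
have oE : Phi k (G - P (pX - pY) pY) = 0.
  apply: (Phi_odd_sym k2 k_even) => [|i j ei].
    by rewrite subst2B wG wsG opprB addrA subrK.
  rewrite -sG (linearB (coefXY i j)) /= coefXY_sign -signr_odd (negbTE ei) expr0 mul1r.
  exact: subrr.
have hE := Phi_rel_sym k2 hsym; rewrite hsh in hE.
rewrite sG; have := oE; have := hE; rewrite /h.
rewrite (linearD (Phi k) (P (pX - pY) pY)) (linearB (Phi k) (P (pX - pY) pY) p).
rewrite (linearB (Phi k) (- G) p) (linearN (Phi k) G) (linearB (Phi k) G) /=.
move: (Phi k G) (Phi k p) (Phi k _) => u w v {hE oE} hE /eqP; rewrite subr_eq0 => /eqP uv.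
move: hE; rewrite -uv addrA => /addIr /eqP; rewrite -addr_eq0 -mulr2n -mulrSr -scaler_nat.
by rewrite scaler_eq0 Num.Theory.pnatr_eq0 => /eqP.
Qed.
End Weven.

Section PeriodRelation.
Variable k : nat.
Hypothesis k_ge6 : (6 <= k)%N.
Hypothesis k_even : ~~ odd k.

(** The even part of p(X+Y,Y) has the coefficients C(k-2, r-1) q_{r,s} with r
    odd. *)
Lemma Weven_relation p : Weven k p ->
  \sum_(i < k.-1 | ~~ odd i) qcoef k p i.+1 (k - 1 - i) *: DtZ k i.+1 (k - 1 - i) = 0.
Proof.
move=> Wp; have [h1 h2] := Weven_even_part k_ge6 k_even Wp.
have := Phi_even_part k (subst2 p (pX + pY) pY); rewrite h1 h2 addr0.
move/esym/eqP; rewrite scaler_eq0 Num.Theory.pnatr_eq0 /= => /eqP e.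
rewrite -[RHS]e; apply: eq_bigr => i _; rewrite /qcoef -[_@_ _]/(coefXY _ _ _) !subn1 /=.
by have -> : (k.-1 - i).-1 = (k - 2 - i)%N by lia.
Qed.

Lemma Weven_XY : Weven k (pX ^+ (k - 2) - pY ^+ (k - 2)).
Proof.
split.
  have hX n (h : QXY) : h \is 1.-homog -> h ^+ n \is n.-homog.
    by move/(dhomogMn n); rewrite mul1n.
  by rewrite rpredB // hX ?pX_homog ?pY_homog.
rewrite !subst2B !subst2Xn !substE.
by rewrite opprB [RHS]addrC addrA subrK.
Qed.

Lemma qcoef_XY i : (i <= k - 2)%N ->
  qcoef k (pX ^+ (k - 2) - pY ^+ (k - 2)) i.+1 (k - 1 - i) = (i != 0%N)%:R.
Proof.
move=> le_i; rewrite /qcoef subst2B !subst2Xn !substE -[_@_ _]/(coefXY _ _ _) !subn1 /=.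
have -> : (k.-1 - i).-1 = (k - 2 - i)%N by lia.
have -> : pY ^+ (k - 2) = mono 0 (k - 2) by rewrite /mono expr0 mul1r.
have lt_i : (i < (k - 2).+1)%N by [].
rewrite linearB /= binom_mono linear_sum (bigD1 (Ordinal lt_i)) //= linearZ_LR /= coefXY_mono !eqxx.
rewrite big1 => [|j ne_j]; last first.
  rewrite linearZ_LR /= coefXY_mono (_ : (j == i :> nat) = false) ?mulr_rato ?mulr0 //.
  by apply: contraNF ne_j => /eqP e; apply/eqP/val_inj.
have c0 : 'C(k - 2, i)%:R != 0 :> rat by rewrite Num.Theory.pnatr_eq0 -lt0n bin_gt0.
rewrite addr0 mulr_rato mulr1 coefXY_mono; case: i lt_i c0 {le_i} => [|i] lt_i c0.
  by rewrite subn0 !eqxx /= bin0 subrr mul0r.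
by rewrite subr0 divff.
Qed.

(** The relation of the period polynomial X^(k-2) - Y^(k-2), for which
    q_{r,s} = 1 when r > 1. *)
Lemma sum_DtZ_odd :
  DtZ k (k - 1) 1 = - \sum_(j < nod k) DtZ k (od j) (k - od j).
Proof.
have := Weven_relation Weven_XY.
rewrite (@sum_even_od _ (fun i => qcoef k (pX ^+ (k - 2) - pY ^+ (k - 2)) i.+1 (k - 1 - i)
  *: DtZ k i.+1 (k - 1 - i))) // !qcoef_XY // scale0r add0r.
have k20 : (k - 2 != 0)%N by lia.
rewrite k20 scale1r.
have -> : (k - 2).+1 = (k - 1)%N by lia.
have -> : (k - 1 - (k - 2) = 1)%N by lia.
rewrite addrC => /eqP; rewrite addr_eq0 => /eqP ->; congr (- _).
apply: eq_bigr => j _.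
have j_k : (od j - 1 <= k - 2)%N by have := ltn_ord j; rewrite /od /nod; lia.
rewrite (qcoef_XY j_k).
have -> : (od j - 1).+1 = od j by rewrite /od /=; lia.
have -> : (k - 1 - (od j - 1) = k - od j)%N by rewrite /od /=; lia.
have -> : (od j - 1 != 0)%N = true by rewrite /od /=; lia.
by rewrite scale1r.
Qed.

(** The symbol Z_{1,k-1} is zero, and eliminating Z_{k-1,1} by [sum_DtZ_odd]
    subtracts q_{k-1,1} from each coefficient. *)
Lemma qrow_relation p : Weven k p ->
  \sum_(j < nod k) qrow k p 0 j *: DtZ k (od j) (k - od j) = 0.
Proof.
move=> Wp; have := Weven_relation Wp.
rewrite (@sum_even_od _ (fun i => qcoef k p i.+1 (k - 1 - i) *: DtZ k i.+1 (k - 1 - i))) //.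
rewrite subn0 DtZ1 scaler0 add0r.
have -> : (k - 2).+1 = (k - 1)%N by lia.
have -> : (k - 1 - (k - 2) = 1)%N by lia.
rewrite sum_DtZ_odd scalerN scaler_sumr -sumrB => e.
rewrite -[RHS](scaler0 _ 2%:R) -[in RHS]e scaler_sumr; apply: eq_bigr => j _.
have -> : (od j - 1).+1 = od j by rewrite /od /=; lia.
have -> : (k - 1 - (od j - 1) = k - od j)%N by rewrite /od /=; lia.
by rewrite mxE -scalerA scalerBl.
Qed.
End PeriodRelation.

(** * Bernoulli numbers *)

Lemma bernoulli_bin n : \sum_(j < n.+1) 'C(n, j)%:R * bernoulli j = bernoulli n + (n == 1)%N%:R.
Proof.
case: n => [|n]; first by rewrite big_ord1 bin0 mul1r addr0.
by rewrite big_ord_recr /= bernoulli_rec binn mul1r addrC eqSS.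
Qed.

Lemma bernoulli_unique (c : nat -> rat) :
  (forall n, \sum_(j < n.+1) 'C(n.+1, j)%:R * c j = (n == 0)%N%:R) -> c =1 bernoulli.
Proof.
move=> cE n; elim/ltn_ind: n => n IHn.
have := bernoulli_rec n; rewrite -cE !big_ord_recr /= => /esym.
under eq_bigr => j _ do rewrite IHn //.
move/addrI; apply: mulfI; rewrite Num.Theory.pnatr_eq0 -lt0n bin_gt0; lia.
Qed.

(** Binomial inversion shows that the sequence (-1)^n (B_n + [n = 1])
    satisfies the recursion that characterises the Bernoulli numbers. In
    particular B_n = 0 for odd n > 1. *)
Lemma bernoulli_sign n : (-1) ^+ n * bernoulli n = bernoulli n + (n == 1)%N%:R.
Proof.
suff E : (-1) ^+ n * (bernoulli n + (n == 1)%N%:R) = bernoulli n.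
  by rewrite -{1}E mulrA -expr2 sqrr_sign mul1r.
move: n; apply: (@bernoulli_unique (fun n => (-1) ^+ n * (bernoulli n + (n == 1)%N%:R))) => n.
have bin_inv : \sum_(j < n.+2) 'C(n.+1, j)%:R * ((-1) ^+ j * (bernoulli j + (j == 1 :> nat)%N%:R))
    = (-1) ^+ n.+1 * bernoulli n.+1.
  transitivity (\sum_(j < n.+2) \sum_(i < n.+2)
      ((-1) ^+ j * ('C(n.+1, j) * 'C(j, i))%:R) * bernoulli i).
    apply: eq_bigr => j _; rewrite -bernoulli_bin mulrA mulr_sumr.
    rewrite (big_ord_widen n.+2 (fun i => 'C(n.+1, j)%:R * (-1) ^+ j * ('C(j, i)%:R * bernoulli i))) //.
    rewrite big_mkcond; apply: eq_bigr => i _; case: ltnP => [_|j_i].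
      by rewrite natrM; ring.
    by rewrite ['C(j, i)]bin_small // muln0 mulr0 mul0r.
  rewrite exchange_big /=; under eq_bigr => i _ do rewrite -mulr_suml alt_bin.
  rewrite big_ord_recr /= eqxx mulr1 big1 ?add0r // => i _.
  by rewrite gtn_eqF ?mulr0 ?mul0r.
move: bin_inv; rewrite big_ord_recr /= binn mul1r mulrDr => /eqP.
rewrite addrA addrAC -subr_eq0 addrK addr_eq0 => /eqP ->.
by rewrite eqSS exprS; case: n => [|n] /=; rewrite ?mulr0 ?oppr0 // expr0 !mulr1 opprK.
Qed.

(** y^n B_n(x / y) for the Bernoulli polynomial B_n. The two basic identities
    B_n(t + 1) = B_n(t) + n t^(n-1) and, for even n, B_n(-t) = B_n(t) + n t^(n-1)
    become [bhom_shift] and [bhom_oppl]. *)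
Definition bhom (n : nat) (x y : QXY) : QXY :=
  \sum_(l < n.+1) ('C(n, l)%:R * bernoulli (n - l)) *: (x ^+ l * y ^+ (n - l)).

Lemma bhom_shift n x y : (0 < n)%N ->
  bhom n (x + y) y = bhom n x y + n%:R *: (x ^+ n.-1 * y).
Proof.
move=> n0; rewrite /bhom.
transitivity (\sum_(l < n.+1) \sum_(i < n.+1)
   ('C(n, i)%:R * ('C(n - i, n - l)%:R * bernoulli (n - l))) *: (x ^+ i * y ^+ (n - i))).
  apply: eq_bigr => l _; have le_l : (l <= n)%N by rewrite -ltnS.
  rewrite addrC exprDn mulr_suml scaler_sumr.
  rewrite (big_ord_widen n.+1 (fun i => ('C(n, l)%:R * bernoulli (n - l))
     *: (y ^+ (l - i) * x ^+ i *+ 'C(l, i) * y ^+ (n - l)))) //.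
  rewrite big_mkcond; apply: eq_bigr => i _; case: ltnP => [i_l|l_i]; last first.
    by rewrite ['C(n - i, _)]bin_small ?mul0r ?mulr0 ?scale0r //; have := ltn_ord i; lia.
  have {}i_l : (i <= l)%N by rewrite -ltnS.
  rewrite -scaler_nat -scalerAl scalerA; congr (_ *: _); last first.
    by rewrite mulrAC mulrC -exprD; congr (_ * _ ^+ _); lia.
  have := @bin_mul_bin n (l - i) i ltac:(lia); rewrite subnK // => e.
  have -> : 'C(n - i, n - l) = 'C(n - i, l - i).
    by rewrite -bin_sub; [congr 'C(_, _); lia|lia].
  have := congr1 (fun t => t%:R : rat) e; rewrite !natrM mulrA => <-; ring.
rewrite exchange_big /=.
have inner (i : 'I_n.+1) : \sum_(l < n.+1) 'C(n - i, n - l)%:R * bernoulli (n - l)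
    = bernoulli (n - i) + (n - i == 1)%N%:R.
  have le_i : (i <= n)%N by rewrite -ltnS.
  rewrite -bernoulli_bin (reindex_inj rev_ord_inj) /=.
  rewrite (big_ord_widen n.+1 (fun j => 'C(n - i, j)%:R * bernoulli j)); last by lia.
  rewrite [RHS]big_mkcond; apply: eq_bigr => l _; have le_l : (l <= n)%N by rewrite -ltnS.
  rewrite subSS subKn //; case: ltnP => // i_l.
  by rewrite bin_small ?mul0r.
under eq_bigr => i _ do rewrite -scaler_suml -mulr_sumr inner mulrDr scalerDl.
rewrite big_split /=; congr (_ + _).
have lt_n : (n.-1 < n.+1)%N by lia.
rewrite (bigD1 (Ordinal lt_n)) //= big1 ?addr0 => [|i ne_i].
  have -> : (n - n.-1 = 1)%N by lia.
  rewrite expr1 mulr1; congr (_%:R *: _).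
  by rewrite -{1}(prednK n0) binSn prednK.
rewrite (_ : (n - i == 1)%N = false) ?mulr0 ?scale0r //.
by apply: contraNF ne_i => /eqP e; apply/eqP/val_inj => /=; have := ltn_ord i; lia.
Qed.

Lemma bhom_oppl n x y : (0 < n)%N -> ~~ odd n ->
  bhom n (- x) y = bhom n x y + n%:R *: (x ^+ n.-1 * y).
Proof.
move=> n0 en; transitivity (bhom n x y + \sum_(l < n.+1)
    ('C(n, l)%:R * (n - l == 1)%N%:R) *: (x ^+ l * y ^+ (n - l))); last first.
  congr (_ + _); have lt_n : (n.-1 < n.+1)%N by lia.
  rewrite (bigD1 (Ordinal lt_n)) //= big1 ?addr0 => [|i ne_i].
    have -> : (n - n.-1 = 1)%N by lia.
    rewrite expr1 mulr1; congr (_%:R *: _).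
    by rewrite -{1}(prednK n0) binSn prednK.
  rewrite (_ : (n - i == 1)%N = false) ?mulr0 ?scale0r //.
  by apply: contraNF ne_i => /eqP e; apply/eqP/val_inj => /=; have := ltn_ord i; lia.
rewrite /bhom -big_split; apply: eq_bigr => l _ /=; have le_l : (l <= n)%N by rewrite -ltnS.
rewrite -scalerDl -mulrDr -bernoulli_sign.
have -> : (- x) ^+ l = ((-1) ^+ (n - l) : rat) *: x ^+ l.
  rewrite -signr_odd oddB // (negbTE en) addFb signr_odd.
  by rewrite -scaleN1r exprZn.
by rewrite -scalerAl scalerA; congr (_ *: _); ring.
Qed.

Lemma bhom_opp n x y : ~~ odd n -> bhom n (- x) (- y) = bhom n x y.
Proof.
move=> en; apply: eq_bigr => l _; have le_l : (l <= n)%N by rewrite -ltnS.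
congr (_ *: _); rewrite (exprNn x) (exprNn y) mulrACA -exprD subnKC //.
by rewrite -signr_odd (negbTE en) expr0 mul1r.
Qed.

Lemma subst2_bhom n x y f g : subst2 (bhom n x y) f g = bhom n (subst2 x f g) (subst2 y f g).
Proof.
rewrite /bhom subst2_sum; apply: eq_bigr => l _.
by rewrite subst2Z subst2M !subst2Xn.
Qed.

(** * The matrix of the H_{r,s} *)

Section OddIndex.
Variables (k r n : nat).
Hypothesis n_gt0 : (0 < n)%N.
Hypothesis n_even : ~~ odd n.
Hypothesis r_odd : odd r.
Hypothesis rnk : (r + n.+1 = k)%N.

Let h : QXY := bhom n pX pY * pY ^+ r.-1.
Let h1 : QXY := bhom n pX (pX + pY) * (pX + pY) ^+ r.-1.

Let r_even : ~~ odd r.-1. Proof. by rewrite -oddS prednK ?odd_gt0. Qed.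

Let even_oppX (x : QXY) : (- x) ^+ r.-1 = x ^+ r.-1.
Proof. by rewrite exprNn -signr_odd (negbTE r_even) expr0 mul1r. Qed.

Let Phi_diff : n%:R *: Phi k (mono r n.-1) = Phi k (h - h1).
Proof.
have k2 : (2 < k)%N by lia.
have := Phi_rel k2 h.
have -> : subst2 h pX (pX + pY) = h1.
  by rewrite subst2M subst2Xn subst2_bhom !substE.
have -> : subst2 h (pX + pY) pX = subst2 h pY pX + n%:R *: mono r n.-1.
  rewrite !subst2M !subst2Xn !subst2_bhom !substE [pX + pY]addrC bhom_shift // mulrDl.
  rewrite -scalerAl -mulrA -exprS prednK; last exact: odd_gt0.
  by rewrite [pY ^+ _ * _]mulrC.
rewrite (linearD (Phi k) h) (linearD (Phi k) h1) (linearD (Phi k) (subst2 h pY pX)).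
rewrite (linearB (Phi k) h) (linearZ_LR (Phi k)) /=.
move: (Phi k h) (Phi k h1) (Phi k (subst2 h pY pX)) (Phi k (mono r n.-1)) => a b c m e.
rewrite (_ : a = b + n%:R *: m); first by rewrite addrC addKr.
by apply: (addIr c); rewrite e addrAC addrA.
Qed.

Let Phi_sg : Phi k (subst2 (h - h1) (- pX) pY) = 0.
Proof.
have k2 : (2 < k)%N by lia.
pose f : QXY := bhom n pX (pX - pY) * (pX - pY) ^+ r.-1.
have fE : subst2 h1 (- pX) pY = f.
  rewrite subst2M subst2Xn subst2_bhom !substE -(bhom_opp _ _ n_even) -(even_oppX (_ + _)).
  by rewrite opprD opprK.
have fsym : subst2 f pY pX = f.
  rewrite subst2M subst2Xn subst2_bhom !substE -(bhom_opp _ _ n_even) -(even_oppX (_ - _)) opprB.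
  rewrite bhom_oppl // /f; congr (_ * _).
  by rewrite -bhom_shift // [pY + _]addrC subrK.
have := Phi_rel_sym k2 fsym.
have -> : subst2 f pX (pX + pY) = subst2 h (- pX) pY.
  rewrite !subst2M !subst2Xn !subst2_bhom !substE opprD addrA subrr sub0r even_oppX.
  by rewrite -(bhom_opp pX _ n_even) opprK.
rewrite subst2B fE (linearB (Phi k)) /=.
move: (Phi k _) (Phi k _) => a b ->; exact: subrr.
Qed.

Let coefXY_diff i : (i < k.-1)%N ->
  coefXY i (k - 2 - i) (h - h1) / 'C(k - 2, i)%:R = - (lambda' k r i.+1 / 'C(k - 2, r.-1)%:R).
Proof.
move=> lt_i; set d := (k - 2)%N.
have r0 : (0 < r)%N := odd_gt0 r_odd.
have hE : h = \sum_(l < n.+1) ('C(n, l)%:R * bernoulli (n - l)) *: mono l (d - l).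
  rewrite /h /bhom mulr_suml; apply: eq_bigr => l _; have le_l : (l <= n)%N by rewrite -ltnS.
  rewrite -scalerAl -mulrA -exprD; congr (_ *: (_ * _ ^+ _)); rewrite /d. lia.
have h1E : h1 = \sum_(l < n.+1) ('C(n, l)%:R * bernoulli (n - l)) *: (pX ^+ l * (pX + pY) ^+ (d - l)).
  rewrite /h1 /bhom mulr_suml; apply: eq_bigr => l _; have le_l : (l <= n)%N by rewrite -ltnS.
  rewrite -scalerAl -mulrA -exprD; congr (_ *: (_ * _ ^+ _)); rewrite /d. lia.
have cE : coefXY i (d - i) (h - h1)
    = - \sum_(l < k | (l < i)%N && (l <= n)%N) 'C(n, l)%:R * bernoulli (n - l) * 'C(d - l, i - l)%:R.
  rewrite hE h1E -sumrB linear_sum.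
  rewrite (big_ord_widen k (fun l => coefXY i (d - i) (('C(n, l)%:R * bernoulli (n - l)) *: mono l (d - l)
     - ('C(n, l)%:R * bernoulli (n - l)) *: (pX ^+ l * (pX + pY) ^+ (d - l))))) /=; last by lia.
  rewrite -sumrN big_mkcond [RHS]big_mkcond; apply: eq_bigr => l _.
  rewrite ltnS andbC; case: (leqP l n) => //= le_ln.
  rewrite linearB !linearZ_LR /= coefXY_mono coefXY_XmXYn ?mulr_rato; [|rewrite /d; lia|rewrite /d; lia].
  have [->|ne_li] := eqVneq (l : nat) i.
    by rewrite leqnn ltnn eqxx subnn bin0 subrr.
  rewrite /= mulr0 sub0r leq_eqVlt (negbTE ne_li) /=.
  by case: ifP => _; rewrite ?mulr0 ?oppr0.
have lE : lambda' k r i.+1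
    = \sum_(l < k | (l < i)%N && (l <= n)%N) 'C(d - l, r.-1)%:R * 'C(i, l)%:R * bernoulli (n - l).
  rewrite /lambda' big_mkord /=.
  rewrite (big_ord_widen k (fun l => 'C(k - 2 - l, r - 1)%:R * 'C(i.+1 - 1, l)%:R
    * bernoulliz (k%:Z - r%:Z - l%:Z - 1))); last by lia.
  rewrite big_mkcond [RHS]big_mkcond; apply: eq_bigr => l _; case: ltnP => //= _.
  have -> : (i.+1 - 1 = i)%N by lia.
  have -> : (r - 1 = r.-1)%N by lia.
  case: leqP => [le_ln|lt_nl].
    by have -> : (k%:Z - r%:Z - l%:Z - 1 = (n - l)%N%:Z) by lia.
  have [m ->] : exists m, (k%:Z - r%:Z - l%:Z - 1 = Negz m) by exists (l - n).-1; lia.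
  by rewrite mulr0.
rewrite cE lE mulNr !mulr_suml; congr (- _); apply: eq_bigr => l /andP[lt_li le_ln].
have ci0 : 'C(d, i)%:R != 0 :> rat by rewrite Num.Theory.pnatr_eq0 -lt0n bin_gt0 /d; lia.
have cr0 : 'C(d, r.-1)%:R != 0 :> rat by rewrite Num.Theory.pnatr_eq0 -lt0n bin_gt0 /d; lia.
have cl0 : 'C(d, l)%:R != 0 :> rat by rewrite Num.Theory.pnatr_eq0 -lt0n bin_gt0 /d; lia.
have e1 : 'C(d, i)%:R * 'C(i, l)%:R = 'C(d, l)%:R * 'C(d - l, i - l)%:R :> rat.
  have := @bin_mul_bin d (i - l) l ltac:(lia); rewrite subnK ?(ltnW lt_li) // => e.
  by rewrite -!natrM e.
have e2 : 'C(d, r.-1)%:R * 'C(n, l)%:R = 'C(d, l)%:R * 'C(d - l, r.-1)%:R :> rat.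
  have := @bin_mul_bin d (n - l) l ltac:(lia); rewrite subnK // => e.
  rewrite -!natrM; congr _%:R; rewrite -(@bin_sub d r.-1); last by lia.
  rewrite -(@bin_sub (d - l) r.-1); last by lia.
  have -> : (d - r.-1 = n)%N by lia.
  by have -> : (d - l - r.-1 = n - l)%N by lia.
have -> : 'C(n, l)%:R = 'C(d, l)%:R * 'C(d - l, r.-1)%:R / 'C(d, r.-1)%:R :> rat.
  by rewrite -e2 mulrAC mulfV // mul1r.
have -> : 'C(i, l)%:R = 'C(d, l)%:R * 'C(d - l, i - l)%:R / 'C(d, i)%:R :> rat.
  by rewrite -e1 mulrAC mulfV // mul1r.
by field; rewrite ci0 cr0.
Qed.

(** Let b be the homogenised Bernoulli polynomial of even degree n and h = b
    Y^(r-1). By [bhom_shift], h(X+Y,X) exceeds h(Y,X) by n X^r Y^(n-1), so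
    [Phi_rel] gives n Phi(X^r Y^(n-1)) = Phi(D) with D = h - h(X,X+Y). The form
    h(-X,Y-X) = b(X,X-Y) (X-Y)^(r-1) is symmetric by [bhom_shift] and
    [bhom_oppl], and [Phi_rel_sym] for it gives Phi(D(-X,Y)) = 0. So Phi(D) is
    twice the part of D with odd first index, the coefficients of which are given
    by [lambda']. *)
Lemma DtZ_even_odd :
  r%:R *: DtZ k r.+1 n = - 2%:R *: \sum_(i < k.-1 | ~~ odd i) lambda' k r i.+1 *: DtZ k i.+1 (k - 1 - i).
Proof.
have k2 : (2 < k)%N by lia.
have c0 : 'C(k - 2, r.-1)%:R != 0 :> rat by rewrite Num.Theory.pnatr_eq0 -lt0n bin_gt0; lia.
have c1 : 'C(k - 2, r)%:R != 0 :> rat by rewrite Num.Theory.pnatr_eq0 -lt0n bin_gt0; lia.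
have := Phi_even_part k (h - h1); rewrite Phi_sg addr0 -Phi_diff Phi_mono; last by lia.
rewrite (prednK n_gt0); move: (DtZ k r.+1 n) => Z e.
have -> : r%:R *: Z = 'C(k - 2, r.-1)%:R *: (n%:R *: ('C(k - 2, r)%:R^-1 *: Z)).
  rewrite !scalerA; congr (_ *: Z); apply: (canRL (mulfK c1)); rewrite -!natrM; congr _%:R.
  have := mul_bin_left (k - 2) r.-1; rewrite prednK ?odd_gt0 //.
  have -> : (k - 2 - r.-1 = n)%N by lia.
  by move=> ->; rewrite mulnC.
rewrite e scaler_sumr [RHS]scaler_sumr scaler_sumr; apply: eq_bigr => i _.
rewrite (coefXY_diff (ltn_ord i)); move: (DtZ k _ _) => z; rewrite !scalerA; congr (_ *: z).
by field.
Qed.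
End OddIndex.

Lemma scale2_sumB (R : pzRingType) (V : lmodType R) (I : finType) (P : pred I) (a b c : R)
    (f g : I -> R) (z : I -> V) :
  a *: (c *: \sum_(i | P i) f i *: z i) - b *: (c *: \sum_(i | P i) g i *: z i)
  = \sum_(i | P i) (a * (c * f i) - b * (c * g i)) *: z i.
Proof.
rewrite !scaler_sumr -sumrB; apply: eq_bigr => i _.
by rewrite !scalerA scalerBl !mulrA.
Qed.

Section MatrixRelation.
Variable k : nat.
Hypothesis k_ge6 : (6 <= k)%N.
Hypothesis k_even : ~~ odd k.

(** Elimination of Z_{1,k-1} = 0 and of Z_{k-1,1}. *)
Lemma sum_DtZ_even (F : nat -> rat) :
  \sum_(i < k.-1 | ~~ odd i) F i.+1 *: DtZ k i.+1 (k - 1 - i)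
  = \sum_(j < nod k) (F (od j) - F (k - 1)%N) *: DtZ k (od j) (k - od j).
Proof.
rewrite (@sum_even_od _ (fun i => F i.+1 *: DtZ k i.+1 (k - 1 - i))) //.
rewrite subn0 DtZ1 scaler0 add0r.
have -> : (k - 2).+1 = (k - 1)%N by lia.
have -> : (k - 1 - (k - 2) = 1)%N by lia.
rewrite sum_DtZ_odd // scalerN scaler_sumr -sumrB; apply: eq_bigr => j _.
have -> : (od j - 1).+1 = od j by rewrite /od /=; lia.
have -> : (k - 1 - (od j - 1) = k - od j)%N by rewrite /od /=; lia.
by rewrite scalerBl.
Qed.

(** The two symbols with even indices in H_{r,s} are replaced by means of
    [DtZ_even_odd]. The P_{l,k-l} contribute to a given Z_{m,k-m} for l = m and
    for l = k - m, whence the four binomial coefficients in [Mcoef]. *)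
Lemma Hdz_Amx (i : 'I_(nod k)) :
  2%:R *: Hdz k (od i) (k - od i) = \sum_(j < nod k) Amx k i j *: DtZ k (od j) (k - od j).
Proof.
have := od_bounds i; set r := od i; set s := (k - r)%N => /andP[/andP[r3 r_k] r_odd].
have two0 : 2%:R != 0 :> rat by rewrite Num.Theory.pnatr_eq0.
pose F m := 2%:R * ((r%:R + 1) / r%:R * lambda' k r m - (s%:R + 1) / s%:R * lambda' k s m).
have r0 : r%:R != 0 :> rat by rewrite Num.Theory.pnatr_eq0; lia.
have s0 : s%:R != 0 :> rat by rewrite Num.Theory.pnatr_eq0 /s; lia.
have FE : (s%:R + 1) *: DtZ k (s + 1) (r - 1) - (r%:R + 1) *: DtZ k (r + 1) (s - 1)
    = \sum_(j < nod k) (F (od j) - F (k - 1)%N) *: DtZ k (od j) (k - od j).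
  rewrite -sum_DtZ_even /F !addn1.
  have n1 : (0 < s - 1)%N by rewrite /s; lia.
  have n2 : ~~ odd (s - 1) by rewrite /s; move: r_odd k_even; lia.
  have n3 : (r + (s - 1).+1 = k)%N by rewrite /s; lia.
  have e1 := DtZ_even_odd n1 n2 r_odd n3.
  have m1 : (0 < r - 1)%N by lia.
  have m2 : ~~ odd (r - 1) by move: r_odd; lia.
  have s_odd : odd s by rewrite /s; move: r_odd k_even; lia.
  have m3 : (s + (r - 1).+1 = k)%N by rewrite /s; lia.
  have e2 := DtZ_even_odd m1 m2 s_odd m3.
  have -> : (r%:R + 1) *: DtZ k r.+1 (s - 1) = ((r%:R + 1) / r%:R) *: (r%:R *: DtZ k r.+1 (s - 1)).
    by move: (DtZ k _ _) => z; rewrite scalerA divfK.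
  have -> : (s%:R + 1) *: DtZ k s.+1 (r - 1) = ((s%:R + 1) / s%:R) *: (s%:R *: DtZ k s.+1 (r - 1)).
    by move: (DtZ k _ _) => z; rewrite scalerA divfK.
  rewrite e1 e2 scale2_sumB; apply: eq_bigr => m _.
  move: (DtZ k _ _) => z; congr (_ *: z).
  by ring.
pose G m : rat := 'C(k - m, s)%:R - 'C(k - m, r)%:R + 'C(m, s)%:R - 'C(m, r)%:R.
have GE : \sum_(3 <= l < k - 2 | odd l) ('C(k - l, s)%:R - 'C(k - l, r)%:R) *: DtP k l (k - l)
    = \sum_(j < nod k) G (od j) *: DtZ k (od j) (k - od j).
  rewrite sum_odd_od //.
  transitivity (\sum_(j < nod k) ('C(k - od j, s)%:R - 'C(k - od j, r)%:R) *: DtZ k (od j) (k - od j)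
     + \sum_(j < nod k) ('C(k - od j, s)%:R - 'C(k - od j, r)%:R) *: DtZ k (k - od j) (od j)).
    rewrite -big_split; apply: eq_bigr => j _ /=; have := od_bounds j => /andP[/andP[j3 j_k] _].
    by rewrite DtP_stuffle ?scalerDr //; lia.
  rewrite [X in _ + X](reindex_inj rev_ord_inj) -big_split; apply: eq_bigr => j _ /=.
  have := od_bounds j => /andP[/andP[j3 j_k] _]; rewrite od_rev // subKn; last by lia.
  move: (DtZ k _ _) => z; rewrite -scalerDl; congr (_ *: z).
  by rewrite /G; ring.
rewrite /Hdz scalerA mulfV // scale1r -/s GE -[X in X + _]addrA FE.
pose a : rat := r%:R * s%:R - r%:R + 1; pose b : rat := r%:R * s%:R + s%:R - 1.
have E1 : a *: DtZ k r s = \sum_(j < nod k) (a * (od j == r)%:R) *: DtZ k (od j) (k - od j).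
  rewrite (bigD1 i) //= eqxx mulr1 big1 ?addr0 // => j ne_j.
  by rewrite od_eq (negbTE ne_j) mulr0 scale0r.
have E2 : b *: DtZ k s r = \sum_(j < nod k) (b * (od j == s)%:R) *: DtZ k (od j) (k - od j).
  rewrite (bigD1 (rev_ord i)) //= od_rev // -/r -/s eqxx mulr1 big1 ?addr0 => [|j ne_j].
    by rewrite /s subKn //; lia.
  by rewrite -[s in (od j == s)](od_rev i k_even) od_eq (negbTE ne_j) mulr0 scale0r.
rewrite -/a -/b E1 E2 -!big_split; apply: eq_bigr => j _ /=.
have := od_bounds j => /andP[/andP[j3 j_k] _].
move: (DtZ k _ _) => z; rewrite -!scalerDl; congr (_ *: z).
rewrite !mxE /Mcoef -/r -/s j3 j_k.
have -> : (3 <= k - 1 <= k - 3)%N = false by lia.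
have -> : (k - 1 == r)%N = false by lia.
have -> : (k - 1 == s)%N = false by rewrite /s; lia.
by rewrite /F /G /a /b /=; ring.
Qed.
End MatrixRelation.

(** * Relations among the H_{r,s} *)

Lemma sum_mulmx (R : comPzRingType) (V : lmodType R) n (a : R) (A : 'M[R]_n) (H Z : 'I_n -> V) :
  (forall i, a *: H i = \sum_j A i j *: Z j) ->
  forall c : 'rV[R]_n, a *: \sum_i c 0 i *: H i = \sum_j (c *m A) 0 j *: Z j.
Proof.
move=> HZ c; transitivity (\sum_i c 0 i *: \sum_j A i j *: Z j).
  by rewrite scaler_sumr; apply: eq_bigr => i _; rewrite -HZ !scalerA mulrC.
under eq_bigr => i _ do rewrite scaler_sumr.
rewrite exchange_big; apply: eq_bigr => j _; rewrite mxE scaler_suml.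
by apply: eq_bigr => i _; rewrite scalerA.
Qed.

Lemma scale_sum_eq0 (V : lmodType rat) n (f g : 'I_n -> rat) (a : rat) (z : 'I_n -> V) :
  (forall j, f j = a * g j) -> \sum_j g j *: z j = 0 -> \sum_j f j *: z j = 0.
Proof.
move=> fg e; transitivity (a *: \sum_j g j *: z j); last by rewrite e scaler0.
by rewrite scaler_sumr; apply: eq_bigr => j _; rewrite fg scalerA.
Qed.

Section Relations.
Variable k : nat.
Hypothesis k_ge6 : (6 <= k)%N.
Hypothesis k_even : ~~ odd k.

Lemma sum_Hdz (c : 'rV[rat]_(nod k)) :
  2%:R *: \sum_(i < nod k) c 0 i *: Hdz k (od i) (k - od i)
  = \sum_(j < nod k) (c *m Amx k) 0 j *: DtZ k (od j) (k - od j).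
Proof.
exact: (sum_mulmx (H := fun i => Hdz k (od i) (k - od i))
  (Z := fun j => DtZ k (od j) (k - od j)) (Hdz_Amx k_ge6 k_even)).
Qed.

Lemma sum_Hdz_eq0 (c : 'rV[rat]_(nod k)) :
  \sum_(i < nod k) c 0 i *: Hdz k (od i) (k - od i) = 0
  <-> \sum_(j < nod k) (c *m Amx k) 0 j *: DtZ k (od j) (k - od j) = 0.
Proof.
have iff2 (V : lmodType rat) (u v : V) : 2%:R *: u = v -> u = 0 <-> v = 0.
  move=> <-; split=> [->|/eqP]; first exact: scaler0.
  by rewrite scaler_eq0 Num.Theory.pnatr_eq0 => /eqP.
exact: (iff2 _ _ _ (sum_Hdz c)).
Qed.

(** The coefficients of the Z_{r,s} are det(A) times [qrow], which is a
    relation. *)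
Lemma chat_Hdz p : Weven k p ->
  \sum_(i < nod k) (\row_i chat p i) 0 i *: Hdz k (od i) (k - od i) = 0.
Proof.
move=> Wp; apply/sum_Hdz_eq0.
apply: (scale_sum_eq0 (a := \det (Amx k)) (g := fun j => qrow k p 0 j)); last first.
  exact: qrow_relation.
by move=> j; rewrite chat_mulA mxE.
Qed.
End Relations.

(** * All relations come from period polynomials *)

Section Converse.
Variable k : nat.
Hypothesis k_ge6 : (6 <= k)%N.
Hypothesis k_even : ~~ odd k.

(** The forms killed by [Phi] for one of the evident reasons, which are
    [Phi_rel_sym], [Phi_odd_sym] and Z_{1,k-1} = 0. *)
Definition null_form (f : QXY) : Prop := exists h o (b : rat),
  [/\ h \is (k - 2).-homog, subst2 h pY pX = h,
      o \is (k - 2).-homog /\ subst2 o pY pX = o,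
      forall i j, ~~ odd i -> coefXY i j o = 0
    & f = h - subst2 h pX (pX + pY) + o + b *: pY ^+ (k - 2)].

Lemma null_form_closed a f g : null_form f -> null_form g -> null_form (a *: f + g).
Proof.
move=> [h [o [b [hh hs [ho os] oo ->]]]] [h' [o' [b' [hh' hs' [ho' os'] oo' ->]]]].
exists (a *: h + h'), (a *: o + o'), (a * b + b'); split.
- by rewrite rpredD ?rpredZ.
- by rewrite subst2D subst2Z hs hs'.
- by rewrite rpredD ?rpredZ // subst2D subst2Z os os'.
- by move=> i j ei; rewrite (linearD (coefXY i j)) (linearZ_LR (coefXY i j)) /= oo // oo' // scaler0 addr0.
rewrite subst2D subst2Z !scalerDr scalerN scalerA scalerDl opprD.
move: (a *: h) (a *: subst2 h _ _) (a *: o) ((a * b) *: _) (b' *: _) => x1 x2 x3 x4 x5.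
ring.
Qed.

Lemma null_form0 : null_form 0.
Proof.
exists 0, 0, 0; split; rewrite ?rpred0 //; rewrite ?scale0r ?addr0 ?subst20 ?subrr //.
- exact: (linear0 (comp_mpoly _)).
- by split=> //; exact: (linear0 (comp_mpoly _)).
- by move=> i j _; exact: linear0.
have -> : subst2 0 pX (pX + pY) = 0 by exact: (linear0 (comp_mpoly _)).
by rewrite subrr.
Qed.

Lemma spanp_null_form f : f \in spanp null_form -> null_form f.
Proof.
move=> /spanpP[s sK ->]; rewrite big_seq; elim/big_ind: _ => [|x y zx zy|t /sK zt].
- exact: null_form0.
- by rewrite -[x]scale1r; exact: null_form_closed.
by rewrite -[_ *: _]addr0; apply: null_form_closed null_form0.
Qed.

Let bswap r s : (r + s = k)%N -> (0 < r)%N -> (0 < s)%N ->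
  zmono k r = 'C(k - 2, r.-1)%:R *: mono r.-1 s.-1
  /\ zmono k s = 'C(k - 2, r.-1)%:R *: mono s.-1 r.-1.
Proof.
move=> rs r0 s0; have e : 'C(k - 2, s.-1) = 'C(k - 2, r.-1).
  by rewrite -(@bin_sub (k - 2) r.-1); [congr 'C(_, _); lia|lia].
rewrite /zmono e; have -> : (k - r = s)%N by lia.
by have -> : (k - s = r)%N by lia.
Qed.

Let msum_homog r s : (r + s = k)%N -> (0 < r)%N -> (0 < s)%N -> forall a : rat,
  a *: (mono r.-1 s.-1 + mono s.-1 r.-1) \is (k - 2).-homog.
Proof.
move=> rs r0 s0 a; have e1 : (r.-1 + s.-1 = k - 2)%N by lia.
by rewrite rpredZ // rpredD // -e1 ?mono_homog // addnC mono_homog.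
Qed.

Let msum_swap i j (a : rat) : subst2 (a *: (mono i j + mono j i)) pY pX = a *: (mono i j + mono j i).
Proof.
rewrite subst2Z subst2D !subst2_mono [mono i j]mulrC [mono j i]mulrC addrC; congr (_ *: _).
Qed.

(** Modulo null forms, the [zmono k r] satisfy all the defining relations of
    the Z_{r,k-r}, so there is a linear map sending the latter to the former. It
    turns a relation among the Z_{r,k-r} into the statement that the corresponding
    form is null. *)
Lemma DtZ_relation (u : 'I_(nod k) -> rat) :
  \sum_j u j *: DtZ k (od j) (k - od j) = 0 ->
  null_form (\sum_j u j *: ('C(k - 2, od j - 1)%:R *: mono (od j - 1) (k - 2 - (od j - 1)))).
Proof.
pose zv c : lquot null_form := lproj null_form (zmono k c).
pose pv c : lquot null_form := zv c + zv (k - c)%N.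
have inK f : null_form f -> lproj null_form f = 0.
  by move=> zf; apply/lproj_eq0/spanpP; exists [:: (1, f)]; [move=> t; rewrite inE => /eqP ->|rewrite big_seq1 scale1r].
have pv_st r s : (0 < r)%N -> (0 < s)%N -> (r + s = k)%N -> pv r = zv r + zv s.
  by move=> _ _ rs; rewrite /pv (_ : (k - r = s)%N) //; lia.
have pv_sh r s : (0 < r)%N -> (0 < s)%N -> (r + s = k)%N ->
    pv r = \sum_(1 <= a < k) ('C(a - 1, r - 1) + 'C(a - 1, s - 1))%:R *: zv a.
  move=> r0 s0 rs; rewrite (pv_st r s) //; have [br bs] := bswap rs r0 s0.
  pose h := 'C(k - 2, r.-1)%:R *: (mono r.-1 s.-1 + mono s.-1 r.-1) : QXY.
  have hb : h = zmono k r + zmono k s by rewrite br bs -scalerDr.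
  have hs : subst2 h pX (pX + pY) = \sum_(1 <= a < k) ('C(a - 1, r - 1) + 'C(a - 1, s - 1))%:R *: zmono k a.
    rewrite /h subst2Z subst2D !subst2_mono scalerDr.
    rewrite XmXYn_zmono; last by lia.
    have -> : 'C(k - 2, r.-1) = 'C(k - 2, s.-1).
      by rewrite -(@bin_sub (k - 2) r.-1); [congr 'C(_, _); lia|lia].
    rewrite XmXYn_zmono; last by lia.
    by rewrite -big_split; apply: eq_bigr => a _ /=; rewrite !subn1 natrD scalerDl.
  have z : null_form (h - subst2 h pX (pX + pY)).
    exists h, 0, 0; split.
    - exact: msum_homog.
    - exact: msum_swap.
    - by split; [exact: rpred0|exact: (linear0 (comp_mpoly _))].
    - by move=> i j _; exact: linear0.
    by rewrite scale0r !addr0.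
  have := inK _ z; rewrite hs hb (linearB (lproj null_form)) (linearD (lproj null_form)) => /eqP.
  rewrite subr_eq0 => /eqP ->; rewrite (linear_sum (lproj null_form)).
  by apply: eq_bigr => a _; rewrite (linearZ_LR (lproj null_form)).
have pv_ev r s : (0 < r)%N -> (0 < s)%N -> (r + s = k)%N -> ~~ odd r -> ~~ odd s -> pv r = 0.
  move=> r0 s0 rs er es; rewrite (pv_st r s) //; have [br bs] := bswap rs r0 s0.
  rewrite /zv -(linearD (lproj null_form)) br bs -scalerDr; apply: inK.
  exists 0, ('C(k - 2, r.-1)%:R *: (mono r.-1 s.-1 + mono s.-1 r.-1)), 0; split.
  - exact: rpred0.
  - exact: (linear0 (comp_mpoly _)).
  - by split; [exact: msum_homog|exact: msum_swap].
  - move=> i j ei; rewrite (linearZ_LR (coefXY i j)) (linearD (coefXY i j)) /= !coefXY_mono.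
    have -> : (r.-1 == i) = false by apply/eqP; move: er ei; lia.
    have -> : (s.-1 == i) = false by apply/eqP; move: es ei; lia.
    by rewrite addr0 scaler0.
  have -> : subst2 0 pX (pX + pY) = 0 by exact: (linear0 (comp_mpoly _)).
  by rewrite subrr add0r scale0r addr0.
have zv1 : zv 1%N = 0.
  apply: inK; exists 0, 0, 1; split.
  - exact: rpred0.
  - exact: (linear0 (comp_mpoly _)).
  - by split; [exact: rpred0|exact: (linear0 (comp_mpoly _))].
  - by move=> i j _; exact: linear0.
  have -> : subst2 0 pX (pX + pY) = 0 by exact: (linear0 (comp_mpoly _)).
  rewrite subrr !add0r /zmono /= bin0; congr (_ *: _); rewrite /mono expr0 mul1r.
  by congr (_ ^+ _); lia.
have k1 : (1 < k)%N by lia.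
have [g [gZ _]] := Dtilde_lift pv_st pv_sh pv_ev k1 zv1.
move/(congr1 g); rewrite linear0 (linear_sum g) => e.
apply: spanp_null_form; apply/lproj_eq0; rewrite -[RHS]e (linear_sum (lproj null_form)).
apply: eq_bigr => j _; have := od_bounds j => /andP[/andP[j3 j_k] _].
rewrite (linearZ_LR (lproj null_form)) (linearZ_LR g) gZ; [|lia|lia|lia].
rewrite /zv /zmono !subn1; congr (_ *: lproj null_form (_ *: mono _ _)).
by lia.
Qed.

Let sg (q : QXY) := subst2 q (- pX) pY.

(** Setting X = 0 shows that e = h - h(X,X+Y) + o, the term with Y^(k-2) being
    absent. Hence p = h(X+Y,Y) - h(X+Y,X). As p is even in X and in Y,
    p(X+Y,Y) = h(X,-Y) - h(X,X+Y), and exchanging the variables here and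
    subtracting gives back p, because h(X,-Y) is symmetric. Since h(X,-Y) and h
    have the same even part and o has none, the even part of p(X+Y,Y) is e. *)
Lemma null_form_even_Weven e :
  null_form e -> coefXY 0 (k - 2) e = 0 -> sg e = e ->
  let p := e - subst2 e pY pX in
  Weven k p /\ forall i j, ~~ odd i -> coefXY i j (subst2 p (pX + pY) pY) = coefXY i j e.
Proof.
move=> [h [o [b [hh hs [ho os] oo eE]]]] e0 se.
have k2even : ~~ odd (k - 2) by move: k_even; lia.
pose H f g := subst2 h f g.
have Hsym f g : H g f = H f g by rewrite /H -{1}hs subst2_comp !substE.
have Hopp f g : H (- f) (- g) = H f g.
  by rewrite /H (subst2_opp _ _ hh) -signr_odd (negbTE k2even) expr0 scale1r.
have {b eE} eE : e = h - H pX (pX + pY) + o.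
  suff b0 : b = 0 by rewrite eE b0 scale0r addr0.
  have : coefXY 0 (k - 2) (H pX (pX + pY)) = coefXY 0 (k - 2) h.
    rewrite -coefXY_X0 -[RHS]coefXY_X0 /H subst2_comp !substE add0r.
    by [].
  move=> S0; move: e0; rewrite eE !(linearD (coefXY 0 (k - 2))) (linearN (coefXY 0 (k - 2))) /= -/(H _ _) S0 subrr add0r.
  rewrite (oo 0%N) // add0r (linearZ_LR (coefXY 0 (k - 2))) /=.
  have -> : pY ^+ (k - 2) = mono 0 (k - 2) by rewrite /mono expr0 mul1r.
  by rewrite coefXY_mono !eqxx mulr_rato mulr1.
have pE : e - subst2 e pY pX = H (pX + pY) pY - H (pX + pY) pX.
  rewrite {2}eE subst2D subst2B os hs -/(H _ _) eE.
  have -> : subst2 (H pX (pX + pY)) pY pX = H (pX + pY) pY.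
    by rewrite /H subst2_comp !substE -/(H _ _) Hsym [pY + pX]addrC.
  rewrite [H (pX + pY) pX]Hsym; move: (H _ _) (H _ _) => x y.
  ring.
have he : e \is (k - 2).-homog.
  by rewrite eE rpredD // rpredB // /H subst2_homog ?rpredD ?pX_homog ?pY_homog.
move=> p; pose P f g := subst2 p f g.
have hp : p \is (k - 2).-homog by rewrite rpredB // subst2_homog ?pX_homog ?pY_homog.
have PE f g : P f g = H (f + g) g - H (f + g) f.
  by rewrite /P /p pE /H subst2B !subst2_comp !substE.
have sp : P pX (- pY) = p.
  have -> : P pX (- pY) = P (- pX) pY.
    rewrite /P -[X in subst2 p X (- pY)]opprK (subst2_opp _ _ hp).
    by rewrite -signr_odd (negbTE k2even) expr0 scale1r.
  have sw : subst2 (subst2 e pY pX) (- pX) pY = subst2 (sg e) pY pX.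
    rewrite !subst2_comp !substE.
    by rewrite -[pY in LHS]opprK (subst2_opp _ _ he) -signr_odd (negbTE k2even) expr0 scale1r.
  by rewrite /P /p subst2B sw -/(sg e) se.
have PN f g : P f (- g) = P f g.
  by have := congr1 (fun q => subst2 q f g) sp; rewrite /P subst2_comp !substE.
have shift f g : P (f + g) g = H f (- g) - H f (f + g).
  by rewrite -PN PE addrK.
have swp : P (pX + pY) pX = H pX (- pY) - H pY (pX + pY).
  rewrite [pX + pY]addrC shift -[H pY (- pX)]Hopp Hsym opprK.
  by rewrite addrC.
split.
  split.
  - exact: hp.
  rewrite -/(P _ _) -/(P _ _) shift swp /p pE.
  rewrite [H (pX + pY) pX]Hsym [H (pX + pY) pY]Hsym.
  move: (H _ _) (H _ _) (H _ _) => x y z; ring.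
move=> i j ei; rewrite -/(P _ _) shift.
have cfs q : coefXY i j (sg q) = coefXY i j q by rewrite coefXY_sign -signr_odd (negbTE ei) expr0 mul1r.
have sH : H pX (- pY) = sg h.
  by rewrite -[H pX _]Hopp opprK.
rewrite sH (linearB (coefXY i j)) /= cfs eE (linearD (coefXY i j)) (linearB (coefXY i j)) /= oo // addr0.
by [].
Qed.

(** The polynomial is e - e(Y,X) for the form e = sum_r u_r C(k-2, r-1)
    X^(r-1) Y^(s-1); since e contains no X^(k-2), the coefficient q_{k-1,1} is
    zero. *)
Lemma relation_qrow (u : 'rV[rat]_(nod k)) :
  \sum_j u 0 j *: DtZ k (od j) (k - od j) = 0 ->
  exists2 p : QXY, Weven k p & qrow k p = 2%:R *: u.
Proof.
move=> /DtZ_relation; set e := (\sum_j _) => ze.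
have cfe i j : coefXY i j e = \sum_(l < nod k) u 0 l * ('C(k - 2, od l - 1)%:R
    * ((od l - 1 == i)%N && (k - 2 - (od l - 1) == j)%N)%:R).
  rewrite /e linear_sum; apply: eq_bigr => l _.
  by rewrite !linearZ_LR /= coefXY_mono.
have cfe0 j : coefXY 0 j e = 0.
  rewrite cfe big1 // => l _; rewrite (_ : (od l - 1 == 0)%N = false) ?mulr0 //.
have cfe2 : coefXY (k - 2) 0 e = 0.
  rewrite cfe big1 // => l _; have := od_bounds l.
  by rewrite (_ : (od l - 1 == k - 2)%N = false) ?mulr0 //; have := ltn_ord l; rewrite /od /nod; lia.
have cfej (l : 'I_(nod k)) : coefXY (od l - 1) (k - 2 - (od l - 1)) e = u 0 l * 'C(k - 2, od l - 1)%:R.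
  rewrite cfe (bigD1 l) //= !eqxx mulr1 big1 ?addr0 // => j ne_j.
  rewrite (_ : (od j - 1 == od l - 1)%N = false) ?mulr0 //.
  by apply: contraNF ne_j => /eqP; rewrite -(od_eq j l) /od => ejl; apply/eqP; lia.
have se : subst2 e (- pX) pY = e.
  apply: QXYP => i j; rewrite coefXY_sign -signr_odd.
  have [oi|ei] := boolP (odd i); last by rewrite expr0 mul1r.
  rewrite cfe big1 ?mulr0 // => l _; rewrite (_ : (od l - 1 == i)%N = false) ?mulr0 //.
  by apply/eqP => li; move: oi; rewrite -li /od /=; lia.
have [Wp qE] := null_form_even_Weven ze (cfe0 _) se.
exists (e - subst2 e pY pX) => //; apply/rowP => j; rewrite !mxE; congr (_ * _).
have := od_bounds j => /andP[/andP[j3 j_k] j_odd].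
rewrite /qcoef -!/(coefXY _ _ _) qE; last by move: j_odd; lia.
rewrite qE; last by move: k_even; lia.
have -> : (k - od j - 1 = k - 2 - (od j - 1))%N by lia.
have -> : (k - 1 - 1 = k - 2)%N by lia.
rewrite cfej subnn cfe2 mul0r subr0 mulfK // Num.Theory.pnatr_eq0 -lt0n bin_gt0; lia.
Qed.

(** For u = c A and p as in [relation_qrow] the row of the determinants is 2 u
    adj(A) = 2 det(A) c. *)
Lemma chat_spans (c : 'rV[rat]_(nod k)) : \det (Amx k) != 0 ->
  \sum_(i < nod k) c 0 i *: Hdz k (od i) (k - od i) = 0 ->
  exists2 p, Weven k p & c = (2%:R * \det (Amx k))^-1 *: \row_i chat p i.
Proof.
move=> d0 /(sum_Hdz_eq0 k_ge6 k_even) /relation_qrow [p Wp qE]; exists p => //.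
have two0 : 2%:R != 0 :> rat by rewrite Num.Theory.pnatr_eq0.
have -> : \row_i chat p i = (2%:R * \det (Amx k)) *: c.
  apply/rowP => i; rewrite mxE chat_adj qE -scalemxAl -mulmxA mul_mx_adj mul_mx_scalar scalerA.
  by [].
by rewrite scalerA mulVf ?mulf_neq0 // scale1r.
Qed.

Lemma coefXY_shift_qcoef p i : (i <= k - 2)%N ->
  coefXY i (k - 2 - i) (subst2 p (pX + pY) pY) = qcoef k p i.+1 (k - 1 - i) * 'C(k - 2, i)%:R.
Proof.
move=> le_i; rewrite /qcoef -/(coefXY _ _ _) !subn1 /= divfK; last first.
  by rewrite Num.Theory.pnatr_eq0 -lt0n bin_gt0.
by have -> : (k.-1 - i).-1 = (k - 2 - i)%N by lia.
Qed.

(** The hypothesis makes F = p(X+Y,Y) odd in X, since its coefficient at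
    Y^(k-2) is p(Y,Y) = 0. Then p = F - F(Y,X) is odd in X too, but an even period
    polynomial is even in X. *)
Lemma Weven_eq0 p : Weven k p ->
  (forall i, ~~ odd i -> (0 < i <= k - 2)%N -> coefXY i (k - 2 - i) (subst2 p (pX + pY) pY) = 0) ->
  p = 0.
Proof.
move=> Wp q0; pose F := subst2 p (pX + pY) pY.
have F0 : coefXY 0 (k - 2) F = 0.
  rewrite -coefXY_X0 /F subst2_comp !substE add0r.
  have : subst2 p pY pY = - subst2 p pY pY by exact: (Weven_anti Wp).
  move/eqP; rewrite -addr_eq0 -mulr2n -scaler_nat scaler_eq0 Num.Theory.pnatr_eq0 /= => /eqP ->.
  exact: linear0.
have sF : subst2 F (- pX) pY = - F.
  have hF : F \is (k - 2).-homog.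
    have [hp _] := Wp; apply: subst2_homog hp; last exact: pY_homog.
    by rewrite rpredD ?pX_homog ?pY_homog.
  apply: QXYP => i j; rewrite coefXY_sign (linearN (coefXY i j)) /= -signr_odd.
  have [oi|ei] := boolP (odd i); first by rewrite expr1 mulN1r.
  rewrite expr0 mul1r; suff -> : coefXY i j F = 0 by rewrite oppr0.
  have [ij|ij] := eqVneq (i + j)%N (k - 2)%N; last exact: coefXY_out hF ij.
  have -> : j = (k - 2 - i)%N by lia.
  case: i ei ij => [|i] ei ij; first by rewrite subn0.
  by apply: q0 => //; lia.
have pE : p = F - subst2 F pY pX.
  have := Weven_lewis Wp pX pY; rewrite subst2_id => {1}->.
  by rewrite /F subst2_comp !substE [pY + pX]addrC.
have sp : subst2 p (- pX) pY = p by rewrite (Weven_oppl k_ge6 k_even Wp) subst2_id.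
have sw : subst2 (subst2 F pY pX) (- pX) pY = subst2 (subst2 F (- pX) pY) pY pX.
  rewrite !subst2_comp !substE (Weven_oppr k_ge6 k_even Wp) -(Weven_oppl k_ge6 k_even Wp).
  by rewrite opprD opprK.
have : p = - p.
  rewrite -{1}sp {1}pE subst2B sw sF subst2N opprK addrC -opprB -pE.
  by [].
by move/eqP; rewrite -addr_eq0 -mulr2n -scaler_nat scaler_eq0 Num.Theory.pnatr_eq0 /= => /eqP.
Qed.

(** After subtraction of q_{k-1,1} times X^(k-2) - Y^(k-2), all the q_{r,s}
    with odd r > 1 are zero. *)
Lemma qrow_eq0 p : Weven k p -> qrow k p = 0 ->
  exists a : rat, p = a *: (pX ^+ (k - 2) - pY ^+ (k - 2)).
Proof.
move=> Wp q0; pose a := qcoef k p (k - 1) 1; exists a.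
set w : QXY := pX ^+ (k - 2) - pY ^+ (k - 2).
have [hw ew] : Weven k w by exact: Weven_XY.
have [hp ep] := Wp.
apply/eqP; rewrite -subr_eq0; apply/eqP/Weven_eq0.
  split; first by rewrite rpredB ?rpredZ.
  rewrite !subst2B !subst2Z {1}ep {1}ew scalerBr.
  move: (subst2 p _ _) (subst2 p _ _) (a *: _) (a *: _) => x y z t; ring.
move=> i ei /andP[i0 i_k]; rewrite subst2B subst2Z (linearB (coefXY _ _)) (linearZ_LR (coefXY _ _)) /=.
rewrite !coefXY_shift_qcoef // qcoef_XY // -lt0n i0 mul1r mulr_rato -mulrBl.
suff -> : qcoef k p i.+1 (k - 1 - i) = a by rewrite subrr mul0r.
have [i00|->|[j ij]] := even_index_cases k_ge6 k_even ei i_k; first by rewrite i00 in i0.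
  by rewrite /a; congr qcoef; lia.
have := congr1 (fun v : 'rV_(nod k) => v 0 j) q0; rewrite !mxE => /eqP.
rewrite mulf_eq0 Num.Theory.pnatr_eq0 /= subr_eq0 -/a => /eqP <-.
have := od_bounds j => /andP[/andP[j3 j_k] _].
by rewrite ij; congr qcoef; lia.
Qed.

Lemma chat_eq0 p : \det (Amx k) != 0 -> Weven k p -> (forall i : 'I_(nod k), chat p i = 0) ->
  exists a : rat, p = a *: (pX ^+ (k - 2) - pY ^+ (k - 2)).
Proof.
move=> d0 Wp c0; apply: qrow_eq0 => //; apply: (scalerI d0); rewrite scaler0 -chat_mulA.
by rewrite (_ : \row_i _ = 0) ?mul0mx //; apply/rowP => i; rewrite !mxE.
Qed.
End Converse.

(** * Symmetrised weighted sums *)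

Lemma algE (R : comAlgType rat) (a : rat) (x : R) : a *: x = GRing.in_alg R a * x.
Proof. by rewrite /= mulr_algl. Qed.

Lemma natr_scale (R : comAlgType rat) (n : nat) (x : R) : n%:R * x = n%:R *: x.
Proof. by rewrite mulr_natl scaler_nat. Qed.

Lemma sign_scale (R : comAlgType rat) n (x : R) : (-1) ^+ n * x = (-1) ^+ n *: x.
Proof. by rewrite -signr_odd -[in RHS]signr_odd; case: odd; rewrite ?expr1 ?mulN1r ?scaleN1r ?mul1r ?scale1r. Qed.

Lemma binSE (F : comNzRingType) n i : 'C(n, i.+1)%:R * (i.+1)%:R = 'C(n, i)%:R * (n%:R - i%:R) :> F.
Proof.
have [lt_ni|le_in] := ltnP n i; first by rewrite !bin_small ?mul0r //; lia.
by rewrite -natrB // -!natrM mulnC mul_bin_left mulnC.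
Qed.

Lemma bin_SE n i : 'C(n, i.+1)%:R = 'C(n, i)%:R * (n%:R - i%:R) / (i%:R + 1) :> rat.
Proof.
have i1 : (i%:R + 1 : rat) != 0 by rewrite natr1 Num.Theory.pnatr_eq0.
by apply: (canRL (mulfK i1)); rewrite natr1 binSE.
Qed.

Lemma comb2 (V : lmodType rat) (a b c u v w : rat) (x y : V) :
  a + b = c -> a * u + b * v = c * w ->
  a *: (x + u *: y) + b *: (x + v *: y) = c *: (x + w *: y).
Proof.
move=> <- e; rewrite !scalerDr !scalerA -e !scalerDl.
by rewrite addrACA.
Qed.

Section Weights.
Variables (V : lmodType rat).

(** Sums of this shape form the right-hand side of the depth three formula. *)
Definition wsum (N : nat) (D : nat -> V) (a c : nat) : V :=
  \sum_(n < N.+1) ('C(n, a) * 'C(N - n, c))%:R *: D n.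

(** The combination that vanishes when the depth three formula is inserted
    into the stuffle product of zeta(c) and zeta(a,b), see [zTau_mixed]. *)
Definition sym3 (K : nat -> nat -> V) (a b c : nat) : V :=
  (-1) ^+ b *: K a c + (-1) ^+ c *: K a b + (-1) ^+ a *: K b c.

(** The coefficient of x^r y^0 z^s in (d/dx + d/dy + d/dz)^2 applied to the
    generating function sum_{a,b,c} tau(a,b,c) x^a y^b z^c. *)
Definition diff2 (tau : nat -> nat -> nat -> V) (r s : nat) : V :=
  2%:R *: tau r 2 s + (2 * r.+1)%:R *: tau r.+1 1 s + (2 * s.+1)%:R *: tau r 1 s.+1
  + (r.+2 * r.+1)%:R *: tau r.+2 0 s + (2 * r.+1 * s.+1)%:R *: tau r.+1 0 s.+1
  + (s.+2 * s.+1)%:R *: tau r 0 s.+2.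

Definition wcoef (N n a b c : nat) : rat :=
  (-1) ^+ b * ('C(n, a) * 'C(N - n, c))%:R + (-1) ^+ c * ('C(n, a) * 'C(N - n, b))%:R
  + (-1) ^+ a * ('C(n, b) * 'C(N - n, c))%:R.

Lemma sym3_wsum N D a b c :
  sym3 (wsum N D) a b c = \sum_(n < N.+1) wcoef N n a b c *: D n.
Proof.
rewrite /sym3 /wsum !scaler_sumr -!big_split; apply: eq_bigr => n _ /=.
by rewrite /wcoef !scalerDl !scalerA.
Qed.

Lemma diff2_wcoef N n r s : (n <= N)%N -> N = (r + s).+1 \/ N = (r + s).+2 ->
  2%:R * wcoef N n r 2 s + (2 * r.+1)%:R * wcoef N n r.+1 1 s
  + (2 * s.+1)%:R * wcoef N n r 1 s.+1 + (r.+2 * r.+1)%:R * wcoef N n r.+2 0 s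
  + (2 * r.+1 * s.+1)%:R * wcoef N n r.+1 0 s.+1 + (s.+2 * s.+1)%:R * wcoef N n r 0 s.+2 = 0.
Proof.
move=> le_nN defN; rewrite /wcoef !natrM !exprS !expr0 !bin0 !bin1 !bin_SE !bin0 !natrB //.
have r1 : (r%:R + 1 : rat) != 0 by rewrite natr1 Num.Theory.pnatr_eq0.
have r2 : (r%:R + 1 + 1 : rat) != 0 by rewrite !natr1 Num.Theory.pnatr_eq0.
have s1 : (s%:R + 1 : rat) != 0 by rewrite natr1 Num.Theory.pnatr_eq0.
have s2 : (s%:R + 1 + 1 : rat) != 0 by rewrite !natr1 Num.Theory.pnatr_eq0.
move: ((-1) ^+ r) ((-1) ^+ s) => x y.
case: defN => ->; rewrite -!natr1 !natrD; field; rewrite ?r1 ?r2 ?s1 ?s2 //.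
all: by rewrite -!natrD Num.Theory.pnatr_eq0.
Qed.

(** This holds for each D n separately, where it is an identity between
    rational functions ([diff2_wcoef]). *)
Lemma diff2_wsum N D r s : N = (r + s).+1 \/ N = (r + s).+2 ->
  diff2 (sym3 (wsum N D)) r s = 0.
Proof.
move=> defN; rewrite /diff2 !sym3_wsum !scaler_sumr -!big_split big1 // => n _ /=.
by rewrite !scalerA -!scalerDl diff2_wcoef ?scale0r // -ltnS.
Qed.

Section Ladder.
Variables (k : nat) (K : nat -> nat -> V).
Hypothesis k_ge4 : (4 <= k)%N.
Hypothesis k_even : ~~ odd k.
Hypothesis K_sym : forall a c, K a c = K c a.
Let tau := sym3 K.
Hypothesis tau_diff2 : forall r s, (r + s).+2 = k -> diff2 tau r s = 0.
Hypothesis tau_mixed : forall a b c, (0 < a)%N -> (0 < b)%N -> (0 < c)%N ->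
  (a + b + c)%N = k -> tau a b c = 0.

Let x r := tau r 0 (k - r).

Lemma ladder_step r : (0 < r)%N -> (r + 3 <= k)%N ->
  (r.+2 * r.+1)%:R *: x r.+2 = - ((2 * r.+1 * (k - r.+1))%:R *: x r.+1)
    - (((k - r) * (k - r.+1))%:R *: x r).
Proof.
move=> r0 rk; have [s [s0 defs]] : exists s, (0 < s)%N /\ (r + s).+2 = k.
  by exists (k - r.+2)%N; lia.
have t0 a b c : (0 < a)%N -> (0 < b)%N -> (0 < c)%N -> (a + b + c)%N = (r + s).+2 ->
  tau a b c = 0 by rewrite defs; apply: tau_mixed.
have := tau_diff2 defs; rewrite /diff2 (t0 r 2) ?(t0 r.+1 1) ?(t0 r 1) //; try lia.
rewrite !scaler0 !add0r.
have e2 : (k - r.+2)%N = s by lia.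
have e1 : (k - r.+1)%N = s.+1 by lia.
have e0 : (k - r)%N = s.+2 by lia.
rewrite /x e0 e1 e2 => /eqP; rewrite -addrA addr_eq0 opprD => /eqP ->.
by [].
Qed.

Lemma x_sym r : (r <= k)%N -> x (k - r) = x r.
Proof.
move=> rk; rewrite /x /tau /sym3 subKn // K_sym [K (k - r)%N _]K_sym [K r 0%N]K_sym.
rewrite -!addrA; congr (_ + _); rewrite addrC.
by rewrite -(signr_odd _ (k - r)) -(signr_odd _ r) oddB // (negbTE k_even).
Qed.

(** As tau vanishes at positive arguments, [tau_diff2] is a recursion of order
    two for x r = tau(r,0,k-r), solved by (-1)^r C(k,r) (A + r B). *)
Lemma ladder_linear : exists A B : V, forall r, (0 < r)%N -> (r < k)%N ->
  x r = ((-1) ^+ r * 'C(k, r)%:R) *: (A + r%:R *: B).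
Proof.
(* v1 and v2 are the values of A + r B at r = 1 and r = 2. *)
pose v1 := - (k%:R^-1 *: x 1%N); pose v2 := 'C(k, 2)%:R^-1 *: x 2.
exists (v1 *+ 2 - v2), (v2 - v1).
have k0 : k%:R != 0 :> rat by rewrite Num.Theory.pnatr_eq0; lia.
have c0 : 'C(k, 2)%:R != 0 :> rat by rewrite Num.Theory.pnatr_eq0 -lt0n bin_gt0; lia.
suff H r : (0 < r)%N -> (r.+1 < k)%N ->
    x r = ((-1) ^+ r * 'C(k, r)%:R) *: (v1 *+ 2 - v2 + r%:R *: (v2 - v1)) /\
    x r.+1 = ((-1) ^+ r.+1 * 'C(k, r.+1)%:R) *: (v1 *+ 2 - v2 + r.+1%:R *: (v2 - v1)).
  move=> r r0 rk; have [lt|ge] := ltnP r.+1 k; first by case: (H r).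
  by case: r {r0} rk ge => [|r] rk ge; [lia|have [||//] := H r; lia].
elim: r => // -[_ _ _|r IHr _ rk].
  have -> : v1 *+ 2 - v2 + 1%:R *: (v2 - v1) = v1.
    by rewrite scale1r mulr2n addrA subrK addrK.
  have -> : v1 *+ 2 - v2 + 2%:R *: (v2 - v1) = v2.
    by rewrite scaler_nat mulrnBl addrC addrA subrK mulr2n addrK.
  rewrite bin1 expr1 sqrrN expr1n mul1r mulN1r scaleNr /v1 /v2 scalerN opprK !scalerA.
  by rewrite !divff // !scale1r.
have [||e1 e2] := IHr; [lia..|].
split=> //.
have d0 : (r.+3 * r.+2)%:R != 0 :> rat by rewrite Num.Theory.pnatr_eq0.
apply: (scalerI d0); rewrite ladder_step; [|lia..].
rewrite e1 e2 -scaleNr -[in X in _ + X]scaleNr !scalerA.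
apply: comb2.
  rewrite ['C(k, r.+3)%:R]bin_SE ['C(k, r.+2)%:R]bin_SE !natrM !natrB ?exprS -?natr1; try lia.
  by field; rewrite !natr1 !Num.Theory.pnatr_eq0.
rewrite ['C(k, r.+3)%:R]bin_SE ['C(k, r.+2)%:R]bin_SE !natrM !natrB ?exprS -?natr1; try lia.
by field; rewrite !natr1 !Num.Theory.pnatr_eq0.
Qed.

(** The symmetry x (k - r) = x r forces B = 0. The recursion at r = 0 then
    determines x 0. *)
Lemma ladder_const : exists A : V, x 0%N = A *+ 2 /\ forall r, (0 < r)%N -> (r < k)%N ->
  x r = ((-1) ^+ r * 'C(k, r)%:R) *: A.
Proof.
have [A [B xE]] := ladder_linear.
have k0 : k%:R != 0 :> rat by rewrite Num.Theory.pnatr_eq0; lia.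
have k2 : (k - 2)%:R != 0 :> rat by rewrite Num.Theory.pnatr_eq0; lia.
have B0 : B = 0.
  have := x_sym (r := 1); rewrite !xE ?bin1; [|lia..] => /(_ ltac:(lia)).
  rewrite -signr_odd oddB ?(negbTE k_even); [|lia].
  rewrite bin_sub ?bin1; [|lia].
  have ck : (-1) ^+ (false (+) odd 1) * k%:R != 0 :> rat by rewrite mulf_neq0 ?signr_eq0.
  move=> /(scalerI ck) /addrI/eqP; rewrite -subr_eq0 -scalerBl scaler_eq0.
  by rewrite -natrB -?subnDA ?(negbTE k2) => [/eqP //|]; lia.
exists A; split; last by move=> r r0 rk; rewrite xE // B0 scaler0 addr0.
have [s [s0 defs]] : exists s, (0 < s)%N /\ (0 + s).+2 = k by exists (k - 2)%N; lia.
have tau0 b c : tau 0 b c = tau b 0 c.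
  by rewrite /tau /sym3 [K b 0%N]K_sym [LHS](ACl (3*2*1))%AC.
have := tau_diff2 defs; rewrite /diff2 !tau0 (tau_mixed (a := 1)) //.
have e2 : (k - 2)%N = s by lia.
have e1 : (k - 1)%N = s.+1 by lia.
have e0 : (k - 0)%N = s.+2 by lia.
have := xE 1%N; have := xE 2; rewrite /x B0 !scaler0 !addr0 e0 e1 e2.
move=> -> //; [|lia]; move=> -> //; [|lia].
rewrite bin1 expr1 sqrrN expr1n mul1r mulN1r !scalerA -!scalerDl => /eqP.
rewrite addrC addr_eq0 -scaleNr => /eqP h.
have d0 : (s.+2 * s.+1)%:R != 0 :> rat by rewrite Num.Theory.pnatr_eq0.
apply: (scalerI d0); rewrite h -scaler_nat scalerA; congr (_ *: _).
by rewrite !bin_SE bin0 -defs !natrM -?natr1; field.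
Qed.

End Ladder.
End Weights.

(** * Algebras satisfying the depth three formula *)

(** The hypotheses on [zeta] are those shared by the finite multiple zeta values
    and, under the assumption of the theorem, by their formal counterparts. *)
Section Model.
Variables (R : comAlgType rat) (k : nat) (zeta : seq nat -> R).
Hypothesis k_ge6 : (6 <= k)%N.
Hypothesis k_even : ~~ odd k.

Definition zz (n : nat) : R :=
  if (n <= 1)%N then 0 else n%:R^-1 *: zeta [:: (n - 1)%N; 1%N].

Hypothesis zeta_stuffle : forall u v : zword,
  zeta (map succn u) * zeta (map succn v) = \sum_(w <- stuffle u v) zeta (map succn w).
Hypothesis zeta_rev : forall w : zword,
  zeta (map succn w) = (-1) ^+ wt w *: zeta (map succn (rev w)).
Hypothesis zeta1 : forall n, (0 < n)%N -> zeta [:: n] = 0.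
Hypothesis zeta3 : forall a b c : nat, (0 < a)%N -> (0 < b)%N -> (0 < c)%N -> (a + b + c = k)%N ->
  zeta [:: a; b; c] =
    (-1) ^+ (b - 1) *
      \sum_(1 <= n < k - 1)
         ('C(n, a) * 'C(k - 1 - n, c))%:R * zeta [:: n; 1%N; (k - 1 - n)%N]
    + (-1) ^+ (a + c) *
      \sum_(1 <= i < b)
         ('C(a + i, a) * 'C(b + c - i, c))%:R * (zz (a + i) * zz (b + c - i)).

Lemma zeta2_even a b : (0 < a)%N -> (0 < b)%N -> ~~ odd (a + b) -> zeta [:: a; b] = 0.
Proof.
case: a b => [//|a] [//|b] _ _ eab.
have := zeta_stuffle [:: a] [:: b]; rewrite /= !big_cons big_nil /= !zeta1 // mul0r !addr0.
have := zeta_rev [:: a; b]; rewrite /wt !big_cons big_nil addn0 /= -signr_odd (negbTE eab) scale1r.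
move=> <- /esym/eqP; rewrite -mulr2n -scaler_nat scaler_eq0 Num.Theory.pnatr_eq0 /=.
by move/eqP.
Qed.

Lemma zz_even n : ~~ odd n -> zz n = 0.
Proof.
move=> en; rewrite /zz; case: leqP => // n1; rewrite zeta2_even ?scaler0 //; first by lia.
by rewrite subnK // ltnW.
Qed.

Lemma zeta3_stuffle a b c : (0 < a)%N -> (0 < b)%N -> (0 < c)%N -> (a + b + c = k)%N ->
  zeta [:: c; a; b] + zeta [:: a; c; b] + zeta [:: a; b; c] = 0.
Proof.
case: a b c => [//|a] [//|b] [//|c] _ _ _ abc.
have := zeta_stuffle [:: c] [:: a; b]; rewrite /= !big_cons big_nil /= !zeta1 // mul0r !addr0.
have z2 x y : ~~ odd (x.+1 + y.+1) -> zeta [:: x.+1; y.+1] = 0 by exact: zeta2_even.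
move: k_even; rewrite -abc => eabc.
rewrite (z2 (c + a).+1 b) ?(z2 a (c + b).+1); [|lia..].
by rewrite !addr0 addrA => <-.
Qed.

(** In the alternating sum of the stuffle products zeta(r-1) zeta(1,s-1,1),
    zeta(1,r-1) zeta(s-1,1) and zeta(s-1,1,r-1) zeta(1), the first and the last of
    which are zero, the only terms of depth four that remain are zeta(r-1,1,s-1,1)
    and its reversal. *)
Lemma zeta4_stuffle r s : odd r -> odd s -> (1 < r)%N -> (1 < s)%N -> (r + s = k)%N ->
  zeta [:: (r - 1)%N; 1%N; (s - 1)%N; 1%N] *+ 2
    = (r * s)%:R *: (zz r * zz s) - zeta [:: 1%N; (s - 1)%N; r] + zeta [:: 1%N; (r - 1)%N; s].
Proof.
case: r s => [//|[//|r]] [//|[//|s]] or os _ _ rsk; rewrite !subn1 /=.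
have z4 a b c d : zeta [:: a.+1; b.+1; c.+1; d.+1] = (-1) ^+ wt [:: a; b; c; d] *:
  zeta [:: d.+1; c.+1; b.+1; a.+1] := zeta_rev [:: a; b; c; d].
have z3 a b c : zeta [:: a.+1; b.+1; c.+1] = (-1) ^+ wt [:: a; b; c] *:
  zeta [:: c.+1; b.+1; a.+1] := zeta_rev [:: a; b; c].
have z2 a b : zeta [:: a.+1; b.+1] = (-1) ^+ wt [:: a; b] *:
  zeta [:: b.+1; a.+1] := zeta_rev [:: a; b].
have e1 := zeta_stuffle [:: r] [:: 0%N; s; 0%N].
have e2 := zeta_stuffle [:: 0%N; r] [:: s; 0%N].
have e3 := zeta_stuffle [:: s; 0%N; r] [:: 0%N].
rewrite /= !big_cons big_nil /= !addn0 in e1 e2 e3.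
rewrite zeta1 // mul0r in e1; rewrite [zeta [:: 1%N]]zeta1 // mulr0 in e3.
have zzM n : zeta [:: n.+1; 1%N] = n.+2%:R *: zz n.+2.
  by rewrite /zz /= scalerA divff ?scale1r ?subn1 // Num.Theory.pnatr_eq0.
have zr : zeta [:: 1%N; r.+1] = - (r.+2%:R *: zz r.+2).
  rewrite (z2 0%N r) zzM /wt !big_cons big_nil -signr_odd.
  by rewrite (_ : odd _ = true) ?scaleN1r //; move: or; lia.
rewrite zr zzM in e2.
have s3 a b c : ~~ odd (a + b + c).+3 -> zeta [:: a.+1; b.+1; c.+1] = zeta [:: c.+1; b.+1; a.+1].
  move=> eabc; rewrite z3 /wt !big_cons big_nil -signr_odd.
  by rewrite (_ : odd _ = false) ?scale1r //; move: eabc; lia.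
have x4 : zeta [:: 1%N; s.+1; 1%N; r.+1] = zeta [:: r.+1; 1%N; s.+1; 1%N].
  rewrite (z4 0%N s 0%N r) /wt !big_cons big_nil -signr_odd.
  by rewrite (_ : odd _ = false) ?scale1r //; move: or os; lia.
have x2 : zeta [:: s.+2; r.+2] = 0 by rewrite zeta2_even //; move: or os; lia.
rewrite (s3 0%N s r.+1) ?(s3 0%N r s.+1); try by move: or os; lia.
rewrite ?add0n x4 x2 in e1 e2 e3.
have -> : (r.+2 * s.+2)%:R *: (zz r.+2 * zz s.+2) = (r.+2%:R *: zz r.+2) * (s.+2%:R *: zz s.+2).
  by rewrite natrM -scalerA scalerAr scalerAl.
have solve (P E1 E2 E3 X Y Z : R) : 0 = E1 -> - P = E2 -> 0 = E3 ->
    E1 - E2 + E3 = X *+ 2 + Y - Z -> X *+ 2 = P - Y + Z.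
  by move=> <- <- <-; rewrite sub0r opprK addr0 => ->; ring.
rewrite mulNr in e2; apply: solve e1 e2 e3 _; ring.
Qed.

Definition zTn (n : nat) : R :=
  if (0 < n < k - 1)%N then zeta [:: n; 1%N; (k - 1 - n)%N] else 0.

Definition zPi0 (n : nat) : R := if (1 < n < k - 1)%N then zz n * zz (k - n) else 0.

(** The image of P_{n,k-n}. It is z(n) z(k-n), but the values at n = 1 and
    n = k - 1 may be chosen freely because z(1) = 0; they are chosen so that the
    sum over all n is zero ([sum_zPi]). *)
Definition zPi (n : nat) : R :=
  if (n == 1) || (n == k - 1)%N then - (2%:R^-1 *: \sum_(i < k.+1) zPi0 i) else zPi0 n.

(** In terms of this function the depth three formula takes the form
    [zeta3_zK]. *)
Definition zK (a c : nat) : R := wsum k zPi a c - wsum (k - 1) zTn a c.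

Lemma zTn_sym n : (n < k)%N -> zTn (k - 1 - n) = zTn n.
Proof.
move=> lt_nk; rewrite /zTn; have -> : (0 < k - 1 - n < k - 1)%N = (0 < n < k - 1)%N by lia.
case: ifP => // n_k; rewrite subKn; last by lia.
have := zeta_rev [:: n.-1; 0%N; (k - 1 - n).-1].
rewrite /wt !big_cons big_nil /= !prednK; [|lia..]; move=> ->.
by rewrite -signr_odd (_ : odd _ = false) ?scale1r //; move: k_even; lia.
Qed.

Lemma zPi0_sym n : (n <= k)%N -> zPi0 (k - n) = zPi0 n.
Proof.
move=> le_nk; rewrite /zPi0; have -> : (1 < k - n < k - 1)%N = (1 < n < k - 1)%N by lia.
by case: ifP => // _; rewrite subKn // mulrC.
Qed.

Lemma zPi_sym n : (n <= k)%N -> zPi (k - n) = zPi n.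
Proof.
move=> le_nk; rewrite /zPi zPi0_sym //.
by have -> : ((k - n == 1) || (k - n == k - 1))%N = ((n == 1) || (n == k - 1))%N by lia.
Qed.

Lemma zPi_even n : ~~ odd n -> zPi n = 0.
Proof.
move=> en; rewrite /zPi /zPi0 ifF; last by move: k_even; lia.
by rewrite zz_even // mul0r if_same.
Qed.

Lemma sum_zPi : \sum_(n < k.+1) zPi n = 0.
Proof.
have l1 : (1 < k.+1)%N by lia.
have l2 : (k - 1 < k.+1)%N by lia.
have ne : Ordinal l2 != Ordinal l1 by apply/eqP => /(congr1 val) /=; lia.
rewrite (bigD1 (Ordinal l1)) //= (bigD1 (Ordinal l2)) //= addrA.
rewrite {1 2}/zPi /= eqxx orbT -opprD -scalerDl.
have -> : 2%:R^-1 + 2%:R^-1 = 1 :> rat by [].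
rewrite scale1r (bigD1 (Ordinal l1)) //= (bigD1 (Ordinal l2)) //=.
have z0 i : (i == 1)%N || (i == k - 1)%N -> zPi0 i = 0.
  by move=> i1; rewrite /zPi0 ifF //; lia.
rewrite !z0 ?eqxx ?orbT // !add0r; apply/eqP; rewrite addrC subr_eq0; apply/eqP.
apply: eq_bigr => i /andP[i1 i2]; rewrite /zPi ifF //.
apply/negbTE; rewrite negb_or; apply/andP; split.
  by apply: contraNneq i1 => e; apply/eqP/val_inj.
by apply: contraNneq i2 => e; apply/eqP/val_inj.
Qed.

Lemma zK_sym a c : zK a c = zK c a.
Proof.
rewrite /zK; congr (_ - _); rewrite /wsum (reindex_inj rev_ord_inj).
  apply: eq_bigr => n _; rewrite /= subSS; have le_n : (n <= k)%N by rewrite -ltnS.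
  by rewrite subKn // zPi_sym // mulnC.
apply: eq_bigr => n _; rewrite /= subSS; have le_n : (n <= k - 1)%N by rewrite -ltnS.
have lt_n : (n < k)%N by apply: leq_ltn_trans le_n _; lia.
by rewrite subKn // zTn_sym // mulnC.
Qed.

(** The products z(a+i) z(b+c-i) run over the terms of the weighted sum of all
    [zPi n] except for the end terms n = a and n = a + b. *)
Lemma zeta3_zK a b c : (0 < a)%N -> (0 < b)%N -> (0 < c)%N -> (a + b + c = k)%N ->
  zeta [:: a; b; c] = (-1) ^+ b *: (zK a c - 'C(b + c, c)%:R *: zPi a - 'C(a + b, a)%:R *: zPi c).
Proof.
move=> a0 b0 c0 abc; rewrite zeta3 //.
have -> : \sum_(1 <= n < k - 1) ('C(n, a) * 'C(k - 1 - n, c))%:R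
    * zeta [:: n; 1%N; (k - 1 - n)%N] = wsum (k - 1) zTn a c.
  rewrite /wsum -(big_mkord xpredT (fun n => ('C(n, a) * 'C(k - 1 - n, c))%:R *: zTn n)).
  rewrite big_ltn // [in RHS]big_nat_recr /=; last by lia.
  rewrite {1}/zTn /= scaler0 add0r {2}/zTn ltnn andbF scaler0 addr0.
  apply: eq_big_nat => n n_k; rewrite /zTn ifT; last by lia.
  by rewrite natr_scale.
rewrite !sign_scale.
have -> : (-1) ^+ (b - 1) = - (-1) ^+ b :> rat.
  by case: b b0 {abc} => // b _; rewrite subn1 exprS mulN1r opprK.
have -> : (-1) ^+ (a + c) = (-1) ^+ b :> rat.
  by rewrite -signr_odd -[RHS]signr_odd; congr (_ ^+ nat_of_bool _); move: k_even; lia.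
have -> : \sum_(1 <= i < b) ('C(a + i, a) * 'C(b + c - i, c))%:R * (zz (a + i) * zz (b + c - i))
    = wsum k zPi a c - 'C(b + c, c)%:R *: zPi a - 'C(a + b, a)%:R *: zPi c.
  rewrite /wsum -(big_mkord xpredT (fun n => ('C(n, a) * 'C(k - n, c))%:R *: zPi n)).
  rewrite [in RHS](big_cat_nat (n := a)) //=; last by lia.
  rewrite [in RHS]big_nat [in RHS]big1 ?add0r => [|n n_a]; last first.
    by rewrite bin_small ?mul0n ?scale0r //; lia.
  rewrite [in RHS]big_ltn; last by lia.
  rewrite [in RHS](big_cat_nat (n := a + b)) //=; [|lia..].
  rewrite [X in _ + (_ + X)]big_ltn; last by lia.
  rewrite [X in _ + (_ + (_ + X))]big_nat [X in _ + (_ + (_ + X))]big1 => [|n n_a]; last first.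
    by rewrite ['C(k - n, c)]bin_small ?muln0 ?scale0r //; lia.
  have -> : (k - a = b + c)%N by lia.
  have -> : (k - (a + b) = c)%N by lia.
  have -> : zPi (a + b) = zPi c by rewrite -zPi_sym; [congr zPi; lia|lia].
  rewrite !binn mul1n muln1 addr0 addrC addrK addrK.
  rewrite -[X in _ = \sum_(X <= _ < _) _]addn1 [in RHS]addnC big_addn.
  have -> : (a + b - a = b)%N by lia.
  apply: eq_big_nat => i i_b; rewrite natr_scale [(i + a)%N]addnC.
  have -> : (k - (a + i) = b + c - i)%N by lia.
  rewrite /zPi ifF /zPi0; last by lia.
  rewrite ifT; last by lia.
  by have -> : (k - (a + i) = b + c - i)%N by lia.
rewrite scaleNr -scalerN -scalerDr /zK; congr (_ *: _).
by rewrite addrC [LHS]addrAC; congr (_ - _); exact: addrAC.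
Qed.

Let zTau := sym3 zK.

(** This is [zeta3_stuffle]. The terms with [zPi] cancel in pairs, because the
    two signs are opposite when the argument of [zPi] is odd, and [zPi] is zero at
    even arguments. *)
Lemma zTau_mixed a b c : (0 < a)%N -> (0 < b)%N -> (0 < c)%N -> (a + b + c = k)%N ->
  zTau a b c = 0.
Proof.
move=> a0 b0 c0 abc; have := zeta3_stuffle a0 b0 c0 abc.
rewrite !zeta3_zK //; try by lia.
rewrite /zTau /sym3 [zK c b]zK_sym.
have eb : 'C(a + b, a) = 'C(a + b, b) by rewrite -bin_sub ?leq_addr // addKn.
have ec : 'C(a + c, a) = 'C(a + c, c) by rewrite -bin_sub ?leq_addr // addKn.
have ea : 'C(c + b, c) = 'C(c + b, b) by rewrite -bin_sub ?leq_addr // addKn.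
rewrite ['C(a + b, a)]eb ['C(a + c, a)]ec [(b + c)%N]addnC [(c + a)%N]addnC ea.
have opp (x y : nat) (d : rat) (P : R) : (odd x != odd y) || (P == 0) ->
    (-1) ^+ x *: (d *: P) = - ((-1) ^+ y *: (d *: P)).
  case: (P =P 0) => [->|_]; first by rewrite !scaler0 oppr0.
  rewrite orbF -signr_odd -[in RHS]signr_odd.
  by case: (odd x); case: (odd y); rewrite // ?expr0 ?expr1 !scaleN1r !scale1r ?opprK.
have Po x y z : (x + y + z)%N = k -> (odd x != odd y) || (zPi z == 0).
  move=> xyz; have [oz|/zPi_even ->] := boolP (odd z); last by rewrite eqxx orbT.
  by rewrite (_ : odd x != odd y) //; move: k_even; rewrite -xyz; lia.
move=> e; rewrite -{}e !scalerBr.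
have h1 d := opp b c d _ (Po b c a ltac:(lia)); have h2 d := opp a c d _ (Po a c b ltac:(lia)).
have h3 d := opp a b d _ (Po a b c abc).
rewrite h1 h2 h3.
move: (_ *: (_ *: zPi a)) (_ *: (_ *: zPi b)) (_ *: (_ *: zPi c)) => P Q S.
ring.
Qed.

Lemma zTau_diff2 r s : (r + s).+2 = k -> diff2 zTau r s = 0.
Proof.
move=> rsk; have h1 := diff2_wsum zPi (or_intror (esym rsk)).
have h2 : diff2 (sym3 (wsum (k - 1) zTn)) r s = 0.
  by apply: diff2_wsum; left; lia.
rewrite -[LHS]subr0 -[X in _ - X]h1 -[RHS]oppr0 -[in RHS]h2 /diff2 /zTau /sym3 /zK !algE.
by ring.
Qed.

Lemma zK_top a : (a <= k)%N -> zK a (k - a) = zPi a.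
Proof.
move=> le_ak; rewrite /zK /wsum [X in _ - X]big1 => [|n _]; last first.
  have [n_a|a_n] := ltnP n a; first by rewrite bin_small ?mul0n ?scale0r.
  rewrite ['C(k - 1 - n, _)]bin_small ?muln0 ?scale0r //.
  have := ltn_ord n; have := k_ge6; lia.
have lt_a : (a < k.+1)%N by rewrite ltnS.
rewrite subr0 (bigD1 (Ordinal lt_a)) //= !binn scale1r big1 ?addr0 // => n ne_n.
have {}ne_n : (n : nat) != a by apply: contraNneq ne_n => e; apply/eqP/val_inj.
have le_n : (n <= k)%N by rewrite -ltnS.
have [n_a|a_n] := ltnP n a; first by rewrite bin_small ?mul0n ?scale0r.
by rewrite ['C(k - n, _)]bin_small ?muln0 ?scale0r //; lia.
Qed.

Lemma zPi_0 : zPi 0 = 0. Proof. exact: zPi_even. Qed.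
Lemma zTn_0 : zTn 0 = 0. Proof. by []. Qed.

Lemma zK_0pred : zK 0 (k - 1) = zPi 1.
Proof.
rewrite /zK /wsum [X in _ - X]big1 => [|[[|n] lt_n] _]; first last.
- by rewrite ['C(k - 1 - _, _)]bin_small ?muln0 ?scale0r //=; have := k_ge6; lia.
- by rewrite zTn_0 scaler0.
have l1 : (1 < k.+1)%N by lia.
rewrite subr0 (bigD1 (Ordinal l1)) //= binn bin0 scale1r big1 ?addr0 // => -[[|[|n]] lt_n] //= ne_n.
  by rewrite zPi_0 scaler0.
by rewrite ['C(k - _, _)]bin_small ?muln0 ?scale0r //; lia.
Qed.

Let sT := \sum_(n < k) zTn n.

Lemma zK_00 : zK 0 0 = - sT.
Proof.
rewrite /zK /wsum; under eq_bigr => n _ do rewrite !bin0 scale1r.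
under [X in _ - X]eq_bigr => n _ do rewrite !bin0 scale1r.
by rewrite sum_zPi sub0r /sT; congr (- _); have -> : (k - 1).+1 = k by lia.
Qed.

Lemma sum_index_sym N (D : nat -> R) : (forall n, (n <= N)%N -> D (N - n)%N = D n) ->
  (\sum_(n < N.+1) n%:R *: D n) *+ 2 = N%:R *: \sum_(n < N.+1) D n.
Proof.
move=> Dsym; rewrite mulr2n {2}(reindex_inj rev_ord_inj) /= -big_split scaler_sumr.
apply: eq_bigr => n _ /=; have le_n : (n <= N)%N by rewrite -ltnS.
by rewrite subSS Dsym // -scalerDl -natrD subnKC.
Qed.

Lemma zK_10 : zK 1 0 *+ 2 = - ((k - 1)%:R *: sT).
Proof.
rewrite /zK /wsum; under eq_bigr => n _ do rewrite !bin0 bin1 muln1.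
under [X in _ - X]eq_bigr => n _ do rewrite !bin0 bin1 muln1.
rewrite mulrnBl (sum_index_sym zPi_sym) sum_zPi scaler0 sub0r sum_index_sym.
  by rewrite /sT; congr (- (_ *: _)); have -> : (k - 1).+1 = k by lia.
by move=> n le_n; rewrite zTn_sym //; lia.
Qed.

(** By [ladder_const] the values depend on one unknown A. Both tau(0,0,k) = 2
    A and tau(1,0,k-1) = -k A are multiples of the sum of all [zTn n], and the two
    multiples are compatible only if A = 0. *)
Lemma zTau_border : sT = 0 /\ forall r, (0 < r)%N -> (r < k)%N -> zTau r 0 (k - r) = 0.
Proof.
have k4 : (4 <= k)%N by lia.
have [A [x0 xr]] := ladder_const k4 k_even zK_sym zTau_diff2 zTau_mixed.
have hT : - sT = A *+ 2.
  rewrite -x0 /sym3 subn0 [zK 0 k](_ : _ = 0); last by rewrite -[X in zK _ X]subn0 zK_top ?zPi_0.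
  by rewrite !scaler0 zK_00 add0r addr0 -signr_odd (negbTE k_even) scale1r.
have x1 : zTau 1 0 (k - 1) = - zK 1 0.
  rewrite /zTau /sym3 zK_top ?zK_0pred; last by lia.
  rewrite -(signr_odd _ (k - 1)) (_ : odd (k - 1) = true); last by move: k_even; lia.
  by rewrite expr0 expr1 scale1r !scaleN1r addrAC subrr add0r.
have A0 : A = 0.
  have := xr 1%N isT ltac:(lia); rewrite -/zTau x1 bin1 expr1 mulN1r scaleNr => /oppr_inj e.
  have := zK_10; rewrite {}e -scalerN hT -[A *+ 2]scaler_nat -[(k%:R *: A) *+ 2]scaler_nat.
  rewrite !scalerA [2%:R * _]mulrC => /eqP; rewrite -subr_eq0 -scalerBl -mulrBl scaler_eq0.
  rewrite -natrB ?leq_subr // subKn; last by lia.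
  by rewrite mul1r => /eqP.
split; last by move=> r r0 rk; have := xr r r0 rk; rewrite A0 scaler0.
by apply: oppr_inj; rewrite hT A0 mul0rn oppr0.
Qed.

(** The image of Z_{r,k-r}. *)
Definition zv (r : nat) : R := - ((-1) ^+ r *: zK r 0).

(** Binomial inversion ([alt_bin_pred]) turns the weights into a
    truncation. *)
Lemma sum_wsum0 N (D : nat -> R) j : (forall n, (k <= n <= N)%N -> D n = 0) ->
  \sum_(1 <= a < k) 'C(a - 1, j)%:R *: ((-1) ^+ a *: wsum N D a 0)
  = (-1) ^+ j.+1 *: \sum_(n < N.+1) (j < n)%N%:R *: D n.
Proof.
move=> D0; rewrite scaler_sumr.
transitivity (\sum_(1 <= a < k) \sum_(n < N.+1)
    ((-1) ^+ a * ('C(n, a) * 'C(a - 1, j))%:R) *: D n).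
  apply: eq_bigr => a _; rewrite /wsum !scaler_sumr; apply: eq_bigr => n _.
  by rewrite bin0 muln1 !scalerA natrM; congr (_ *: _); ring.
rewrite exchange_big; apply: eq_bigr => n _ /=; rewrite -scaler_suml.
have [lt_nk|le_kn] := ltnP n k; first by rewrite alt_bin_pred // scalerA.
by rewrite D0 ?scaler0 // le_kn -ltnS ltn_ord.
Qed.

(** This is the vanishing of tau(r,0,k-r), by [zK_top]. *)
Lemma zv_stuffle r s : (0 < r)%N -> (0 < s)%N -> (r + s = k)%N -> zPi r = zv r + zv s.
Proof.
move=> r0 s0 rsk; have [_ /(_ r r0 ltac:(lia))] := zTau_border.
have -> : (k - r)%N = s by lia.
rewrite /zTau /sym3 {1}(_ : s = (k - r)%N) ?zK_top; [|lia..].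
rewrite expr0 scale1r [zK 0 s]zK_sym /zv => /eqP; rewrite -addrA addr_eq0 => /eqP ->.
rewrite opprD; congr (- (_ *: _) - (_ *: _)).
  by rewrite -signr_odd -[RHS]signr_odd; congr (_ ^+ nat_of_bool _); move: k_even; lia.
by rewrite -signr_odd -[RHS]signr_odd; congr (_ ^+ nat_of_bool _); move: k_even; lia.
Qed.

(** By [sum_wsum0] the two sums over a collect the terms with n >= r and with
    n >= s. Reflecting the second range shows that every [zTn n] is collected
    once, and so is every [zPi n] but [zPi r], which is collected twice. The
    complete sums are zero. *)
Lemma zv_shuffle r s : (0 < r)%N -> (0 < s)%N -> (r + s = k)%N ->
  zPi r = \sum_(1 <= a < k) ('C(a - 1, r - 1) + 'C(a - 1, s - 1))%:R *: zv a.
Proof.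
move=> r0 s0 rsk.
have E j : \sum_(1 <= a < k) 'C(a - 1, j)%:R *: zv a = (-1) ^+ j *:
    (\sum_(n < k.+1) (j < n)%N%:R *: zPi n - \sum_(n < k) (j < n)%N%:R *: zTn n).
  transitivity (\sum_(1 <= a < k) (- ('C(a - 1, j)%:R *: ((-1) ^+ a *: wsum k zPi a 0))
      + 'C(a - 1, j)%:R *: ((-1) ^+ a *: wsum (k - 1) zTn a 0))).
    by apply: eq_bigr => a _; rewrite /zv /zK scalerN !scalerBr opprB addrC.
  rewrite big_split sumrN !sum_wsum0; first last.
  - by move=> n n_k; rewrite zPi_even // (_ : n = k) //; lia.
  - by move=> n; lia.
  by rewrite exprS mulN1r !scaleNr opprK /= -scalerBr; have -> : (k - 1).+1 = k by lia.
under eq_bigr do rewrite natrD scalerDl.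
rewrite big_split !E /=.
have -> : (-1) ^+ (s - 1) = (-1) ^+ (r - 1) :> rat.
  by rewrite -signr_odd -[RHS]signr_odd; congr (_ ^+ nat_of_bool _); move: k_even; lia.
rewrite -scalerDr addrACA -opprD.
have -> : \sum_(n < k) (r - 1 < n)%N%:R *: zTn n + \sum_(n < k) (s - 1 < n)%N%:R *: zTn n = 0.
  have [eT _] := zTau_border; rewrite -[RHS]eT /sT [X in _ + X](reindex_inj rev_ord_inj) -big_split.
  apply: eq_bigr => n _ /=.
  have -> : (k - n.+1 = k - 1 - n)%N by lia.
  rewrite zTn_sym // -scalerDl -natrD (_ : (_ + _)%N = 1%N) ?scale1r //.
  by have := ltn_ord n; lia.
have -> : \sum_(n < k.+1) (r - 1 < n)%N%:R *: zPi n + \sum_(n < k.+1) (s - 1 < n)%N%:R *: zPi n = zPi r.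
  have lt_r : (r < k.+1)%N by lia.
  transitivity (\sum_(n < k.+1) zPi n + \sum_(n < k.+1) (n == Ordinal lt_r)%:R *: zPi n).
    rewrite [X in _ + X = _](reindex_inj rev_ord_inj) -!big_split.
    apply: eq_bigr => n _ /=; have le_n : (n <= k)%N by rewrite -ltnS.
    rewrite subSS zPi_sym // -[X in _ = X + _]scale1r -!scalerDl -natrD; congr (_ *: _).
    by rewrite -val_eqE -[1 + _](natrD _ 1 _); congr _%:R => /=; lia.
  rewrite sum_zPi add0r (bigD1 (Ordinal lt_r)) //= eqxx scale1r big1 ?addr0 // => n.
  by move/negbTE ->; rewrite scale0r.
rewrite subr0; have [or|/zPi_even ->] := boolP (odd r); last by rewrite scaler0.
by rewrite -signr_odd (_ : odd _ = false) ?scale1r //; move: or; lia.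
Qed.

Lemma zv_1 : zv 1 = 0.
Proof.
suff /eqP : zK 1 0 *+ 2 = 0.
  by rewrite -scaler_nat scaler_eq0 /= /zv => /eqP ->; rewrite scaler0 oppr0.
by rewrite zK_10; have [-> _] := zTau_border; rewrite scaler0 oppr0.
Qed.

Lemma Dtilde_model : exists psi : {linear Dtilde k -> R},
  (forall r s, (0 < r)%N -> (0 < s)%N -> (r + s = k)%N -> psi (DtZ k r s) = zv r) /\
  (forall r s, (0 < r)%N -> (0 < s)%N -> (r + s = k)%N -> psi (DtP k r s) = zPi r).
Proof.
apply: Dtilde_lift; [exact: zv_stuffle | exact: zv_shuffle | | by lia | exact: zv_1].
by move=> r s _ _ _ er _; exact: zPi_even.
Qed.

(** From C(n,1) = n and the absorption identity (s+1) C(k-n, s+1) = (k-n-s)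
    C(k-n, s). *)
Lemma zK_1 r s : (0 < r)%N -> (r + s = k)%N ->
  zK 1 s = (r%:R - 1) *: zK 0 s - s.+1%:R *: zK 0 s.+1
    + \sum_(n < k.+1) 'C(k - n, s)%:R *: zPi n.
Proof.
move=> r0 rsk; have ks : k%:R = r%:R + s%:R :> rat by rewrite -natrD rsk.
have wk : \sum_(n < k.+1) ('C(n, 1) * 'C(k - n, s))%:R *: zPi n
    = (r%:R - 1) *: (\sum_(n < k.+1) ('C(n, 0) * 'C(k - n, s))%:R *: zPi n)
      - s.+1%:R *: (\sum_(n < k.+1) ('C(n, 0) * 'C(k - n, s.+1))%:R *: zPi n)
      + \sum_(n < k.+1) 'C(k - n, s)%:R *: zPi n.
  rewrite !scaler_sumr -sumrB -big_split; apply: eq_bigr => n _ /=.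
  have le_n : (n <= k)%N by rewrite -ltnS.
  rewrite !scalerA -scalerBl -scalerDl; congr (_ *: _).
  rewrite bin1 bin0 !mul1n natrM [s.+1%:R * _]mulrC binSE natrB // ks; ring.
have wk1 : \sum_(n < (k - 1).+1) ('C(n, 1) * 'C(k - 1 - n, s))%:R *: zTn n
    = (r%:R - 1) *: (\sum_(n < (k - 1).+1) ('C(n, 0) * 'C(k - 1 - n, s))%:R *: zTn n)
      - s.+1%:R *: (\sum_(n < (k - 1).+1) ('C(n, 0) * 'C(k - 1 - n, s.+1))%:R *: zTn n).
  rewrite !scaler_sumr -sumrB; apply: eq_bigr => n _ /=.
  have le_n : (n <= k - 1)%N by rewrite -ltnS.
  rewrite !scalerA -scalerBl; congr (_ *: _).
  rewrite bin1 bin0 !mul1n natrM [s.+1%:R * _]mulrC binSE natrB // natrB; last by lia.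
  by rewrite ks; ring.
rewrite /zK /wsum wk wk1 !algE; ring.
Qed.

Section Image.
Variable psi : {linear Dtilde k -> R}.
Hypothesis psiZ : forall r s, (0 < r)%N -> (0 < s)%N -> (r + s = k)%N -> psi (DtZ k r s) = zv r.
Hypothesis psiP : forall r s, (0 < r)%N -> (0 < s)%N -> (r + s = k)%N -> psi (DtP k r s) = zPi r.

(** The right-hand side is evaluated by [zeta4_stuffle] and [zeta3_zK]; the
    values zK 1 s and zK 1 r that occur there are expressed by the images of the
    symbols in H_{r,s} by means of [zK_1]. *)
Lemma psi_Hdz r : odd r -> (3 <= r <= k - 3)%N ->
  psi (Hdz k r (k - r)) = zeta [:: (r - 1)%N; 1%N; (k - r - 1)%N; 1%N].
Proof.
move=> or r_k; have [s sE] : exists s, s = (k - r)%N by eexists.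
have rsk : (r + s = k)%N by lia.
have os : odd s by move: k_even; lia.
rewrite -sE; have two0 : 2%:R != 0 :> rat by [].
apply: (scalerI two0); rewrite [RHS]scaler_nat zeta4_stuffle //; [|lia..].
rewrite -linearZ_LR /= /Hdz scalerA divff // scale1r.
rewrite !linearD !linearN !linearZ_LR linear_sum /=.
rewrite !psiZ ?addn1; [|lia..].
have -> : \sum_(3 <= l < k - 2 | odd l)
      psi (('C(k - l, s)%:R - 'C(k - l, r)%:R) *: DtP k l (k - l))
    = \sum_(n < k.+1) 'C(k - n, s)%:R *: zPi n - \sum_(n < k.+1) 'C(k - n, r)%:R *: zPi n
      - ('C(k - 1, s)%:R - 'C(k - 1, r)%:R) *: zPi 1.
  transitivity (\sum_(3 <= l < k - 2) ('C(k - l, s)%:R - 'C(k - l, r)%:R) *: zPi l).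
    rewrite big_mkcond; apply: eq_big_nat => l l_k; case: ifPn => [ol|/zPi_even ->].
      by rewrite linearZ_LR /= psiP //; lia.
    by rewrite scaler0.
  rewrite -sumrB [X in _ = X - _](eq_bigr (fun n : 'I_k.+1 =>
    ('C(k - n, s)%:R - 'C(k - n, r)%:R) *: zPi n)); last by move=> n _; rewrite scalerBl.
  rewrite -(big_mkord xpredT (fun n => ('C(k - n, s)%:R - 'C(k - n, r)%:R) *: zPi n)).
  rewrite [in RHS]big_ltn // [in RHS]big_ltn; last by lia.
  rewrite [in RHS]big_ltn; last by lia.
  rewrite zPi_0 [zPi 2]zPi_even // !scaler0 !add0r [X in _ = X]addrAC subrr add0r.
  rewrite [in RHS](big_cat_nat (n := k - 2)) //=; [|lia..].
  rewrite [X in _ + X]big_nat [X in _ + X]big1 ?addr0 // => n n_k.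
  have [en|/zPi_even ->] := boolP (odd n); last by rewrite scaler0.
  by rewrite !bin_small ?subrr ?scale0r //; move: k_even or os; lia.
rewrite (_ : zz r * zz s = zPi r); last first.
  by rewrite /zPi /zPi0 ifF ?ifT -?sE //; lia.
rewrite !zeta3_zK //; try by lia.
have es : ~~ odd (s - 1) by move: os; lia.
have er : ~~ odd (r - 1) by move: or; lia.
rewrite -(signr_odd _ (s - 1)) -(signr_odd _ (r - 1)) (negbTE es) (negbTE er) !scale1r.
have -> : (s - 1 + r = k - 1)%N by lia.
have -> : (r - 1 + s = k - 1)%N by lia.
rewrite !add1n !bin1 !subn1 !prednK; [|lia..].
have srk : (s + r)%N = k by lia.
have r0 : (0 < r)%N by lia.
have s0 : (0 < s)%N by lia.
rewrite (zK_1 s0 srk) (zK_1 r0 rsk).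
have zPs : zPi s = zPi r by rewrite -zPi_sym; [congr zPi; lia|lia].
rewrite zPs (zv_stuffle r0 s0 rsk).
have zvo n : odd n -> zv n = zK 0 n.
  by move=> on; rewrite /zv -signr_odd on expr1 scaleN1r opprK zK_sym.
have zve n : ~~ odd n -> zv n = - zK 0 n.
  by move=> on; rewrite /zv -signr_odd (negbTE on) expr0 scale1r zK_sym.
rewrite [zv r]zvo // [zv s]zvo // [zv r.+1]zve ?[zv s.+1]zve /= ?negbK // natrM -!natr1.
by rewrite !algE; ring.
Qed.
End Image.

Lemma model_relation (c : 'I_(nod k) -> rat) :
  \sum_(i < nod k) c i *: Hdz k (od i) (k - od i) = 0 ->
  \sum_(i < nod k) c i *: zeta [:: (od i - 1)%N; 1%N; (k - od i - 1)%N; 1%N] = 0.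
Proof.
move=> e; have [psi [psiZ psiP]] := Dtilde_model.
have := congr1 psi e; rewrite linear0 linear_sum => e0; rewrite -[RHS]e0.
apply: eq_bigr => i _; have [o_i i_k] := andP ((odP (od i) k_ge6 k_even).2 (ex_intro _ i erefl)).
by rewrite linearZ_LR /= (psi_Hdz psiZ psiP).
Qed.
End Model.

(** * Formal finite multiple zeta values *)

Lemma Zf_class0 : Zf_class 0 = 0.
Proof. by have := Zf_classD 0 0; rewrite addr0 => /esym/(canRL (addrK _)); rewrite subrr. Qed.

Lemma Zf_class_sum I (r : seq I) (F : I -> H1) :
  Zf_class (\sum_(i <- r) F i) = \sum_(i <- r) Zf_class (F i).
Proof. exact: (big_morph Zf_class Zf_classD Zf_class0). Qed.

Lemma map_succnK (w : zword) : [seq k.-1 | k <- map succn w] = w.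
Proof. by rewrite -map_comp -[RHS]map_id; apply: eq_map. Qed.

Lemma zetaf_word (w : zword) : zetaf (map succn w) = Zf_class (wordH1 w).
Proof. by rewrite /zetaf map_succnK. Qed.

Lemma zetaf_stuffle (u v : zword) :
  zetaf (map succn u) * zetaf (map succn v) = \sum_(w <- stuffle u v) zetaf (map succn w).
Proof.
rewrite !zetaf_word -Zf_classM [wordH1 u * _]H1_mulU Zf_class_sum.
by apply: eq_bigr => w _; rewrite zetaf_word.
Qed.

Lemma zetaf_shuffle (w v : zword) :
  \sum_(u <- shuffle (xyword w) (xyword v)) zetaf (map succn (zword_of u))
  = (-1) ^+ wt w *: zetaf (map succn (rev w ++ v)).
Proof.
under eq_bigr do rewrite zetaf_word.
rewrite -Zf_class_sum zetaf_word -[RHS]Zf_class_scale; apply/Zf_class_eq/calLP.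
exists [:: (1, dshuffle_rel w v)]; last by rewrite big_seq1 mul1r.
by move=> t; rewrite inE => /eqP ->; exists w, v.
Qed.

(** The generator of the ideal for the empty second word. *)
Lemma zetaf_rev (w : zword) :
  zetaf (map succn w) = (-1) ^+ wt w *: zetaf (map succn (rev w)).
Proof.
have := zetaf_shuffle w [::]; rewrite cats0 => <-.
have -> : shuffle (xyword w) (xyword [::]) = [:: xyword w] by case: (xyword w).
by rewrite big_seq1 xywordK.
Qed.

Lemma sum_shuffle_y (V : nmodType) (F : seq bool -> V) n :
  \sum_(u <- shuffle [:: ly] (rcons (nseq n lx) ly)) F u
  = \sum_(i < n.+1) F (nseq i lx ++ ly :: rcons (nseq (n - i) lx) ly)
    + F (rcons (nseq n lx) ly ++ [:: ly]).
Proof.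
elim: n F => [|n IHn] F; first by rewrite /= !big_cons big_nil big_ord_recl big_ord0 /= !addr0.
have -> : shuffle [:: ly] (rcons (nseq n.+1 lx) ly) = (ly :: rcons (nseq n.+1 lx) ly)
    :: [seq lx :: w | w <- shuffle [:: ly] (rcons (nseq n lx) ly)] by [].
by rewrite big_cons big_map IHn [in RHS]big_ord_recl addrA.
Qed.

(** For odd n this is the reversal formula. For even n, reversal and the
    products zeta(i) zeta(n-i) = 0 show that every value of depth two and weight n
    is -zeta(n)/2, so the shuffle product of y and x^(n-2) y reads -n
    zeta(n)/2 = zeta(n)/2. *)
Lemma zetaf1 n : (0 < n)%N -> zetaf [:: n] = 0.
Proof.
elim/ltn_ind: n => n IHn n0.
have [on|en] := boolP (odd n).
  have := zetaf_rev [:: n.-1]; rewrite /wt big_seq1 /= prednK // -signr_odd on scaleN1r.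
  move=> /eqP; rewrite -addr_eq0 -mulr2n -scaler_nat scaler_eq0 /=.
  by move/eqP.
case: n n0 en IHn => [//|[//|m]] _ en IHn.
pose Z := zetaf [:: m.+2].
have depth2 i : (i <= m)%N -> zetaf [:: i.+1; (m - i).+1] = - (2%:R^-1 *: Z).
  move=> le_im; have := zetaf_stuffle [:: i] [:: (m - i)%N].
  rewrite /= !big_cons big_nil addr0 subnKC // -/Z IHn // mul0r.
  have := zetaf_rev [:: i; (m - i)%N].
  rewrite /wt !big_cons big_nil /= -signr_odd (_ : odd _ = false); last by move: en; lia.
  rewrite scale1r => <- /esym/eqP; rewrite addrA -mulr2n addr_eq0 => /eqP e.
  by apply: (scalerI (_ : 2%:R != 0 :> rat)) => //; rewrite scaler_nat e scalerN scalerA scale1r.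
have := zetaf_shuffle [:: 0%N] [:: m].
have -> : xyword [:: m] = rcons (nseq m lx) ly by rewrite /xyword /= cats0.
rewrite (_ : xyword [:: 0%N] = [:: ly]) // sum_shuffle_y /wt big_seq1 expr1 scaleN1r /=.
under eq_bigr => i _.
  have -> : nseq i lx ++ ly :: rcons (nseq (m - i) lx) ly = xyword [:: (i : nat); (m - i)%N].
    by rewrite /xyword /= cats0 cat_rcons.
  rewrite xywordK /= depth2; last by rewrite -ltnS.
  over.
have -> : rcons (nseq m lx) ly ++ [:: ly] = xyword [:: m; 0%N] by [].
rewrite xywordK /=; have /= := depth2 m (leqnn m); rewrite subnn => ->.
have /= := depth2 0%N (leq0n m); rewrite subn0 => ->.
rewrite sumr_const card_ord -mulrSr => /eqP; rewrite -subr_eq0 opprK -mulrSr.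
rewrite mulNrn oppr_eq0 -scaler_nat scalerA scaler_eq0 mulf_eq0 !Num.Theory.pnatr_eq0 /=.
by move/eqP.
Qed.

(** * Multiple harmonic sums modulo a prime *)

Lemma natF_neq0 p j : prime p -> (0 < j < p)%N -> j%:R != 0 :> 'F_p.
Proof. by move=> p_pr j_p; rewrite -(dvdn_pcharf (pchar_Fp p_pr)) gtnNdvd //; case/andP: j_p. Qed.

Section Mhs.
Variable p : nat.
Hypothesis p_pr : prime p.

(** For n = 0 this relies on the convention that the inverse of 0 is 0. *)
Lemma mhs_recr n k ks : (0 < k)%N ->
  mhs p n.+1 (k :: ks) = mhs p n (k :: ks) + n%:R ^- k * mhs p n ks.
Proof.
case: n => [|n] k0; last by rewrite /= big_nat_recr.
by rewrite /= !big_geq // expr0n gtn_eqF // invr0 mul0r addr0.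
Qed.

Let stuffle_cons (G : zword -> 'F_p) a u b v : \sum_(w <- stuffle (a :: u) (b :: v)) G w
  = \sum_(w <- stuffle u (b :: v)) G (a :: w) + (\sum_(w <- stuffle (a :: u) v) G (b :: w)
    + \sum_(w <- stuffle u v) G ((a + b).+1 :: w)).
Proof.
rewrite [stuffle (a :: u) (b :: v)](_ : _ = [seq a :: w | w <- stuffle u (b :: v)]
  ++ [seq b :: w | w <- stuffle (a :: u) v] ++ [seq (a + b).+1 :: w | w <- stuffle u v]) //.
by rewrite !big_cat !big_map.
Qed.

(** Induction on the bound n: the new largest summation index occurs in the
    first factor, in the second, or in both. *)
Lemma mhs_stuffle n (u v : zword) :
  mhs p n (map succn u) * mhs p n (map succn v)
  = \sum_(w <- stuffle u v) mhs p n (map succn w).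
Proof.
elim: n u v => [|n IHn] [|a u] [|b v]; rewrite ?[stuffle [::] _]/= ?[stuffle _ [::]]/=;
  rewrite ?big_seq1 ?mul1r ?mulr1 //.
  rewrite stuffle_cons /= big_geq // mul0r.
  by rewrite !big1 ?addr0 // => w _; rewrite /= big_geq.
have E c (s : seq zword) : \sum_(w <- s) mhs p n.+1 (map succn (c :: w)) =
   \sum_(w <- s) mhs p n (map succn (c :: w)) + n%:R ^- c.+1 * \sum_(w <- s) mhs p n (map succn w).
  rewrite mulr_sumr -big_split; apply: eq_bigr => w _.
  by rewrite [map _ _]/= mhs_recr.
have := IHn (a :: u) (b :: v); rewrite !stuffle_cons => e.
rewrite !E -!IHn ![map succn (_ :: u)]/= ![map succn (_ :: v)]/= !mhs_recr //.
rewrite mulrDl !mulrDr [X in X + _ + _]e.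
rewrite (_ : n%:R ^- (a + b).+2 = n%:R ^- a.+1 * n%:R ^- b.+1); last first.
  by rewrite -invfM -exprD addnS addSn.
set x := n%:R ^- a.+1; set y := n%:R ^- b.+1.
ring.
Qed.

(** The counterpart of [mhs] with increasing indices l < m_1 < m_2 < ... < p,
    into which the reflection m |-> p - m transforms it. *)
Fixpoint mhs_up (l : nat) (ks : seq nat) : 'F_p :=
  if ks is k :: ks' then \sum_(l.+1 <= m < p) m%:R ^- k * mhs_up m ks' else 1.

(** A nested sum split at one of its indices, the indices below it being
    summed by [mhs] and those above it by [mhs_up]. *)
Lemma mhs_split k u v :
  \sum_(1 <= m < p) m%:R ^- k * mhs p m u * mhs_up m v = mhs_up 0 (catrev u (k :: v)).
Proof.
elim: u k v => [|k' u IHu] k v.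
  by apply: eq_bigr => m _; rewrite mulr1.
rewrite [catrev _ _]/= -IHu /=.
transitivity (\sum_(1 <= m < p) \sum_(1 <= i < p | (i < m)%N)
    i%:R ^- k' * mhs p i u * (m%:R ^- k * mhs_up m v)).
  apply: eq_big_nat => m m_p; rewrite mulrAC mulrC big_distrl /=.
  rewrite (big_nat_widen _ _ p); last by lia.
  by apply: eq_bigr => i _.
rewrite (exchange_big_dep_nat xpredT) //=; apply: eq_big_nat => i i_p.
rewrite big_distrr /= (big_nat_widenl i.+1 1) //.
Qed.

Lemma mhs_mhs_up ks : mhs p p ks = mhs_up 0 (rev ks).
Proof.
case: ks => [//|k u]; rewrite /rev /= -mhs_split.
by apply: eq_bigr => m _; rewrite mulr1.
Qed.

(** The substitution m |-> p - m. *)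
Lemma mhs_upE l ks : (l <= p)%N -> mhs_up l ks = (-1) ^+ sumn ks * mhs p (p - l) ks.
Proof.
elim: ks l => [|k ks IHks] l le_lp; first by rewrite expr0 mul1r.
rewrite /= mulr_sumr [in RHS]big_nat_rev /= -[l.+1]add1n big_addn.
apply: eq_big_nat => m m_p; rewrite IHks; last by lia.
have -> : (1 + (p - l) - m.+1 = p - (m + l))%N by lia.
rewrite natrB; last by lia.
rewrite pchar_Fp_0 // sub0r (exprNn (m + l)%:R) invfM invr_sign exprD.
have sq := sqrr_sign 'F_p k; rewrite -[LHS]mul1r -[X in X * _]sq; ring.
Qed.

Lemma mhs_rev ks : mhs p p ks = (-1) ^+ sumn ks * mhs p p (rev ks).
Proof. by rewrite mhs_mhs_up mhs_upE // subn0 sumn_rev. Qed.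
End Mhs.

Section PowerSums.
Variable p : nat.
Hypothesis p_pr : prime p.

Lemma natF_expp j : (0 < j < p)%N -> j%:R ^+ (p - 1) = 1 :> 'F_p.
Proof.
move=> j_p; apply: (mulfI (natF_neq0 p_pr j_p)); rewrite -exprS mulr1.
by have := expf_card (j%:R : 'F_p); rewrite card_Fp //; have -> : (p - 1).+1 = p by lia.
Qed.

Lemma sum_natF (G : 'F_p -> 'F_p) :
  \sum_(1 <= j < p) G j%:R = \sum_(x : 'F_p | x != 0) G x.
Proof.
have Ep := Fp_cast p_pr.
rewrite -[X in \sum_(_ <= _ < X) _]Ep.
rewrite (big_nat_widenl _ 0) // big_mkord; apply: eq_big => [x|x _]; last by rewrite natr_Zp.
by rewrite -lt0n.
Qed.

(** If p - 1 does not divide N, there is g with g^N different from 1, and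
    multiplication by g permutes the nonzero elements. *)
Lemma sum_pow_natF N : \sum_(1 <= j < p) j%:R ^+ N = - (p - 1 %| N)%N%:R :> 'F_p.
Proof.
have p_gt1 := prime_gt1 p_pr; have [/dvdnP[m ->]|ndv] := boolP (p - 1 %| N)%N.
  rewrite (eq_big_nat _ _ (F2 := fun=> 1)) => [|j j_p]; last first.
    by rewrite mulnC exprM natF_expp // expr1n.
  by rewrite big_const_nat iter_addr addr0 natrB ?pchar_Fp_0 ?sub0r // ltnW.
rewrite oppr0 (sum_natF (fun x => x ^+ N)).
have p1 : (0 < p - 1)%N by lia.
pose e := (N %% (p - 1))%N; have e0 : (0 < e)%N by rewrite lt0n.
have e_p : (e < p - 1)%N by rewrite ltn_mod.
have powE x : x != 0 :> 'F_p -> x ^+ N = x ^+ e.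
  move=> x0; rewrite {1}(divn_eq N (p - 1)) exprD mulnC exprM.
  have -> : x ^+ (p - 1) = 1.
    apply: (mulfI x0); rewrite -exprS mulr1; have := expf_card x; rewrite card_Fp //.
    by have -> : (p - 1).+1 = p by lia.
  by rewrite expr1n mul1r.
have [g g0 ge] : exists2 g : 'F_p, g != 0 & g ^+ e != 1.
  have [/existsP[g /andP[g0 ge]]|/existsPn H] := boolP [exists g : 'F_p, (g != 0) && (g ^+ e != 1)].
    by exists g.
  have q0 : 'X^e - 1 != 0 :> {poly 'F_p} by rewrite -size_poly_eq0 size_XnsubC.
  have := @max_poly_roots _ _ [seq x <- enum 'F_p | x != 0] q0.
  rewrite filter_uniq ?enum_uniq // size_XnsubC // => /(_ _ isT).
  have -> : size [seq x <- enum 'F_p | x != 0] = (p - 1)%N.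
    rewrite size_filter; have := count_predC (pred1 (0 : 'F_p)) (enum 'F_p).
    rewrite (count_uniq_mem _ (enum_uniq _)) (_ : _ \in _ = true) ?mem_enum // -cardE card_Fp // => h.
    transitivity (count (predC (pred1 (0 : 'F_p))) (enum 'F_p)); first exact: eq_count.
    by rewrite -[in RHS]h add1n subn1.
  suff -> : all (root ('X^e - 1)) [seq x <- enum 'F_p | x != 0] by move=> /(_ isT); lia.
  apply/allP => x; rewrite mem_filter => /andP[x0 _]; rewrite rootE !hornerE.
  by have := H x; rewrite x0 /= negbK => /eqP ->; rewrite subrr.
suff : (g ^+ e - 1) * (\sum_(x : 'F_p | x != 0) x ^+ N) = 0.
  by move/eqP; rewrite mulf_eq0 subr_eq0 (negbTE ge) => /eqP.
rewrite mulrBl mul1r mulr_sumr; apply/eqP; rewrite subr_eq0; apply/eqP.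
rewrite [RHS](reindex_inj (mulfI g0)) /=; apply: eq_big => [x|x x0].
  by rewrite mulf_eq0 (negbTE g0).
by rewrite exprMn (powE g).
Qed.
End PowerSums.

(** * Sums of powers as polynomials *)

Lemma coefXD1 (R : comNzRingType) n i : (('X + 1 : {poly R}) ^+ n)`_i = 'C(n, i)%:R.
Proof.
rewrite addrC exprDn coef_sum.
have [le_in|lt_ni] := leqP i n; last first.
  rewrite bin_small // big1 // => j _; rewrite expr1n mul1r coefMn coefXn.
  by rewrite gtn_eqF ?mul0rn // (leq_trans (ltn_ord j)).
have lt_in : (i < n.+1)%N by rewrite ltnS.
rewrite (bigD1 (Ordinal lt_in)) //= expr1n mul1r coefMn coefXn eqxx big1 ?addr0 // => j ne_j.
rewrite expr1n mul1r coefMn coefXn; suff /negbTE -> : i != j by rewrite mul0rn.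
by apply: contraNneq ne_j => e; apply/eqP/val_inj.
Qed.

Section PowerPolynomials.
Variable p : nat.
Hypothesis p_pr : prime p.

(** The leading term c X^e of q is that of the difference of c / (e+1)
    X^(e+1), where e + 1 < p is invertible; this removes it from q. *)
Lemma antidifference d (q : {poly 'F_p}) : (d < p)%N -> (size q <= d)%N ->
  exists Q : {poly 'F_p}, [/\ (size Q <= d.+1)%N, Q \Po ('X + 1) - Q = q & Q.[0] = 0].
Proof.
elim: d q => [|d IHd] q lt_dp sq.
  exists 0; rewrite comp_poly0 subrr size_poly0 horner0; split => //.
  by move: sq; rewrite size_poly_leq0 => /eqP.
have d0 : d.+1%:R != 0 :> 'F_p by apply: natF_neq0.
pose c := q`_d / d.+1%:R; pose P : {poly 'F_p} := c *: 'X^(d.+1).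
have DP : P \Po ('X + 1) - P = c *: (('X + 1) ^+ d.+1 - 'X^(d.+1)).
  by rewrite scalerBr /P comp_polyZ comp_Xn_poly.
have [||Q [sQ DQ Q0]] := IHd (q - (P \Po ('X + 1) - P)); first exact: ltnW.
  apply/leq_sizeP => i le_di; rewrite DP coefB coefZ coefB coefXD1 coefXn.
  move: le_di; rewrite leq_eqVlt => /orP[/eqP <-|lt_di].
    by rewrite binSn ltn_eqF // subr0 /c divfK ?subrr.
  rewrite (leq_sizeP _ _ sq) //; move: lt_di; rewrite leq_eqVlt => /orP[/eqP <-|lt_di].
    by rewrite binn eqxx subrr mulr0 subr0.
  by rewrite bin_small // gtn_eqF // subr0 mulr0 subr0.
exists (Q + P); split.
- apply: leq_trans (size_polyD _ _) _; rewrite geq_max (leq_trans sQ) //=.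
  by apply: leq_trans (size_scale_leq _ _) _; rewrite size_polyXn.
- by rewrite comp_polyD opprD addrACA DQ subrK.
- by rewrite hornerD Q0 /P hornerZ hornerXn expr0n mulr0 addr0.
Qed.

(** D takes the same value at all p elements of F_p, which are more than its
    degree. *)
Lemma periodic_const (D : {poly 'F_p}) : (size D <= p)%N -> D \Po ('X + 1) = D ->
  forall e, (0 < e)%N -> D`_e = 0.
Proof.
move=> sD perD.
have Dnat j : D.[j%:R] = D.[0].
  elim: j => // j <-; by rewrite -[in RHS]perD horner_comp !hornerE natr1.
have D0 : D - D.[0]%:P = 0.
  apply/eqP/negPn/negP => ne0.
  have := @max_poly_roots _ _ (enum 'F_p) ne0.
  rewrite enum_uniq -cardE card_Fp // => /(_ _ isT).
  suff -> : all (root (D - D.[0]%:P)) (enum 'F_p).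
    move=> /(_ isT); apply/negP; rewrite -leqNgt.
    apply: leq_trans (size_polyD _ _) _; rewrite geq_max sD size_polyN.
    by rewrite (leq_trans (size_polyC_leq1 _)) // ltnW // prime_gt1.
  apply/allP => x _; rewrite rootE !hornerE -[x in D.[x]](natr_Zp x) Dnat subrr //.
by move=> [//|e] _; rewrite -[D](subrK D.[0]%:P) D0 add0r coefC.
Qed.

(** The values of such a polynomial at j are the sums of i^-m over 0 < i < j
    ([power_sum_polyE]), because i^(p-1-m) = i^-m. *)
Definition power_sum_poly (m : nat) (Q : {poly 'F_p}) :=
  [/\ (size Q <= p)%N, Q \Po ('X + 1) - Q = 'X^(p - 1 - m) & Q.[0] = 0].

Lemma power_sum_poly_exists m : (0 < m < p)%N -> exists Q, power_sum_poly m Q.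
Proof.
move=> m_p; have [||Q [sQ DQ Q0]] := @antidifference (p - m) ('X^(p - 1 - m)).
- by lia.
- by rewrite size_polyXn; lia.
by exists Q; split => //; lia.
Qed.

Lemma power_sum_polyE m Q j : (0 < m < p - 1)%N -> power_sum_poly m Q -> (j <= p)%N ->
  Q.[j%:R] = mhs p j [:: m].
Proof.
move=> m_p [_ DQ Q0]; elim: j => [|j IHj] lt_jp; first by rewrite /= big_geq.
rewrite mhs_recr; last by lia.
rewrite -IHj ?(ltnW lt_jp) //= mulr1; apply/eqP; rewrite addrC -subr_eq; apply/eqP.
have := congr1 (fun P => P.[j%:R]) DQ; rewrite !hornerE horner_comp !hornerE natr1 => ->.
case: j lt_jp {IHj} => [|j] lt_jp.
  by rewrite !expr0n !gtn_eqF ?invr0 //; lia.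
have j0 := natF_neq0 p_pr (ltac:(lia) : (0 < j.+1 < p)%N).
apply: (mulIf (expf_neq0 m j0)); rewrite -exprD mulVf ?expf_neq0 //.
by rewrite subnK ?natF_expp //; lia.
Qed.

(** The derivative of Q_m and -(m+1) Q_{m+1} have the same difference, so they
    differ by a constant ([periodic_const]). This determines all coefficients from
    those of Q_1. *)
Lemma power_sum_poly_coef Q1 m : power_sum_poly 1 Q1 -> (0 < m < p - 1)%N ->
  exists2 Q, power_sum_poly m Q & forall e, (0 < e)%N ->
    Q`_e * m%:R = (-1) ^+ m.-1 * 'C(e + m.-1, m.-1)%:R * Q1`_(e + m.-1).
Proof.
move=> PQ1; elim: m => // -[_ _|m IHm m_p].
  by exists Q1 => // e _; rewrite /= expr0 addn0 bin0 !mul1r mulr1.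
have [|Q [sQ DQ Q0] coQ] := IHm; first by lia.
have [Q' [sQ' DQ' Q0']] := @power_sum_poly_exists m.+2 ltac:(lia).
exists Q' => // e e0.
have coD : (e.+1)%:R * Q`_e.+1 = - (m.+2%:R * Q'`_e).
  apply/eqP; rewrite -addr_eq0; apply/eqP.
  pose D := Q^`() + m.+2%:R *: Q'.
  have <- : D`_e = e.+1%:R * Q`_e.+1 + m.+2%:R * Q'`_e.
    by rewrite coefD coefZ coef_deriv -[_ *+ e.+1]mulr_natl.
  apply: periodic_const => //.
    apply: leq_trans (size_polyD _ _) _; rewrite geq_max.
    rewrite (leq_trans (size_scale_leq _ _)) // andbT.
    by apply/leq_sizeP => i p_i; rewrite coef_deriv (leq_sizeP _ _ sQ) ?mul0rn // leqW.
  apply/eqP; rewrite -subr_eq0 /D comp_polyD comp_polyZ opprD addrACA -scalerBr DQ'.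
  have := congr1 (@deriv _) DQ; rewrite derivB deriv_comp derivD derivX derivC addr0 mulr1 => ->.
  rewrite derivXn -scaler_nat.
  have -> : (p - 1 - m.+1).-1 = (p - 1 - m.+2)%N by lia.
  rewrite -scalerDl -natrD (_ : _ + _ = p)%N; last by lia.
  by rewrite pchar_Fp_0 // scale0r.
have m0 : m.+1%:R != 0 :> 'F_p by apply: natF_neq0 => //; lia.
apply: (mulfI m0); rewrite [Q'`_e * _]mulrC -[_ * Q'`_e]opprK -coD.
have := coQ e.+1 isT; rewrite /= addSnnS => coQe.
have binE : m.+1%:R * 'C(e + m.+1, m.+1)%:R = e.+1%:R * 'C(e + m.+1, m)%:R :> 'F_p.
  by rewrite -!natrM mul_bin_left addnS subSn ?leq_addl // addnK.
rewrite exprS mulN1r mulrN !mulNr mulrN; congr (- _).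
transitivity ((-1) ^+ m * (m.+1%:R * 'C(e + m.+1, m.+1)%:R) * Q1`_(e + m.+1)); last by ring.
by rewrite binE mulrCA [m.+1%:R * _]mulrC coQe; ring.
Qed.
End PowerPolynomials.

(** * The depth three formula modulo a prime *)

Section DepthTwo.
Variable p : nat.
Hypothesis p_pr : prime p.

Lemma sum_pow_div e b : (b <= p - 1)%N ->
  \sum_(1 <= j < p) j%:R ^+ e / j%:R ^+ b = - (p - 1 %| e + (p - 1 - b))%N%:R :> 'F_p.
Proof.
move=> b_p; rewrite -sum_pow_natF //; apply: eq_big_nat => j j_p.
have j0 : j%:R ^+ b != 0 :> 'F_p by rewrite expf_neq0 // natF_neq0.
by apply: (mulIf j0); rewrite divfK // -exprD -addnA subnK // exprD natF_expp // mulr1.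
Qed.

Lemma mhs1_eq0 n : (0 < n < p - 1)%N -> mhs p p [:: n] = 0.
Proof.
move=> n_p; rewrite /=; transitivity (- (p - 1 %| 0 + (p - 1 - n))%N%:R : 'F_p).
  rewrite -sum_pow_div; [by apply: eq_bigr => j _; rewrite expr0 mul1r mulr1 | lia].
by rewrite gtnNdvd ?oppr0 //; lia.
Qed.

(** In even weight the value equals its reversal, and by the stuffle product
    the sum of the two is zero. *)
Lemma mhs2_even r : (0 < r)%N -> (r.+2 < p)%N -> odd r -> mhs p p [:: r; 1%N] = 0.
Proof.
case: r => // r _ r_p or.
have := mhs_stuffle p p [:: r] [:: 0%N]; rewrite [LHS]/= -![\sum_(_ <= _ < _) _]/(mhs p p [:: _]).
rewrite !mhs1_eq0; [|lia..]; rewrite mul0r !big_cons big_nil addr0 ![map _ _]/=.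
rewrite [mhs _ _ [:: (r + 0).+2]]mhs1_eq0 ?addr0; [|lia..].
rewrite [mhs p p [:: 1%N; r.+1]]mhs_rev // [rev _]/= [sumn _]/= addn0 -signr_odd (_ : odd _ = false); last by lia.
rewrite expr0 mul1r -mulr2n -mulr_natl => /esym/eqP; rewrite mulf_eq0.
have two : 2%:R != 0 :> 'F_p by apply: natF_neq0 => //; lia.
by rewrite (negbTE two) => /eqP.
Qed.

Variable Q1 : {poly 'F_p}.
Hypothesis PQ1 : power_sum_poly 1 Q1.

(** For 0 < e < p, the sum of j^(e-r) over all j is zero unless e = r. *)
Lemma mhs2_coef r : (0 < r)%N -> (r < p - 1)%N -> mhs p p [:: r; 1%N] = - Q1`_r.
Proof.
move=> r0 r_p; have [sQ _ Q0] := PQ1.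
have Q1_0 : Q1`_0 = 0 by rewrite -horner_coef0.
transitivity (\sum_(1 <= j < p) \sum_(e < p) Q1`_e * (j%:R ^+ e / j%:R ^+ r)).
  rewrite [LHS]/=; apply: eq_big_nat => j j_p.
  rewrite -[\sum_(_ <= _ < _) _]/(mhs p j [:: 1%N]) -(power_sum_polyE p_pr _ PQ1) //; [|lia..].
  rewrite (horner_coef_wide _ sQ) mulr_sumr; apply: eq_bigr => e _.
  by rewrite mulrC mulrA.
rewrite exchange_big /=; have lt_r : (r < p)%N by lia.
have b_p : (r <= p - 1)%N by lia.
under eq_bigr => e _ do rewrite -mulr_sumr sum_pow_div //.
rewrite (bigD1 (Ordinal lt_r)) //= subnKC ?dvdnn ?mulrN1; last by lia.
rewrite big1 ?addr0 // => -[[|e] lt_e] ne_e /=; first by rewrite Q1_0 mul0r.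
suff /negbTE -> : ~~ (p - 1 %| e.+1 + (p - 1 - r))%N by rewrite oppr0 mulr0.
have {}ne_e : e.+1 != r by apply: contraNneq ne_e => e_r; apply/eqP/val_inj.
apply/negP => /dvdnP[[|[|m]] dv]; [lia|lia|].
have : (2 * (p - 1) <= m.+2 * (p - 1))%N by rewrite leq_mul2r orbT.
by rewrite -dv; lia.
Qed.

Lemma bin_p_eq1 b : (b < p)%N -> 'C(p + b, b)%:R = 1 :> 'F_p.
Proof.
move=> b_p; rewrite -binomial.Vandermonde natr_sum big_ord_recl /= bin0 subn0 binn mul1n big1 ?addr0 // => i _.
have : (p %| 'C(p, bump 0 i))%N by rewrite prime_dvd_bin //; have := ltn_ord i; rewrite /bump; lia.
by rewrite natrM (dvdn_pcharf (pchar_Fp p_pr)) => /eqP ->; rewrite mul0r.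
Qed.

End DepthTwo.

Section DepthThree.
Variables (p k : nat).
Hypothesis p_pr : prime p.
Hypothesis k_ge6 : (6 <= k)%N.
Hypothesis k_even : ~~ odd k.
Hypothesis k_p : (k.*2 < p)%N.

Variable Q1 : {poly 'F_p}.
Hypothesis PQ1 : power_sum_poly 1 Q1.
Let q rho := Q1`_(rho - 1).

Let q_big rho : (p < rho)%N -> q rho = 0.
Proof. by move=> p_rho; have [sQ _ _] := PQ1; apply: (leq_sizeP _ _ sQ); lia. Qed.

Let term (a c rho sigma : nat) : 'F_p :=
  (-1) ^+ rho * ('C(rho - 1, a - 1) * 'C(sigma - 1, c - 1))%:R * (q rho * q sigma).

(** The terms where the sum of the two exponents exceeds b by p - 1, so that
    rho and sigma add up to k + p - 1 instead of k. *)
Let long (a c : nat) : 'F_p :=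
  \sum_(k - 1 <= rho < p.+1) term a c rho (k + p - 1 - rho).

(** Fix the middle summation index j. The sums over the other two are values
    of Q_c at j and of Q_a at p - j = -j. When both polynomials are expanded, the
    sum over j leaves the terms X^e and X^f with e + f congruent to b modulo
    p - 1, that is e + f = b or e + f = b + p - 1. *)
Lemma mhs3_terms a b c : (0 < a)%N -> (0 < b)%N -> (0 < c)%N -> (a + b + c = k)%N ->
  (a * c)%:R * mhs p p [:: a; b; c] = - ((-1) ^+ (a + c) *
    (\sum_(1 <= i < b) term a c (a + i) (b + c - i) + long a c)).
Proof.
move=> a0 b0 c0 abc; have [Qa PQa coQa] := power_sum_poly_coef p_pr PQ1 (ltac:(lia) : (0 < a < p - 1)%N).
have [Qc PQc coQc] := power_sum_poly_coef p_pr PQ1 (ltac:(lia) : (0 < c < p - 1)%N).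
have [sQa _ Qa0] := PQa; have [sQc _ Qc0] := PQc.
have {}Qa0 : Qa`_0 = 0 by rewrite -horner_coef0.
have {}Qc0 : Qc`_0 = 0 by rewrite -horner_coef0.
have E1 : mhs p p [:: a; b; c] = \sum_(1 <= j < p)
    j%:R ^- b * Qc.[j%:R] * ((-1) ^+ a * Qa.[- j%:R]).
  transitivity (mhs_up p 0 (catrev [:: c] [:: b; a])); first exact: mhs_mhs_up.
  rewrite -mhs_split //.
  apply: eq_big_nat => j j_p; rewrite (power_sum_polyE p_pr _ PQc) //; [|lia..].
  congr (_ * _); rewrite mhs_upE //; last by lia.
  rewrite /= addn0 -[\sum_(_ <= _ < _) _]/(mhs p (p - j) [:: a]); congr (_ * _).
  by rewrite -(power_sum_polyE p_pr _ PQa) ?natrB ?pchar_Fp_0 ?sub0r //; lia.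
have E2 : mhs p p [:: a; b; c] = - ((-1) ^+ a * \sum_(e < p) \sum_(f < p)
    (p - 1 %| e + f + (p - 1 - b))%N%:R * ((-1) ^+ e * Qa`_e * Qc`_f)).
  rewrite E1; transitivity (\sum_(1 <= j < p) \sum_(e < p) \sum_(f < p)
      (-1) ^+ a * ((-1) ^+ e * Qa`_e * Qc`_f) * (j%:R ^+ (e + f) / j%:R ^+ b)).
    apply: eq_big_nat => j j_p.
    rewrite (horner_coef_wide _ sQa) (horner_coef_wide _ sQc) !mulr_sumr.
    apply: eq_bigr => e _; rewrite mulr_suml; apply: eq_bigr => f _.
    rewrite exprD (exprNn j%:R); ring.
  rewrite exchange_big mulr_sumr -sumrN; apply: eq_bigr => e _.
  rewrite exchange_big mulr_sumr -sumrN; apply: eq_bigr => f _ /=.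
  rewrite -mulr_sumr sum_pow_div //; last by lia.
  by ring.
have gE e f : (0 < e)%N -> (0 < f)%N ->
    (a * c)%:R * ((-1) ^+ a * ((-1) ^+ e * Qa`_e * Qc`_f))
    = (-1) ^+ (a + c) * term a c (a + e) (c + f).
  move=> e0 f0; have ea := coQa e e0; have ec := coQc f f0.
  transitivity ((-1) ^+ a * (-1) ^+ e * (Qa`_e * a%:R) * (Qc`_f * c%:R)).
    by rewrite natrM; ring.
  rewrite ea ec /term /q.
  have -> : (a + e - 1 = e + a.-1)%N by lia.
  have -> : (c + f - 1 = f + c.-1)%N by lia.
  rewrite !subn1 natrM !exprD -[in RHS](prednK a0) -[in RHS](prednK c0) /= !exprS.
  rewrite -{1}(prednK a0) exprS.
  by ring.
have g0 e f : (e == 0)%N || (f == 0)%N ->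
    (a * c)%:R * ((-1) ^+ a * ((-1) ^+ e * Qa`_e * Qc`_f)) = 0.
  by case/orP => /eqP ->; rewrite ?Qa0 ?Qc0; ring.
pose g e f := (a * c)%:R * ((-1) ^+ a * ((-1) ^+ e * Qa`_e * Qc`_f)).
have E3 : (a * c)%:R * mhs p p [:: a; b; c] = - (\sum_(1 <= e < b) g e (b - e)%N
    + \sum_(b <= e < p) g e (b + p - 1 - e)%N).
  rewrite E2 mulrN !mulr_sumr; congr (- _).
  rewrite -(big_mkord xpredT (fun e => (a * c)%:R * ((-1) ^+ a * \sum_(f < p)
    (p - 1 %| e + f + (p - 1 - b))%N%:R * ((-1) ^+ e * Qa`_e * Qc`_f)))).
  (* For each e exactly one f survives; it is b - e if e < b, and b + p - 1 - e
     otherwise. *)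
  have pick e f0 : (0 < e)%N -> (f0 < p)%N ->
      (forall f, (0 < f < p)%N -> (p - 1 %| e + f + (p - 1 - b))%N = (f == f0)) ->
      (a * c)%:R * ((-1) ^+ a * \sum_(f < p)
        (p - 1 %| e + f + (p - 1 - b))%N%:R * ((-1) ^+ e * Qa`_e * Qc`_f)) = g e f0.
    move=> e0 f0_p dvE; rewrite !mulr_sumr (bigD1 (Ordinal f0_p)) //= big1 ?addr0 => [|f ne_f].
      have [f00|f00] := posnP f0; first by rewrite f00 Qc0 !mulr0 /g Qc0 !mulr0.
      by rewrite dvE ?f00 // eqxx mul1r.
    have [f00|f00] := posnP f; first by rewrite f00 Qc0 !mulr0.
    rewrite dvE ?f00 ?ltn_ord // (_ : (f == f0 :> nat) = false) ?mul0r ?mulr0 //.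
    by apply: contraNF ne_f => /eqP e_f; apply/eqP/val_inj.
  rewrite big_ltn ?prime_gt0 // Qa0.
  rewrite big1 => [|f _]; last by rewrite mulr0 mul0r mulr0.
  rewrite !mulr0 add0r (big_cat_nat (n := b)) //=; last by lia.
  have dvE e f : (0 < e < p)%N -> (0 < f < p)%N -> (p - 1 %| e + f + (p - 1 - b))%N
      = (e + f == b)%N || (e + f == b + p - 1)%N.
    move=> e_p f_p; apply/idP/orP.
      move=> /dvdnP[[|[|[|m]]] dv]; [lia|lia|right; lia|].
      have : (3 * (p - 1) <= m.+3 * (p - 1))%N by rewrite leq_mul2r orbT.
      by rewrite -dv; lia.
    case=> /eqP e_f.
      by rewrite e_f addnC subnK //; lia.
    rewrite (_ : e + f + (p - 1 - b) = 2 * (p - 1))%N ?dvdn_mull //; lia.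
  congr (_ + _); apply: eq_big_nat => e e_b; apply: pick; try lia.
    by move=> f f_p; rewrite dvE //; lia.
  by move=> f f_p; rewrite dvE //; lia.
rewrite E3; congr (- _); rewrite mulrDr mulr_sumr; congr (_ + _).
  apply: eq_big_nat => e e_b; rewrite /g gE; [|lia..].
  by congr (_ * term _ _ _ _); lia.
pose G rho := term a c rho (k + p - 1 - rho).
transitivity ((-1) ^+ (a + c) * \sum_(a + b <= rho < a + p) G rho).
  rewrite mulr_sumr [(a + b)%N]addnC big_addn addKn.
  apply: eq_big_nat => e e_b; rewrite /g gE; [|lia..].
  by rewrite /G [(e + a)%N]addnC; congr (_ * term _ _ _ _); lia.
congr (_ * _); rewrite (big_cat_nat (n := k - 1)) //=; [|lia..].
rewrite big_nat big1 => [|rho rho_k]; last first.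
  by rewrite /G /term [q (k + p - 1 - rho)]q_big ?mulr0 //; lia.
rewrite add0r (big_cat_nat (n := p.+1)) //=; [|lia..].
rewrite [X in _ + X]big_nat [X in _ + X]big1 ?addr0 // => rho rho_p.
by rewrite /G /term [q rho]q_big ?mul0r ?mulr0 //; lia.
Qed.

(** Both sides are combinations of the same products q(rho) q(sigma). The
    equality of the coefficients is Vandermonde's identity, together with
    C(p + b - 1, b - 1) = 1 modulo p. *)
Lemma long_split a b c : (0 < a)%N -> (0 < b)%N -> (0 < c)%N -> (a + b + c = k)%N ->
  long a c = \sum_(1 <= n < k - 1)
    ('C(n - 1, a - 1) * 'C(k - 1 - n - 1, c - 1))%:R * long n (k - 1 - n).
Proof.
move=> a0 b0 c0 abc; under eq_bigr => n _ do rewrite mulr_sumr.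
rewrite exchange_big_nat /=; apply: eq_big_nat => rho rho_k.
set sigma := (k + p - 1 - rho)%N.
transitivity ((-1) ^+ rho * (q rho * q sigma) * (\sum_(1 <= n < k - 1)
   ('C(n - 1, a - 1) * 'C(k - 1 - n - 1, c - 1)
    * ('C(rho - 1, n - 1) * 'C(sigma - 1, k - 1 - n - 1)))%:R)); last first.
  by rewrite mulr_sumr; apply: eq_bigr => n _; rewrite /term !natrM; ring.
rewrite -natr_sum; have -> : (\sum_(1 <= n < k - 1)
   ('C(n - 1, a - 1) * 'C(k - 1 - n - 1, c - 1)
    * ('C(rho - 1, n - 1) * 'C(sigma - 1, k - 1 - n - 1)))
  = 'C(rho - 1, a - 1) * 'C(sigma - 1, c - 1) * 'C(p + (b - 1), b - 1))%N.
  rewrite (big_cat_nat (n := a)) //=; last by lia.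
  rewrite big_nat big1 => [|n n_a]; last by rewrite ['C(n - 1, a - 1)]bin_small //; lia.
  rewrite add0n (big_cat_nat (n := a + b)) //=; [|lia..].
  rewrite [X in (_ + X)%N]big_nat [X in (_ + X)%N]big1 => [|n n_a]; last first.
    by rewrite ['C(k - 1 - n - 1, c - 1)]bin_small ?muln0 //; lia.
  rewrite addn0 [(a + b)%N]addnC -{1}[a]add0n big_addn addnK.
  have -> : (p + (b - 1) = (rho - a) + (sigma - c))%N by rewrite /sigma; lia.
  have eb : b = (b - 1).+1 by lia.
  rewrite -binomial.Vandermonde [X in \sum_(_ <= _ < X) _ = _]eb big_mkord big_distrr /=; apply: eq_bigr => i _.
  have i_b : (i <= b - 1)%N by rewrite -ltnS.
  have e1 := @bin_mul_bin (rho - 1) i (a - 1) ltac:(lia).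
  have e2 := @bin_mul_bin (sigma - 1) (b - 1 - i) (c - 1) ltac:(rewrite /sigma; lia).
  have -> : (i + a - 1 = i + (a - 1))%N by lia.
  have -> : (k - 1 - (i + a) - 1 = b - 1 - i + (c - 1))%N by lia.
  have f1 : (rho - 1 - (a - 1) = rho - a)%N by lia.
  have f2 : (sigma - 1 - (c - 1) = sigma - c)%N by rewrite /sigma; lia.
  rewrite f1 in e1; rewrite f2 in e2.
  transitivity (('C(rho - 1, i + (a - 1)) * 'C(i + (a - 1), a - 1)) *
    ('C(sigma - 1, b - 1 - i + (c - 1)) * 'C(b - 1 - i + (c - 1), c - 1)))%N; first by ring.
  by rewrite e1 e2; ring.
rewrite natrM (bin_p_eq1 p_pr); last by lia.
by rewrite mulr1 /term; ring.
Qed.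

(** For b = 1 only [long] occurs in [mhs3_terms], so [long_split] expresses
    [long a c] by the values with index (n,1,k-1-n). The factor a c keeps the
    coefficients integral. *)
Lemma mhs3 a b c : (0 < a)%N -> (0 < b)%N -> (0 < c)%N -> (a + b + c = k)%N ->
  (a * c)%:R * mhs p p [:: a; b; c] =
    (-1) ^+ (b - 1) * (\sum_(1 <= n < k - 1)
      ('C(n - 1, a - 1) * 'C(k - 1 - n - 1, c - 1) * (n * (k - 1 - n)))%:R
        * mhs p p [:: n; 1%N; (k - 1 - n)%N])
    + (-1) ^+ (a + c) * (\sum_(1 <= i < b)
      ('C(a + i - 1, a - 1) * 'C(b + c - i - 1, c - 1))%:R
        * (mhs p p [:: (a + i - 1)%N; 1%N] * mhs p p [:: (b + c - i - 1)%N; 1%N])).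
Proof.
move=> a0 b0 c0 abc; rewrite (mhs3_terms a0 b0 c0 abc) mulrDr opprD addrC.
rewrite (long_split a0 b0 c0 abc); congr (_ + _).
  rewrite -mulNr; have -> : - (-1) ^+ (a + c) = (-1) ^+ (b - 1) :> 'F_p.
    rewrite -[X in - X]signr_odd -[RHS]signr_odd (_ : odd (a + c) = ~~ odd (b - 1)).
      by case: odd; rewrite /= ?expr0 ?expr1 ?opprK.
    by move: k_even; lia.
  congr (_ * _); apply: eq_big_nat => n n_k; rewrite [in RHS]natrM -[RHS]mulrA; congr (_ * _).
  rewrite mhs3_terms //; [|lia..]; rewrite big_geq // add0r.
  rewrite -signr_odd (_ : odd _ = true) ?mulN1r ?opprK //.
  by move: k_even; lia.
rewrite -mulrN -sumrN; congr (_ * _); apply: eq_big_nat => i i_b; rewrite /term.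
have [er|or] := boolP (odd (a + i)).
  rewrite -signr_odd er expr1 mulN1r mulNr opprK; congr (_ * _).
  by rewrite !(mhs2_coef p_pr PQ1) ?mulrNN //; lia.
rewrite [mhs p p [:: (a + i - 1)%N; _]](mhs2_even p_pr); [|lia..]; rewrite mul0r mulr0.
have : mhs p p [:: (a + i - 1)%N; 1%N] = - q (a + i).
  by rewrite (mhs2_coef p_pr PQ1) //; lia.
rewrite (mhs2_even p_pr); [|lia..] => /esym/eqP; rewrite oppr_eq0 => /eqP ->.
by rewrite mul0r mulr0 oppr0.
Qed.
End DepthThree.

(** * Finite multiple zeta values *)

Lemma calA_class0 : calA_class 0 = 0.
Proof. by have := calA_classD 0 0; rewrite addr0 => /esym/(canRL (addrK _)); rewrite subrr. Qed.

Lemma calA_class_sum I (r : seq I) (P : pred I) (F : I -> prodF) :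
  \sum_(i <- r | P i) calA_class (F i) = calA_class (fun p => \sum_(i <- r | P i) F i p).
Proof.
elim: r => [|i r IHr].
  rewrite big_nil -calA_class0; apply: (@calA_class_bound _ _ 0) => p _.
  by rewrite big_nil.
rewrite big_cons IHr; case: ifP => Pi.
  rewrite -calA_classD; apply: (@calA_class_bound _ _ 0) => p _.
  by rewrite big_cons Pi.
by apply: (@calA_class_bound _ _ 0) => p _; rewrite big_cons Pi.
Qed.

Lemma calA_class_mulrn n (f : prodF) :
  n%:R * calA_class f = calA_class (fun p => n%:R * f p).
Proof.
rewrite mulr_natl -[n in LHS]card_ord -sumr_const calA_class_sum.
apply: (@calA_class_bound _ _ 0) => p _.
by rewrite sumr_const card_ord mulr_natl.
Qed.

Lemma calA_class_sign n (f : prodF) :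
  (-1) ^+ n * calA_class f = calA_class (fun p => (-1) ^+ n * f p).
Proof.
rewrite -signr_odd; case on: (odd n).
  rewrite expr1 mulN1r; apply/eqP; rewrite eq_sym -addr_eq0 -calA_classD -calA_class0.
  apply/eqP/(@calA_class_bound _ _ 0) => p _.
  by rewrite -[LHS]/((-1) ^+ n * f p + f p) -signr_odd on expr1 mulN1r addNr.
rewrite expr0 mul1r; apply: (@calA_class_bound _ _ 0) => p _.
by rewrite -signr_odd on mul1r.
Qed.

Lemma calA_classMf (f g : prodF) : calA_class f * calA_class g = calA_class (fun p => f p * g p).
Proof. by rewrite -calA_classM. Qed.

Lemma calA_classDf (f g : prodF) : calA_class f + calA_class g = calA_class (fun p => f p + g p).
Proof. by rewrite -calA_classD. Qed.

Lemma zetaA_stuffle (u v : zword) :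
  zetaA (map succn u) * zetaA (map succn v) = \sum_(w <- stuffle u v) zetaA (map succn w).
Proof.
rewrite calA_classMf calA_class_sum; apply: (@calA_class_bound _ _ 0) => p _.
exact: mhs_stuffle.
Qed.

Lemma sumn_succ (w : zword) : sumn (map succn w) = wt w.
Proof. by rewrite sumnE big_map. Qed.

Lemma zetaA_rev (w : zword) :
  zetaA (map succn w) = (-1) ^+ wt w *: zetaA (map succn (rev w)).
Proof.
rewrite -sign_scale calA_class_sign; apply: (@calA_class_bound _ _ 0) => p _.
by rewrite mhs_rev ?(valP p) // sumn_succ map_rev.
Qed.

Lemma zetaA1 n : (0 < n)%N -> zetaA [:: n] = 0.
Proof.
move=> n0; rewrite -calA_class0; apply: (@calA_class_bound _ _ n.+1) => -[p p_pr] /= n_p.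
by apply: mhs1_eq0 => //; lia.
Qed.

(** This is [mhs3] for the primes p > 2 k, divided by a c. *)
Lemma zetaA3 k a b c : (6 <= k)%N -> ~~ odd k ->
  (0 < a)%N -> (0 < b)%N -> (0 < c)%N -> (a + b + c = k)%N ->
  zetaA [:: a; b; c] =
    (-1) ^+ (b - 1) *
      \sum_(1 <= n < k - 1)
         ('C(n, a) * 'C(k - 1 - n, c))%:R * zetaA [:: n; 1%N; (k - 1 - n)%N]
    + (-1) ^+ (a + c) *
      \sum_(1 <= i < b)
         ('C(a + i, a) * 'C(b + c - i, c))%:R * (zz zetaA (a + i) * zz zetaA (b + c - i)).
Proof.
move=> k6 ek a0 b0 c0 abc.
have ac0 : (a * c)%:R != 0 :> rat by rewrite Num.Theory.pnatr_eq0 muln_eq0; lia.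
apply: (scalerI ac0); rewrite scalerDr !scalerAr !scaler_sumr.
have binE n a' : (0 < a')%N -> (0 < n)%N -> a'%:R * 'C(n, a')%:R = n%:R * 'C(n - 1, a' - 1)%:R :> rat.
  case: n a' => [|n] [|a'] // _ _.
  by rewrite -!natrM -mul_bin_diag !subn1.
have -> : \sum_(1 <= n < k - 1) (a * c)%:R *: (('C(n, a) * 'C(k - 1 - n, c))%:R
      * zetaA [:: n; 1%N; (k - 1 - n)%N])
    = \sum_(1 <= n < k - 1) ('C(n - 1, a - 1) * 'C(k - 1 - n - 1, c - 1) * (n * (k - 1 - n)))%:R
      * zetaA [:: n; 1%N; (k - 1 - n)%N].
  apply: eq_big_nat => n n_k; rewrite !natr_scale scalerA; congr (_ *: _).
  rewrite !natrM mulrACA !binE //; [|lia..].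
  by ring.
have -> : \sum_(1 <= i < b) (a * c)%:R *: (('C(a + i, a) * 'C(b + c - i, c))%:R
      * (zz zetaA (a + i) * zz zetaA (b + c - i)))
    = \sum_(1 <= i < b) ('C(a + i - 1, a - 1) * 'C(b + c - i - 1, c - 1))%:R
      * (zetaA [:: (a + i - 1)%N; 1%N] * zetaA [:: (b + c - i - 1)%N; 1%N]).
  apply: eq_big_nat => i i_b; rewrite /zz !ifF; [|lia..].
  rewrite !natr_scale -scalerAl -scalerAr !scalerA; congr (_ *: _).
  have ai0 : (a + i)%:R != 0 :> rat by rewrite Num.Theory.pnatr_eq0; lia.
  have bc0 : (b + c - i)%:R != 0 :> rat by rewrite Num.Theory.pnatr_eq0; lia.
  rewrite !natrM mulrACA [c%:R * _]binE ?[a%:R * _]binE //; [|lia..].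
  by field; rewrite -?natrD ?ai0 ?bc0.
rewrite -natr_scale calA_class_mulrn.
under eq_bigr => n _ do rewrite calA_class_mulrn.
under [X in _ = _ + _ * X]eq_bigr => n _ do rewrite calA_classMf calA_class_mulrn.
rewrite !calA_class_sum !calA_class_sign calA_classDf.
apply: (@calA_class_bound _ _ k.*2) => -[p p_pr] /= k_p.
have [Q1 PQ1] := power_sum_poly_exists p_pr (ltac:(lia) : (0 < 1 < p)%N).
exact: (mhs3 p_pr k6 ek k_p PQ1 a0 b0 c0 abc).
Qed.

(** * Relations from even period polynomials *)

Theorem theorem5p17 (k : nat) (k_ge6 : (6 <= k)%N) (k_even : ~~ odd k) :
  (forall p : QXY, Weven k p ->
     \sum_(i < nod k) chat p i *: Hdz k (od i) (k - od i) = 0 :> Dtilde k)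
  /\
  (forall p : QXY, Weven k p ->
     \sum_(i < nod k)
        chat p i *: zetaA [:: (od i - 1)%N; 1%N; (k - od i - 1)%N; 1%N] = 0 :> calA)
  /\
  ((forall a b c : nat, (0 < a)%N -> (0 < b)%N -> (0 < c)%N -> (a + b + c = k)%N ->
      zetaf [:: a; b; c] =
        (-1) ^+ (b - 1) *
          \sum_(1 <= n < k - 1)
             ('C(n, a) * 'C(k - 1 - n, c))%:R * zetaf [:: n; 1%N; (k - 1 - n)%N]
        + (-1) ^+ (a + c) *
          \sum_(1 <= i < b)
             ('C(a + i, a) * 'C(b + c - i, c))%:R * (zf (a + i) * zf (b + c - i))) ->
   forall p : QXY, Weven k p ->
     \sum_(i < nod k)
        chat p i *: zetaf [:: (od i - 1)%N; 1%N; (k - od i - 1)%N; 1%N] = 0 :> Zf)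
  /\
  (\det (Amx k) != 0 ->
     (forall c : 'rV[rat]_(nod k),
        \sum_(i < nod k) c 0 i *: Hdz k (od i) (k - od i) = 0 :> Dtilde k
        <-> c \in spanp (fun v : 'rV[rat]_(nod k) =>
                           exists2 p : QXY, Weven k p & v = \row_i chat p i))
     /\
     (forall p : QXY, Weven k p -> (forall i : 'I_(nod k), chat p i = 0) ->
        exists a : rat, p = a *: (pX ^+ (k - 2) - pY ^+ (k - 2)))).
Proof.
have H1 p : Weven k p -> \sum_(i < nod k) chat p i *: Hdz k (od i) (k - od i) = 0.
  move=> /(chat_Hdz k_ge6 k_even) e; rewrite -[RHS]e; apply: eq_bigr => i _.
  by rewrite mxE.
split; first exact: H1.
split.
  move=> p /H1; apply: (model_relation k_ge6 k_even).
  - exact: zetaA_stuffle.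
  - exact: zetaA_rev.
  - exact: zetaA1.
  by move=> a b c; exact: zetaA3.
split.
  move=> zetaf3 p /H1; apply: (model_relation k_ge6 k_even).
  - exact: zetaf_stuffle.
  - exact: zetaf_rev.
  - exact: zetaf1.
  exact: zetaf3.
move=> d0; split=> [c|p Wp c0]; last exact: chat_eq0 d0 Wp c0.
split=> [/(chat_spans k_ge6 k_even d0)[p Wp ->]|/spanpP[s sW ->]].
  apply/spanpP; exists [:: ((2%:R * \det (Amx k))^-1, \row_i chat p i)]; last by rewrite big_seq1.
  by move=> t; rewrite inE => /eqP ->; exists p.
transitivity (\sum_(t <- s) t.1 *: \sum_(i < nod k) t.2 0 i *: Hdz k (od i) (k - od i)).
  under [RHS]eq_bigr => t _ do rewrite scaler_sumr.
  rewrite exchange_big; apply: eq_bigr => i _; rewrite summxE scaler_suml.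
  by apply: eq_bigr => t _; rewrite mxE scalerA.
rewrite big_seq big1 // => t /sW[p Wp ->].
by rewrite chat_Hdz // scaler0.
Qed.
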